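(* Let $0 < \kappa < 1$, $\lambda = \sqrt{1-\kappa^2}$, and let $p_\kappa = \wp(\,\cdot\,; g_2, g_3)$ with $g_2 = \tfrac{4}{27}(8\lambda^2 + 1)$ and $g_3 = \tfrac{8}{729}(8\lambda^4 + 20\lambda^2 - 1)$. The period lattice of $p_\kappa$ is rectangular, generated by $2\omega_\kappa$ and $2\omega_\kappa'$ with $\omega_\kappa > 0$ real and $\omega_\kappa'$ purely imaginary with positive imaginary part. Then $$\omega_\kappa = \tfrac{1}{2}\pi \,_2F_1 (\tfrac{1}{3}, \tfrac{2}{3}; 1; \kappa^2) \quad\text{and}\quad \omega_\kappa' = {\rm i}\, \tfrac{\sqrt3}{2}\pi \,_2F_1 (\tfrac{1}{3}, \tfrac{2}{3}; 1; \lambda^2).$$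
   Context: $\wp(\,\cdot\,; g_2, g_3)$ denotes the Weierstrass elliptic function with invariants $g_2, g_3$; $\,_2F_1$ is the Gauss hypergeometric function. *)

(* Defs.v *)
From Coquelicot Require Import Coquelicot.
From Stdlib Require Import Reals ZArith.
Open Scope R_scope.

Fixpoint poch (a : R) (n : nat) : R :=
  match n with O => 1 | S k => poch a k * (a + INR k) end.

(* Gauss hypergeometric series 2F1(a,b;c;z) = sum_n (a)_n (b)_n / ((c)_n n!) z^n,
   used here for real z with |z| < 1 (where it converges). *)
Definition hyp2F1 (a b c z : R) : R :=
  Series (fun n => poch a n * poch b n / (poch c n * INR (fact n)) * z ^ n).

Fixpoint Cpow (z : Complex.C) (n : nat) : Complex.C :=
  match n with O => RtoC 1 | S k => Cmult (Cpow z k) z end.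

Definition latpt (w1 w2 : Complex.C) (m n : Z) : Complex.C :=
  Cplus (Cmult (RtoC (2 * IZR m)) w1) (Cmult (RtoC (2 * IZR n)) w2).

Definition eis_partial (k : nat) (w1 w2 : Complex.C) (N : nat) : Complex.C :=
  sum_n (fun i => sum_n (fun j =>
      let m := (Z.of_nat i - Z.of_nat N)%Z in
      let n := (Z.of_nat j - Z.of_nat N)%Z in
      if (Z.eqb m 0 && Z.eqb n 0)%bool then RtoC 0
      else Cinv (Cpow (latpt w1 w2 m n) k)) (2 * N)) (2 * N).

(* The lattice generated by 2 w1, 2 w2 has Weierstrass invariants g2, g3:
   g2 = 60 sum' w^(-4), g3 = 140 sum' w^(-6)  (absolutely convergent sums,
   computed as limits of the symmetric box partial sums). *)
Definition lattice_has_invariants (w1 w2 g2 g3 : Complex.C) : Prop :=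
  filterlim (fun N => Cmult (RtoC 60) (eis_partial 4 w1 w2 N)) Hierarchy.eventually (locally g2) /\
  filterlim (fun N => Cmult (RtoC 140) (eis_partial 6 w1 w2 N)) Hierarchy.eventually (locally g3).

(* Main.v *)
Require Import Defs.
From Coquelicot Require Import Coquelicot.
From Stdlib Require Import Reals ZArith.
From Stdlib Require Import Ranalysis5 Lra Lia.
Open Scope R_scope.

(** Put [P(u)] for the sum of [1 / sinh^2 (u - n h)] over all integers [n].  The product formula
    [csq_mult] makes [P^2] telescope, so [P] satisfies a Weierstrass differential equation; its
    expansion at [u = 0] shows that, up to an additive constant, [P] is the Weierstrass function
    of the lattice generated by [h] and [i PI], the row sums of the Eisenstein series being given
    by the partial fractions of [coth].  Since [P] decreases on [(0, h/2)] to a critical point,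
    the real half-period of a rectangular lattice is the time that a solution of
    [p'^2 = 4 p^3 - g2 p - g3] takes to come from infinity to rest; rotating the lattice by a
    right angle gives the imaginary half-period with [g3] replaced by [- g3].

    For the invariants of the theorem, put [p = - 1/3 + kappa^2 / (9 sin^2 (z/3))] and
    [sin z = kappa sin phi]: the real time becomes the integral over [0 <= phi <= PI/2] of
    [cos (z/3) / cos z = 2F1 (1/3, 2/3; 1/2; kappa^2 sin^2 phi)], which integrates termwise to
    [PI/2 2F1 (1/3, 2/3; 1; kappa^2)].  A 3-isogeny exchanging [kappa] and [lambda] (and scaling
    by [sqrt 3]) carries the imaginary time for [kappa] to the real time for [lambda].  Finally,
    every pair [g2, g3] of positive discriminant comes from a rectangular lattice by the
    intermediate value theorem applied to [g3 / g2^(3/2)] as a function of [h]. *)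

(** * Series *)

(** The statement is about the Eisenstein sums of an explicit lattice. So a rectangular lattice with
    the right invariants is produced abstractly, and its half-periods are identified through the
    time of the Weierstrass equation, which depends on the invariants alone. Everything stays on the
    real axis: the imaginary period is reached as the real period of the rotated lattice, and the
    rotation is the exchange of the two indices of a square box. The shift by 1/3 comes from
    3-torsion. With [s = p + 1/3] and [m = 4 k^2 / 27] the curve is [y^2 = 4 s^3 - 4 (s - m)^2], and
    the line [y = 2 i (s - m)] meets it three times at [s = 0]. The points over [s = 0] thus have
    order three; as [y] is imaginary there, they lie on the imaginary axis, and the quotient by them
    keeps the real period and divides the imaginary one by three. For modulus [lambda] this quotient
    is the curve of [kappa] turned by a right angle and scaled by [sqrt 3]. *)

Lemma ex_series_dominated (a M : nat -> R) :
  (forall n, Rabs (a n) <= M n) -> ex_series M -> ex_series a.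
Proof.
  intros H HM. apply (ex_series_le (K := R_AbsRing) (V := R_CompleteNormedModule) a M); assumption.
Qed.

Lemma ex_series_Rscal (c : R) (a : nat -> R) : ex_series a -> ex_series (fun n => c * a n).
Proof. exact (ex_series_scal (K := R_AbsRing) (V := R_NormedModule) c a). Qed.

Lemma ex_series_Rplus (a b : nat -> R) :
  ex_series a -> ex_series b -> ex_series (fun n => a n + b n).
Proof. exact (ex_series_plus (K := R_AbsRing) (V := R_NormedModule) a b). Qed.

Lemma is_lim_seq_sum_n (a : nat -> R) : ex_series a -> is_lim_seq (sum_n a) (Series a).
Proof. intros H. apply Series_correct in H. exact H. Qed.

Lemma Series_tail_le (a M : nat -> R) (N : nat) :
  (forall n, Rabs (a n) <= M n) -> ex_series M ->
  Rabs (Series a - sum_n a N) <= Series M - sum_n M N.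
Proof.
  intros H HM.
  pose proof (ex_series_dominated a M H HM) as Ha.
  rewrite (Series_incr_n a (S N)), (Series_incr_n M (S N)) by (assumption || lia).
  simpl Init.Nat.pred. rewrite <- !sum_n_Reals.
  unfold Rminus. rewrite !(Rplus_comm (sum_n _ N)), !Rplus_assoc, !Rplus_opp_r, !Rplus_0_r.
  apply ex_series_incr_n with (n := S N) in HM.
  eapply Rle_trans; [apply Series_Rabs|].
  - apply ex_series_dominated with (fun k => M (S N + k)%nat); [|exact HM].
    intros n. rewrite Rabs_Rabsolu. apply H.
  - apply Series_le; [|exact HM]. intros n; split; [apply Rabs_pos|apply H].
Qed.

Lemma Series_tail_small (M : nat -> R) (eps : R) :
  ex_series M -> 0 < eps -> exists N, forall n, (N <= n)%nat -> Rabs (Series M - sum_n M n) < eps.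
Proof.
  intros HM He. pose proof (is_lim_seq_sum_n M HM) as HL.
  apply is_lim_seq_spec in HL. destruct (HL (mkposreal eps He)) as [N HN].
  exists N. intros n Hn. rewrite Rabs_minus_sym. apply (HN n Hn).
Qed.

Lemma continuous_sum_n (f : nat -> R -> R) (x0 : R) (N : nat) :
  (forall n, continuous (f n) x0) -> continuous (fun x => sum_n (fun n => f n x) N) x0.
Proof.
  intros H. induction N as [|N IH].
  - apply continuous_ext with (f 0%nat); [|apply H]. intros x; now rewrite sum_O.
  - apply continuous_ext with (fun x => plus (sum_n (fun n => f n x) N) (f (S N) x)).
    + intros x; now rewrite sum_Sn.
    + apply (continuous_plus (fun x => sum_n (fun n => f n x) N)); [exact IH|apply H].
Qed.

Lemma continuous_Series (f : nat -> R -> R) (M : nat -> R) (x0 : R) :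
  locally x0 (fun x => forall n, Rabs (f n x) <= M n) -> ex_series M ->
  (forall n, continuous (f n) x0) -> continuous (fun x => Series (fun n => f n x)) x0.
Proof.
  intros Hb HM Hc. apply filterlim_locally. intros eps.
  assert (He : 0 < eps/3) by (destruct eps; simpl; lra).
  destruct (Series_tail_small M (eps/3) HM He) as [N HN].
  specialize (HN N (Nat.le_refl N)).
  pose proof (continuous_sum_n f x0 N Hc) as HS.
  pose proof (proj1 (filterlim_locally _ _) HS (mkposreal (eps/3) He)) as HS'.
  pose proof (locally_singleton _ _ Hb) as H0.
  generalize (filter_and _ _ HS' Hb). apply filter_imp. intros x [H1 H2].
  pose proof (Series_tail_le (fun n => f n x) M N H2 HM) as T1.
  pose proof (Series_tail_le (fun n => f n x0) M N H0 HM) as T0.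
  change (Rabs (sum_n (fun n => f n x) N - sum_n (fun n => f n x0) N) < eps/3) in H1.
  change (Rabs (Series (fun n => f n x) - Series (fun n => f n x0)) < eps).
  apply Rabs_def2 in H1. apply Rabs_def2 in HN.
  apply Rabs_le_between in T1. apply Rabs_le_between in T0.
  apply Rabs_def1; lra.
Qed.

(* The difference quotients, completed by the derivative at [t = 0], are dominated by [M]
   thanks to the mean value theorem, so [continuous_Series] applies to them. *)
Lemma is_derive_Series (f f' : nat -> R -> R) (M : nat -> R) (x0 : R) :
  locally x0 (fun x => forall n, is_derive (f n) x (f' n x) /\ Rabs (f' n x) <= M n) ->
  locally x0 (fun x => ex_series (fun n => f n x)) -> ex_series M ->
  is_derive (fun x => Series (fun n => f n x)) x0 (Series (fun n => f' n x0)).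
Proof.
  intros [d1 Hd1] [d2 Hd2] HM.
  set (q := fun n t => if Req_EM_T t 0 then f' n x0 else (f n (x0 + t) - f n x0) / t).
  assert (Hq : continuous (fun t => Series (fun n => q n t)) 0).
  { apply continuous_Series with M; [|exact HM|].
    - exists d1. intros t Ht n. change (Rabs (t - 0) < d1) in Ht. rewrite Rminus_0_r in Ht.
      unfold q. destruct (Req_EM_T t 0) as [E|E].
      + apply Hd1. apply ball_center.
      + assert (Hin : forall y, Rmin x0 (x0 + t) <= y <= Rmax x0 (x0 + t) -> ball x0 d1 y).
        { intros y Hy. change (Rabs (y - x0) < d1). apply Rabs_def2 in Ht.
          unfold Rmin, Rmax in Hy. destruct (Rle_dec x0 (x0 + t)); apply Rabs_def1; lra. }
        destruct (MVT_gen (f n) x0 (x0 + t) (f' n)) as [c [Hc E2]].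
        * intros y Hy. apply Hd1, Hin; lra.
        * intros y Hy. apply continuity_pt_filterlim, (ex_derive_continuous (f n)).
          eexists. apply Hd1, Hin, Hy.
        * rewrite E2. replace (f' n c * (x0 + t - x0) / t) with (f' n c) by (field; assumption).
          apply Hd1, Hin, Hc.
    - intros n. apply filterlim_locally. intros eps.
      destruct (Hd1 x0 (ball_center _ _) n) as [HD _].
      apply is_derive_Reals in HD. destruct (HD eps (cond_pos eps)) as [d Hd].
      exists d. intros t Ht. change (Rabs (t - 0) < d) in Ht. rewrite Rminus_0_r in Ht.
      change (Rabs (q n t - q n 0) < eps). unfold q.
      destruct (Req_EM_T 0 0) as [_|]; [|lra].
      destruct (Req_EM_T t 0) as [E|E].
      + rewrite Rminus_diag, Rabs_R0. apply cond_pos.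
      + apply Hd; assumption. }
  apply is_derive_Reals. intros eps He.
  destruct (proj1 (filterlim_locally _ _) Hq (mkposreal eps He)) as [d3 Hd3].
  assert (Hm : 0 < Rmin d2 d3) by (apply Rmin_glb_lt; apply cond_pos).
  exists (mkposreal _ Hm). intros t Ht Hlt. simpl in Hlt.
  assert (L2 : Rabs t < d2) by (eapply Rlt_le_trans; [exact Hlt|apply Rmin_l]).
  assert (L3 : Rabs t < d3) by (eapply Rlt_le_trans; [exact Hlt|apply Rmin_r]).
  assert (B : ball 0 d3 t) by (change (Rabs (t - 0) < d3); rewrite Rminus_0_r; exact L3).
  specialize (Hd3 t B).
  change (Rabs (Series (fun n => q n t) - Series (fun n => q n 0)) < eps) in Hd3.
  replace (Series (fun n => q n 0)) with (Series (fun n => f' n x0)) in Hd3.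
  2:{ apply Series_ext. intros n. unfold q. destruct (Req_EM_T 0 0); [reflexivity|lra]. }
  replace (Series (fun n => q n t)) with
    ((Series (fun n => f n (x0 + t)) - Series (fun n => f n x0)) / t) in Hd3; [exact Hd3|].
  rewrite <- Series_minus.
  - unfold Rdiv. rewrite <- Series_scal_r. apply Series_ext. intros n. unfold q.
    destruct (Req_EM_T t 0); [contradiction|reflexivity].
  - apply Hd2. change (Rabs (x0 + t - x0) < d2). now replace (x0 + t - x0) with t by ring.
  - apply Hd2, ball_center.
Qed.

Lemma derive_0_constant (K : R -> R) (a b : R) :
  (forall t, a < t < b -> is_derive K t 0) ->
  forall x y, a < x < b -> a < y < b -> K x = K y.
Proof.
  intros HK x y Hx Hy.
  assert (Hin : forall t, Rmin x y <= t <= Rmax x y -> a < t < b).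
  { intros t Ht. unfold Rmin, Rmax in Ht. destruct (Rle_dec x y); lra. }
  destruct (MVT_gen K x y (fun _ => 0)) as [c [_ Hc]].
  - intros t Ht. apply HK, Hin. lra.
  - intros t Ht. apply continuity_pt_filterlim, (ex_derive_continuous K t).
    exists 0. apply HK, Hin, Ht.
  - lra.
Qed.

Lemma continuous_eps (f : R -> R) (x eps : R) : continuous f x -> 0 < eps ->
  exists d, 0 < d /\ forall y, Rabs (y - x) < d -> Rabs (f y - f x) < eps.
Proof.
  intros Hf He. destruct (proj1 (filterlim_locally _ _) Hf (mkposreal eps He)) as [d Hd].
  exists d. split; [apply cond_pos|]. intros y Hy. exact (Hd y Hy).
Qed.

Lemma is_derive_RInt_cont (w : R -> R) (x : R) :
  (forall t, continuous w t) -> is_derive (fun x => RInt w 0 x) x (w x).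
Proof.
  intros Hw. apply (is_derive_RInt w _ 0 x); [|apply Hw].
  apply filter_forall. intros y. apply (RInt_correct w).
  apply (ex_RInt_continuous w). intros z _. apply Hw.
Qed.

(** Separation of variables: [w x] is the time spent per unit of position. The difference
    [RInt w 0 (psi u) - u] has zero derivative on [(0, a)] and tends to 0 at 0. An arc has its pole
    there, so the initial condition is a limit and not a value. *)
Lemma time_of_flight (w psi dpsi : R -> R) (a : R) :
  (forall x, continuous w x) ->
  (forall u, 0 < u < a -> is_derive psi u (dpsi u) /\ w (psi u) * dpsi u = 1) ->
  (forall eps, 0 < eps -> exists d, 0 < d /\ forall u, 0 < u < d -> u < a -> Rabs (psi u) < eps) ->
  forall u, 0 < u < a -> RInt w 0 (psi u) = u.
Proof.
  intros Hw Hpsi H0 u Hu.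
  set (G := fun x => RInt w 0 x).
  assert (HG : forall x, is_derive G x (w x)) by (intros x; apply is_derive_RInt_cont, Hw).
  set (K := fun t => G (psi t) - t).
  assert (HK : forall t, 0 < t < a -> is_derive K t 0).
  { intros t Ht. destruct (Hpsi t Ht) as [D E].
    replace 0 with (minus (scal (dpsi t) (w (psi t))) 1)
      by (unfold minus, plus, opp, scal; simpl; unfold mult; simpl; lra).
    apply (is_derive_minus (fun t => G (psi t)) (fun t => t)).
    - apply (is_derive_comp G psi); [apply HG|exact D].
    - apply (is_derive_id t). }
  assert (E0 : forall eps, 0 < eps -> Rabs (K u) <= eps).
  { intros eps He.
    destruct (continuous_eps G 0 (eps/2)) as [d1 [Hd1 C]]; [|lra|].
    { apply (ex_derive_continuous G). eexists; apply HG. }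
    destruct (H0 d1 Hd1) as [d2 [Hd2 C2]].
    set (t := Rmin (Rmin (d2/2) (a/2)) (eps/2)).
    assert (Ht : 0 < t /\ t <= d2/2 /\ t <= a/2 /\ t <= eps/2).
    { unfold t. repeat split.
      - repeat apply Rmin_glb_lt; lra.
      - eapply Rle_trans; [apply Rmin_l|apply Rmin_l].
      - eapply Rle_trans; [apply Rmin_l|apply Rmin_r].
      - apply Rmin_r. }
    rewrite (derive_0_constant K 0 a HK u t) by lra.
    specialize (C2 t ltac:(lra) ltac:(lra)).
    specialize (C (psi t)). rewrite Rminus_0_r in C. specialize (C C2).
    replace (G 0) with 0 in C by (unfold G; rewrite RInt_point; reflexivity).
    unfold K. apply Rabs_def2 in C. apply Rabs_le; lra. }
  assert (K u = 0).
  { destruct (Req_dec (K u) 0) as [E|E]; [exact E|exfalso].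
    pose proof (Rabs_pos_lt _ E). specialize (E0 (Rabs (K u) / 2)). lra. }
  apply Rminus_diag_uniq. exact H.
Qed.

(** * The hypergeometric integral *)

(** Coefficients of [2F1 (1/3, 2/3; 1/2; x)]. The lower parameter is 1/2 because the integral of
    [sin^(2n)] brings a factor [(1/2)_n / n!], which leaves the lower parameter 1. *)
Definition hcoef (n : nat) : R :=
  poch (1/3) n * poch (2/3) n / (poch (1/2) n * INR (fact n)).

Lemma poch_pos (a : R) (n : nat) : 0 < a -> 0 < poch a n.
Proof.
  intros Ha; induction n as [|n IH]; simpl; [lra|].
  apply Rmult_lt_0_compat; [exact IH|]. pose proof (pos_INR n); lra.
Qed.

Lemma poch_1 (n : nat) : poch 1 n = INR (fact n).
Proof.
  induction n as [|n IH]; [reflexivity|].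
  change (fact (S n)) with (S n * fact n)%nat.
  rewrite mult_INR, S_INR. simpl poch. rewrite IH. ring.
Qed.

Lemma hcoef_S (n : nat) :
  hcoef (S n) * ((INR n + 1) * (INR n + 1/2)) =
  hcoef n * ((INR n + 1/3) * (INR n + 2/3)).
Proof.
  unfold hcoef. change (fact (S n)) with (S n * fact n)%nat.
  rewrite mult_INR, S_INR. simpl poch.
  pose proof (poch_pos (1/2) n ltac:(lra)). pose proof (INR_fact_lt_0 n).
  pose proof (pos_INR n). field. repeat split; lra.
Qed.

Lemma hcoef_bounds (n : nat) : 0 < hcoef n <= 1.
Proof.
  assert (Hp : forall m, 0 < hcoef m).
  { intros m. unfold hcoef. apply Rdiv_lt_0_compat; apply Rmult_lt_0_compat;
      try (apply poch_pos; lra). apply INR_fact_lt_0. }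
  split; [apply Hp|].
  induction n as [|n IH]; [unfold hcoef; simpl; lra|].
  pose proof (hcoef_S n). pose proof (pos_INR n). pose proof (Hp n). pose proof (Hp (S n)).
  assert (0 < (INR n + 1) * (INR n + 1/2)) by nra.
  apply Rmult_le_reg_r with ((INR n + 1) * (INR n + 1/2)); [assumption|].
  rewrite H. apply Rle_trans with (1 * ((INR n + 1/3) * (INR n + 2/3))); [|nra].
  apply Rmult_le_compat_r; nra.
Qed.

Lemma hcoef_radius (x : R) : Rabs x < 1 -> Rbar_lt (Rabs x) (CV_radius hcoef).
Proof.
  intros Hx. apply Rbar_lt_le_trans with 1; [exact Hx|].
  apply CV_radius_bounded. exists 1. intros n.
  rewrite pow1, Rmult_1_r, Rabs_pos_eq; apply hcoef_bounds || apply Rlt_le, hcoef_bounds.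
Qed.

Definition hfun (x : R) : R := PSeries hcoef x.
Definition hfun1 (x : R) : R := PSeries (PS_derive hcoef) x.
Definition hfun2 (x : R) : R := PSeries (PS_derive (PS_derive hcoef)) x.

Lemma is_derive_hfun (x : R) : Rabs x < 1 -> is_derive hfun x (hfun1 x).
Proof. intros Hx. apply is_derive_PSeries, hcoef_radius, Hx. Qed.

Lemma is_derive_hfun1 (x : R) : Rabs x < 1 -> is_derive hfun1 x (hfun2 x).
Proof.
  intros Hx. apply is_derive_PSeries. rewrite CV_radius_derive. apply hcoef_radius, Hx.
Qed.

Lemma hfun_0 : hfun 0 = 1.
Proof. unfold hfun. rewrite PSeries_0. unfold hcoef; simpl; field. Qed.

(** Gauss's equation for parameters 1/3, 2/3, 1/2: the coefficient of [x^n] on the left is the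
    recurrence [hcoef_S n]. Indices 0 and 1 stand apart because [x^2 F''] starts at degree two. *)
Lemma hfun_ode (x : R) : Rabs x < 1 ->
  x * (1 - x) * hfun2 x + (1/2 - 2 * x) * hfun1 x - 2/9 * hfun x = 0.
Proof.
  intros Hx.
  assert (E0 : ex_pseries hcoef x) by (apply CV_radius_inside, hcoef_radius, Hx).
  assert (E1 : ex_pseries (PS_derive hcoef) x).
  { apply CV_radius_inside. rewrite CV_radius_derive. apply hcoef_radius, Hx. }
  assert (E2 : ex_pseries (PS_derive (PS_derive hcoef)) x).
  { apply CV_radius_inside. rewrite !CV_radius_derive. apply hcoef_radius, Hx. }
  apply PSeries_correct in E0. apply PSeries_correct in E1. apply PSeries_correct in E2.
  pose proof (is_pseries_incr_1 _ _ _ E2) as E3.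
  pose proof (is_pseries_incr_1 _ _ _ E3) as E4.
  pose proof (is_pseries_incr_1 _ _ _ E1) as E5.
  pose proof (is_pseries_minus _ _ _ _ _ E3 E4) as F1.
  pose proof (is_pseries_scal (1/2) _ _ _ (Rmult_comm _ _) E1) as F2.
  pose proof (is_pseries_scal (2) _ _ _ (Rmult_comm _ _) E5) as F3.
  pose proof (is_pseries_scal (2/9) _ _ _ (Rmult_comm _ _) E0) as F4.
  pose proof (is_pseries_minus _ _ _ _ _
    (is_pseries_minus _ _ _ _ _ (is_pseries_plus _ _ _ _ _ F1 F2) F3) F4) as F.
  apply is_pseries_unique in F.
  rewrite (PSeries_ext _ (fun _ => 0)) in F.
  - rewrite PSeries_const_0 in F.
    fold (hfun x) in F. fold (hfun1 x) in F. fold (hfun2 x) in F.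
    unfold minus, plus, opp, scal in F; simpl in F. unfold mult in F; simpl in F. nra.
  - intros n. unfold PS_minus, PS_plus, PS_opp, PS_scal, PS_incr_1, PS_derive.
    unfold minus, plus, opp, scal, zero; simpl. unfold mult; simpl.
    destruct n as [|[|n]]; simpl.
    + pose proof (hcoef_S 0). simpl in H. lra.
    + pose proof (hcoef_S 1). simpl in H. lra.
    + pose proof (hcoef_S (S (S n))) as H. rewrite !S_INR in H.
      pose proof (pos_INR n).
      change (match n with | 0%nat => 1 | S _ => INR n + 1 end) with (INR (S n)).
      rewrite !S_INR. lra.
Qed.

Ltac rewrite_Derive D :=
  match type of D with is_derive ?f ?x ?l =>
    replace (Derive (fun y : R => f y) x) with l
      by (symmetry; apply is_derive_unique; exact D) end.

Ltac solve_ex_derive :=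
  repeat match goal with |- _ /\ _ => split end; try exact I; eexists; eassumption.

Lemma ode_cos_third (g g1 : R -> R) (b : R) :
  (forall x, 0 <= x <= b -> is_derive g x (g1 x)) ->
  (forall x, 0 <= x <= b -> is_derive g1 x (- (1/9) * g x)) ->
  g 0 = 1 -> g1 0 = 0 -> forall x, 0 <= x <= b -> g x = cos (x/3).
Proof.
  intros H1 H2 H0 H0' x Hx.
  (* The vector [(g, 3 g')] rotates with angular speed 1/3; [P] and [Q] are its coordinates in a
     frame rotating with it, hence constant. *)
  set (P := fun x => g x * cos (x/3) - 3 * g1 x * sin (x/3)).
  set (Q := fun x => g x * sin (x/3) + 3 * g1 x * cos (x/3)).
  assert (HC : forall K : R -> R, (forall t, 0 <= t <= b -> is_derive K t 0) -> K x = K 0).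
  { intros K HK. destruct (MVT_gen K 0 x (fun _ => 0)) as [c [_ Hc]].
    - intros t Ht. apply HK. rewrite Rmin_left, Rmax_right in Ht; lra.
    - intros t Ht. apply continuity_pt_filterlim.
      apply (ex_derive_continuous K t). exists 0. apply HK.
      rewrite Rmin_left, Rmax_right in Ht; lra.
    - lra. }
  assert (EP : P x = P 0).
  { apply HC. intros t Ht. unfold P.
    pose proof (H1 t Ht) as D1. pose proof (H2 t Ht) as D2.
    auto_derive.
    - solve_ex_derive.
    - rewrite_Derive D1; rewrite_Derive D2. field. }
  assert (EQ : Q x = Q 0).
  { apply HC. intros t Ht. unfold Q.
    pose proof (H1 t Ht) as D1. pose proof (H2 t Ht) as D2.
    auto_derive.
    - solve_ex_derive.
    - rewrite_Derive D1; rewrite_Derive D2. field. }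
  unfold P, Q in EP, EQ. rewrite H0, H0' in EP, EQ.
  replace (0/3) with 0 in EP, EQ by field. rewrite cos_0, sin_0 in EP, EQ.
  pose proof (sin2_cos2 (x/3)) as T. unfold Rsqr in T.
  rewrite <- (Rmult_1_r (g x)), <- T.
  transitivity (cos (x/3) * (g x * cos (x/3) - 3 * g1 x * sin (x/3))
    + sin (x/3) * (g x * sin (x/3) + 3 * g1 x * cos (x/3))); [ring|].
  rewrite EP, EQ. ring.
Qed.

(** The substitution [x = sin^2 z] turns Gauss's equation for [F] into [g'' = - g / 9] for
    [g = cos z F (sin^2 z)], with [g 0 = 1] and [g' 0 = 0]; [cos (z/3)] solves the same problem. *)
Lemma hfun_sin (z : R) : 0 <= z < PI/2 -> cos z * hfun (sin z ^ 2) = cos (z/3).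
Proof.
  intros Hz.
  assert (Hr : forall t, 0 <= t <= z -> Rabs (sin t ^ 2) < 1).
  { intros t Ht. pose proof (sin2_cos2 t) as T. unfold Rsqr in T.
    assert (0 < cos t) by (apply cos_gt_0; lra).
    rewrite Rabs_pos_eq; nra. }
  apply (ode_cos_third (fun z => cos z * hfun (sin z ^ 2))
     (fun z => - sin z * hfun (sin z ^ 2) + cos z ^ 2 * (2 * sin z * hfun1 (sin z ^ 2))) z).
  - intros t Ht. pose proof (is_derive_hfun _ (Hr t Ht)) as D.
    auto_derive.
    + change (sin t * (sin t * 1)) with (sin t ^ 2). solve_ex_derive.
    + replace (sin t * (sin t * 1)) with (sin t ^ 2) by ring.
      rewrite_Derive D. ring.
  - intros t Ht. pose proof (is_derive_hfun _ (Hr t Ht)) as D.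
    pose proof (is_derive_hfun1 _ (Hr t Ht)) as D1.
    auto_derive.
    + change (sin t * (sin t * 1)) with (sin t ^ 2). solve_ex_derive.
    + replace (sin t * (sin t * 1)) with (sin t ^ 2) by ring.
      rewrite_Derive D; rewrite_Derive D1.
      pose proof (hfun_ode _ (Hr t Ht)) as O.
      assert (T : cos t ^ 2 = 1 - sin t ^ 2).
      { pose proof (sin2_cos2 t) as T. unfold Rsqr in T. lra. }
      set (F0 := hfun (sin t ^ 2)) in *. set (F1 := hfun1 (sin t ^ 2)) in *. set (F2 := hfun2 (sin t ^ 2)) in *.
      set (c := cos t) in *. set (s := sin t) in *.
      apply Rminus_diag_uniq.
      (* The residual is [4 cos t] times Gauss's equation, up to multiples of
         [cos^2 + sin^2 - 1]. *)
      transitivity (4 * c * (s ^ 2 * (1 - s ^ 2) * F2 + (1/2 - 2 * s ^ 2) * F1 - 2 / 9 * F0)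
        + 4 * c * s ^ 2 * F2 * (c ^ 2 - (1 - s ^ 2)) + 2 * c * F1 * (c ^ 2 - (1 - s^2))).
      * field.
      * rewrite O, T. ring.
  - rewrite cos_0, sin_0. replace (0 ^ 2) with 0 by ring. rewrite hfun_0. ring.
  - rewrite sin_0. ring.
  - lra.
Qed.

(** Algebraic form of [hfun_sin]: for [y = sin t] and [z = 3 t], [sin z = 3 y - 4 y^3] and
    [cos z = cos t (1 - 4 y^2)], and [cos t] cancels. The bound [y < 1/2] says [z < PI/2]. *)
Lemma hfun_triple (y : R) : 0 <= y < 1/2 ->
  hfun ((3 * y - 4 * y ^ 3) ^ 2) = / (1 - 4 * y ^ 2).
Proof.
  intros Hy. pose proof PI_RGT_0.
  set (t := asin y).
  assert (St : sin t = y) by (apply sin_asin; lra).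
  assert (Ht0 : 0 <= t).
  { destruct (Rle_lt_dec 0 t) as [h|h]; [exact h|exfalso].
    pose proof (asin_bound y) as B. fold t in B.
    assert (sin t < sin 0) by (apply sin_increasing_1; lra). rewrite sin_0 in *. lra. }
  assert (Ht1 : t < PI/6).
  { destruct (Rlt_le_dec t (PI/6)) as [h|h]; [exact h|exfalso].
    assert (t <= PI/2) by apply asin_bound.
    assert (sin (PI/6) <= sin t) by (apply sin_incr_1; lra).
    rewrite sin_PI6 in H1. lra. }
  pose proof (hfun_sin (3 * t) ltac:(lra)) as HS.
  replace (3 * t / 3) with t in HS by field.
  assert (S3 : sin (3 * t) = 3 * y - 4 * y ^ 3).
  { replace (3 * t) with (2 * t + t) by ring. rewrite sin_plus, sin_2a, cos_2a_sin.
    pose proof (sin2_cos2 t) as T. unfold Rsqr in T.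
    rewrite St in *.
    replace (2 * y * cos t * cos t) with (2 * y * (cos t * cos t)) by ring.
    replace (cos t * cos t) with (1 - y * y) by lra. ring. }
  assert (C3 : cos (3 * t) = cos t * (1 - 4 * y ^ 2)).
  { replace (3 * t) with (2 * t + t) by ring. rewrite cos_plus, sin_2a, cos_2a_sin. rewrite St. ring. }
  assert (0 < cos t) by (apply cos_gt_0; lra).
  rewrite S3, C3 in HS.
  assert (0 < 1 - 4 * y ^ 2) by nra.
  apply Rmult_eq_reg_l with (cos t * (1 - 4 * y ^ 2)); [|nra].
  rewrite HS. field. lra.
Qed.

(** Wallis's recurrence, from integrating the derivative of [cos t sin^(2n+1) t], which vanishes at
    both ends. *)
Lemma is_RInt_sin_pow (n : nat) :
  is_RInt (fun t => sin t ^ (2 * n)) 0 (PI/2) (PI/2 * (poch (1/2) n / INR (fact n))).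
Proof.
  induction n as [|n IH].
  - simpl. apply is_RInt_ext with (fun _ => 1); [reflexivity|].
    replace (PI/2 * (1/1)) with (scal (PI/2 - 0) 1) by (unfold scal; simpl; unfold mult; simpl; field).
    apply (is_RInt_const 0 (PI/2) 1).
  - pose proof (pos_INR n) as Hn. pose proof (INR_fact_lt_0 n) as Hf.
    assert (D : is_RInt (fun t => (2 * INR n + 1) * sin t ^ (2 * n) - (2 * INR n + 2) * sin t ^ (2 * S n))
                 0 (PI/2) (minus (cos (PI/2) * sin (PI/2) ^ (S (2 * n))) (cos 0 * sin 0 ^ (S (2 * n))))).
    { apply (is_RInt_derive (fun t => cos t * sin t ^ (S (2 * n)))).
      - intros t _. auto_derive; [exact I|].
        change (match (n + (n + 0))%nat with 0%nat => 1 | S _ => INR (n + (n + 0)) + 1 end)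
          with (INR (S (2 * n))). change (n + (n + 0))%nat with (2 * n)%nat.
        rewrite S_INR, mult_INR. change (INR 2) with 2.
        replace (2 * S n)%nat with (S (S (2 * n))) by lia. rewrite <- !tech_pow_Rmult.
        pose proof (sin2_cos2 t) as T. unfold Rsqr in T.
        set (P := sin t ^ (2 * n)).
        transitivity ((2 * INR n + 1) * P * (cos t * cos t) - sin t * sin t * P); [ring|].
        replace (cos t * cos t) with (1 - sin t * sin t) by lra. ring.
      - intros t _. apply (ex_derive_continuous (fun t => (2 * INR n + 1) * sin t ^ (2 * n) - (2 * INR n + 2) * sin t ^ (2 * S n))).
        auto_derive. exact I. }
    replace (minus (cos (PI/2) * sin (PI/2) ^ (S (2 * n))) (cos 0 * sin 0 ^ (S (2 * n)))) with 0 in D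
      by (rewrite cos_PI2, sin_0; unfold minus, plus, opp; simpl; ring).
    pose proof (is_RInt_scal _ _ _ (/ (2 * INR n + 2)) _
      (is_RInt_minus _ _ _ _ _ _ (is_RInt_scal _ _ _ (2 * INR n + 1) _ IH) D)) as D2.
    replace (PI/2 * (poch (1/2) (S n) / INR (fact (S n)))) with
      (scal (/ (2 * INR n + 2)) (minus (scal (2 * INR n + 1) (PI/2 * (poch (1/2) n / INR (fact n))))
         0)).
    + eapply is_RInt_ext; [|exact D2].
      intros t _. unfold minus, plus, opp, scal; simpl; unfold mult; simpl. field. lra.
    + unfold minus, plus, opp, scal; simpl; unfold mult; simpl.
      change (fact n + n * fact n)%nat with (S n * fact n)%nat.
      rewrite mult_INR, S_INR. field. lra.
Qed.

(** Convergence is uniform in [t]: as [hcoef n <= 1], the term of index [n] is at most [k^(2n)]. In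
    the integrated series, the factor [(1/2)_n] of Wallis's integral cancels the one in the
    denominator of [hcoef]. *)
Lemma is_RInt_hfun_sin (k : R) : 0 <= k < 1 ->
  is_RInt (fun t => hfun ((k * sin t) ^ 2)) 0 (PI/2) (PI/2 * hyp2F1 (1/3) (2/3) 1 (k ^ 2)).
Proof.
  intros Hk.
  set (M := fun n => (k ^ 2) ^ n).
  assert (HM : ex_series M) by (apply ex_series_geom; rewrite Rabs_pos_eq; nra).
  assert (Hb : forall t n, Rabs (hcoef n * ((k * sin t) ^ 2) ^ n) <= M n).
  { intros t n. pose proof (hcoef_bounds n). pose proof (SIN_bound t).
    assert (Hs : 0 <= (k * sin t) ^ 2 <= k ^ 2).
    { rewrite Rpow_mult_distr. assert (0 <= sin t ^ 2 <= 1) by nra.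
      assert (0 <= k ^ 2) by nra. nra. }
    rewrite Rabs_mult, (Rabs_pos_eq (hcoef n)), Rabs_pos_eq by (try apply pow_le; lra).
    pose proof (pow_incr _ _ n Hs). pose proof (pow_le _ n (proj1 Hs)).
    unfold M. nra. }
  set (I := fun N => sum_n (fun n => hcoef n * (k ^ 2) ^ n * (PI/2 * (poch (1/2) n / INR (fact n)))) N).
  destruct (filterlim_RInt (fun N t => sum_n (fun n => hcoef n * ((k * sin t) ^ 2) ^ n) N) 0 (PI/2)
     Hierarchy.eventually _ (fun t => hfun ((k * sin t) ^ 2)) I) as [J [HJ HI]].
  - assert (Hp : forall n t, scal (hcoef n * (k ^ 2) ^ n) (sin t ^ (2 * n)) = hcoef n * ((k * sin t) ^ 2) ^ n).
    { intros n t. change (hcoef n * (k ^ 2) ^ n * sin t ^ (2 * n) = hcoef n * ((k * sin t) ^ 2) ^ n).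
      rewrite pow_mult, Rpow_mult_distr with (x := k), Rpow_mult_distr. ring. }
    intros N. unfold I. induction N as [|N IH].
    + apply is_RInt_ext with (fun t => hcoef 0 * ((k * sin t) ^ 2) ^ 0);
        [intros t _; now rewrite sum_O|]. rewrite sum_O.
      eapply is_RInt_ext; [|apply (is_RInt_scal _ _ _ (hcoef 0 * (k ^ 2) ^ 0) _ (is_RInt_sin_pow 0))].
      intros t _. apply Hp.
    + apply is_RInt_ext with (fun t => plus (sum_n (fun n => hcoef n * ((k * sin t) ^ 2) ^ n) N)
        (hcoef (S N) * ((k * sin t) ^ 2) ^ S N)); [intros t _; now rewrite sum_Sn|]. rewrite sum_Sn.
      apply (is_RInt_plus (fun t => sum_n (fun n => hcoef n * ((k * sin t) ^ 2) ^ n) N)); [exact IH|].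
      eapply is_RInt_ext; [|apply (is_RInt_scal _ _ _ (hcoef (S N) * (k ^ 2) ^ (S N)) _ (is_RInt_sin_pow (S N)))].
      intros t _. apply Hp.
  - apply filterlim_locally. intros eps.
    destruct (Series_tail_small M eps HM (cond_pos eps)) as [N HN].
    exists N. intros n Hn t.
    change (Rabs (sum_n (fun n => hcoef n * ((k * sin t) ^ 2) ^ n) n - hfun ((k * sin t) ^ 2)) < eps).
    rewrite Rabs_minus_sym. unfold hfun, PSeries.
    eapply Rle_lt_trans; [apply (Series_tail_le _ M n (Hb t) HM)|].
    eapply Rle_lt_trans; [apply Rle_abs|apply HN, Hn].
  - replace (PI/2 * hyp2F1 (1/3) (2/3) 1 (k ^ 2)) with J; [exact HI|].
    symmetry. unfold hyp2F1. rewrite <- Series_scal_l.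
    apply is_series_unique. unfold is_series.
    eapply filterlim_ext; [|exact HJ]. intros N. unfold I. apply sum_n_ext. intros n.
    unfold hcoef. rewrite poch_1. match goal with |- ?a = ?b => change (@eq R a b) end. field.
    pose proof (poch_pos (1/2) n ltac:(lra)). pose proof (INR_fact_lt_0 n). lra.
Qed.

(** * Arcs of the Weierstrass equation *)

(* The branch of a solution of the Weierstrass equation from its pole at [0] to the half-period [a]. *)
Record wp_arc (g2 g3 a : R) (p dp : R -> R) : Prop := {
  arc_pos : 0 < a;
  arc_derive : forall u, 0 < u < a -> is_derive p u (dp u);
  arc_neg : forall u, 0 < u < a -> dp u < 0;
  arc_eq : forall u, 0 < u < a -> dp u ^ 2 = 4 * p u ^ 3 - g2 * p u - g3;
  arc_0 : forall K, exists d, 0 < d /\ forall u, 0 < u < d -> u < a -> K < p u;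
  arc_a : forall eps, 0 < eps -> exists d, 0 < d /\ forall u, a - d < u < a -> 0 < u -> - eps < dp u }.

Lemma arc_continuity_pt (g2 g3 a : R) (p dp : R -> R) (u : R) :
  wp_arc g2 g3 a p dp -> 0 < u < a -> continuity_pt p u.
Proof.
  intros H Hu. apply continuity_pt_filterlim, (ex_derive_continuous p).
  eexists. apply (arc_derive _ _ _ _ _ H u Hu).
Qed.

Lemma arc_large_before (g2 g3 a : R) (p dp : R -> R) (K u : R) :
  wp_arc g2 g3 a p dp -> 0 < u < a -> exists t, 0 < t < u /\ K < p t.
Proof.
  intros H Hu. destruct (arc_0 _ _ _ _ _ H K) as [d [Hd C]].
  exists (Rmin (d/2) (u/2)).
  pose proof (Rmin_l (d/2) (u/2)). pose proof (Rmin_r (d/2) (u/2)).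
  assert (0 < Rmin (d/2) (u/2)) by (apply Rmin_glb_lt; lra).
  split; [lra|]. apply C; lra.
Qed.

Lemma arc_intermediate (g2 g3 a : R) (p dp : R -> R) (x u : R) :
  wp_arc g2 g3 a p dp -> 0 < u < a -> p u <= x -> exists t, 0 < t <= u /\ p t = x.
Proof.
  intros H Hu Hx. destruct (Req_dec (p u) x) as [E|E]; [exists u; lra|].
  destruct (arc_large_before _ _ _ _ _ x u H Hu) as [t [Ht Hp]].
  destruct (IVT_interv (fun y => x - p y) t u) as [z [Hz1 Hz2]]; try lra.
  - intros y Hy. apply (continuity_pt_minus (fun _ => x) p).
    + apply continuity_pt_const. intros ? ?; reflexivity.
    + apply (arc_continuity_pt _ _ _ _ _ _ H); lra.
  - exists z. lra.
Qed.

(** [p'^2] is the cubic evaluated at [p], so [p] never takes a value where the cubic is negative;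
    coming down from infinity, it stays above all such values. *)
Lemma arc_barrier (g2 g3 a : R) (p dp : R -> R) (x u : R) :
  wp_arc g2 g3 a p dp -> 4 * x ^ 3 - g2 * x - g3 < 0 -> 0 < u < a -> x < p u.
Proof.
  intros H Hx Hu. destruct (Rlt_le_dec x (p u)) as [L|L]; [exact L|exfalso].
  destruct (arc_intermediate _ _ _ _ _ x u H Hu L) as [t [Ht E]].
  pose proof (arc_eq _ _ _ _ _ H t ltac:(lra)) as Q. rewrite E in Q.
  pose proof (pow2_ge_0 (dp t)). lra.
Qed.

(** Homogeneity of the Weierstrass equation under [u -> c u]. It sets the size of a lattice once its
    shape is known, and it carries the factor [sqrt 3]. *)
Lemma arc_scale (g2 g3 a c : R) (p dp : R -> R) :
  wp_arc g2 g3 a p dp -> 0 < c ->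
  wp_arc (c ^ 4 * g2) (c ^ 6 * g3) (a / c) (fun u => c ^ 2 * p (c * u)) (fun u => c ^ 3 * dp (c * u)).
Proof.
  intros H Hc. pose proof (arc_pos _ _ _ _ _ H) as Ha.
  assert (Hs : forall u, 0 < u < a / c -> 0 < c * u < a).
  { intros u Hu. split; [nra|]. apply Rmult_lt_reg_r with (/ c); [apply Rinv_0_lt_compat; lra|].
    replace (c * u * / c) with u by (field; lra). apply Hu. }
  constructor.
  - apply Rdiv_lt_0_compat; lra.
  - intros u Hu. pose proof (arc_derive _ _ _ _ _ H _ (Hs u Hu)) as D.
    auto_derive; [solve_ex_derive|]. rewrite_Derive D. ring.
  - intros u Hu. pose proof (arc_neg _ _ _ _ _ H _ (Hs u Hu)).
    assert (0 < c ^ 3) by (apply pow_lt; lra). nra.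
  - intros u Hu. pose proof (arc_eq _ _ _ _ _ H _ (Hs u Hu)) as E.
    rewrite Rpow_mult_distr, E. ring.
  - intros K. destruct (arc_0 _ _ _ _ _ H (K / c ^ 2)) as [d [Hd C]].
    exists (d / c). split; [apply Rdiv_lt_0_compat; lra|]. intros u Hu1 Hu2.
    specialize (C (c * u)).
    assert (c * u < d).
    { apply Rmult_lt_reg_r with (/ c); [apply Rinv_0_lt_compat; lra|].
      replace (c * u * / c) with u by (field; lra). apply Hu1. }
    pose proof (Hs u ltac:(lra)). specialize (C ltac:(lra) ltac:(lra)).
    apply Rmult_lt_compat_l with (r := c ^ 2) in C; [|apply pow_lt; lra].
    replace (c ^ 2 * (K / c ^ 2)) with K in C by (field; lra). exact C.
  - intros eps He. assert (Hc3 : 0 < c ^ 3) by (apply pow_lt; lra).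
    destruct (arc_a _ _ _ _ _ H (eps / c ^ 3)) as [d [Hd C]]; [apply Rdiv_lt_0_compat; lra|].
    exists (d / c). split; [apply Rdiv_lt_0_compat; lra|]. intros u Hu1 Hu2.
    pose proof (Hs u ltac:(lra)).
    assert (a - d < c * u).
    { apply Rmult_lt_reg_r with (/ c); [apply Rinv_0_lt_compat; lra|].
      replace (c * u * / c) with u by (field; lra).
      replace ((a - d) * / c) with (a / c - d / c) by (field; lra). apply Hu1. }
    specialize (C (c * u) ltac:(lra) ltac:(lra)).
    apply Rmult_lt_compat_l with (r := c ^ 3) in C; [|exact Hc3].
    replace (c ^ 3 * (- (eps / c ^ 3))) with (- eps) in C by (field; lra). exact C.
Qed.

(** * The curve of the theorem: its real period and its 3-isogeny *)

Definition cub2 (k : R) : R := 4 / 27 * (8 * (1 - k ^ 2) + 1).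
Definition cub3 (k : R) : R := 8 / 729 * (8 * (1 - k ^ 2) ^ 2 + 20 * (1 - k ^ 2) - 1).

(** In the variable [s = p + 1/3] the cubic is [4 s^3] minus the square of a linear form, which
    displays the points of order three at [s = 0]. In [cub2] and [cub3] the complementary modulus is
    written [1 - k^2], so they serve both [kappa] and [lambda]. *)
Lemma cubic_shift (k x : R) :
  4 * x ^ 3 - cub2 k * x - cub3 k =
  4 * (x + 1/3) ^ 3 - 4 * (x + 1/3 - 4 * k ^ 2 / 27) ^ 2.
Proof. unfold cub2, cub3. field. Qed.

(** With [s = k^2 / (9 sin^2 (z/3))] the bound reads [sin (z/3) < 1/2], that is [z < PI/2]. At
    [s = 4 k^2 / 9] the cubic is a negative multiple of [k^4 (1 - k^2)], so this value is a
    barrier. *)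
Lemma arc_lower_bound (k a : R) (p dp : R -> R) (u : R) :
  0 < k < 1 -> wp_arc (cub2 k) (cub3 k) a p dp -> 0 < u < a -> 4 * k ^ 2 / 9 < p u + 1/3.
Proof.
  intros Hk H Hu.
  enough (4 * k ^ 2 / 9 - 1/3 < p u) by lra.
  apply (arc_barrier _ _ _ _ _ _ _ H); [|exact Hu].
  rewrite cubic_shift.
  replace (4 * (4 * k ^ 2 / 9 - 1 / 3 + 1 / 3) ^ 3 -
    4 * (4 * k ^ 2 / 9 - 1 / 3 + 1 / 3 - 4 * k ^ 2 / 27) ^ 2)
  with (- (256 / 729 * (k ^ 4 * (1 - k ^ 2)))) by field.
  assert (0 < k ^ 4) by (apply pow_lt; lra). assert (0 < 1 - k ^ 2) by nra. nra.
Qed.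

Lemma is_derive_asin (x : R) : -1 < x < 1 -> is_derive asin x (/ sqrt (1 - x ^ 2)).
Proof.
  intros Hx. apply is_derive_Reals.
  replace (/ sqrt (1 - x ^ 2)) with (derive_pt asin x (derivable_pt_asin x Hx)).
  - apply derive_pt_eq_1 with (derivable_pt_asin x Hx). reflexivity.
  - rewrite derive_pt_asin. unfold Rsqr. replace (x ^ 2) with (x * x) by ring. field.
    apply Rgt_not_eq, sqrt_lt_R0. nra.
Qed.

Lemma continuous_hfun_sin (k x : R) : 0 < k < 1 -> continuous (fun t => hfun ((k * sin t) ^ 2)) x.
Proof.
  intros Hk.
  assert (Hr : Rabs ((k * sin x) ^ 2) < 1).
  { pose proof (SIN_bound x). rewrite Rabs_pos_eq by apply pow2_ge_0.
    rewrite Rpow_mult_distr. assert (0 <= sin x ^ 2 <= 1) by nra. assert (k ^ 2 < 1) by nra. nra. }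
  apply (ex_derive_continuous (fun t => hfun ((k * sin t) ^ 2))).
  pose proof (is_derive_hfun _ Hr) as D. auto_derive. eexists. exact D.
Qed.

Lemma is_derive_inv_sqrt (p : R -> R) (l c u : R) :
  is_derive p u l -> 0 < p u + c ->
  is_derive (fun t => / sqrt (p t + c)) u (- l / (2 * (p u + c) * sqrt (p u + c))).
Proof.
  intros D Hp. pose proof (sqrt_lt_R0 _ Hp) as Hs. pose proof (sqrt_sqrt _ (Rlt_le _ _ Hp)) as E.
  auto_derive.
  - repeat split; try lra. eexists; exact D.
  - rewrite_Derive D. set (r := sqrt (p u + c)) in *. rewrite <- E. field. lra.
Qed.

Lemma inv_sqrt_tends_0 (g2 g3 a c : R) (p dp : R -> R) :
  wp_arc g2 g3 a p dp ->
  forall eps, 0 < eps -> exists d, 0 < d /\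
    forall u, 0 < u < d -> u < a -> 0 < / sqrt (p u + c) < eps.
Proof.
  intros H eps He.
  destruct (arc_0 _ _ _ _ _ H (/ eps ^ 2 - c)) as [d [Hd C]].
  exists d. split; [exact Hd|]. intros u Hu1 Hu2. specialize (C u Hu1 Hu2).
  assert (0 < / eps ^ 2) by (apply Rinv_0_lt_compat, pow_lt, He).
  assert (Hs : 0 < sqrt (p u + c)) by (apply sqrt_lt_R0; lra).
  split; [apply Rinv_0_lt_compat, Hs|].
  rewrite <- (Rinv_inv eps). apply Rinv_lt_contravar; [apply Rmult_lt_0_compat; [apply Rinv_0_lt_compat; lra|lra]|].
  rewrite <- (sqrt_pow2 (/ eps)) by (apply Rlt_le, Rinv_0_lt_compat, He).
  apply sqrt_lt_1_alt. rewrite pow_inv. lra.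
Qed.

Lemma arc_length (k a : R) (p dp : R -> R) :
  0 < k < 1 -> wp_arc (cub2 k) (cub3 k) a p dp ->
  a = PI / 2 * hyp2F1 (1/3) (2/3) 1 (k ^ 2).
Proof.
  intros Hk H. pose proof (arc_pos _ _ _ _ _ H) as Ha. pose proof PI_RGT_0 as Hpi.
  assert (Hk2 : 0 < k ^ 2 < 1) by nra.
  (* [k v / 3] plays the part of [sin (z/3)]; by the triple angle formula [k S] is then [sin z], so
     [S] is [sin phi]. *)
  set (v := fun u => / sqrt (p u + 1/3)).
  set (S := fun u => v u - 4 * k ^ 2 / 27 * v u ^ 3).
  set (w := fun t => hfun ((k * sin t) ^ 2)).
  assert (Hw : forall x, continuous w x) by (intros x; apply continuous_hfun_sin, Hk).
  assert (F : forall u, 0 < u < a -> 4 * k ^ 2 / 9 < p u + 1/3 /\ 0 < v u /\ v u ^ 2 * (p u + 1/3) = 1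
     /\ 0 < S u < 1 /\ 1 - S u ^ 2 = dp u ^ 2 / (4 * (p u + 1/3) ^ 3)
     /\ is_derive v u (sqrt (1 - S u ^ 2))).
  { intros u Hu. pose proof (arc_lower_bound k a p dp u Hk H Hu) as Hs.
    assert (Hs0 : 0 < p u + 1/3) by lra.
    pose proof (sqrt_lt_R0 _ Hs0) as Hr. pose proof (sqrt_sqrt _ (Rlt_le _ _ Hs0)) as Er.
    assert (Hv : 0 < v u) by (apply Rinv_0_lt_compat, Hr).
    assert (Ev : v u ^ 2 * (p u + 1/3) = 1) by (unfold v; rewrite <- Er at 2; field; lra).
    assert (ES : 1 - S u ^ 2 = dp u ^ 2 / (4 * (p u + 1/3) ^ 3)).
    { rewrite (arc_eq _ _ _ _ _ H u Hu), cubic_shift. set (s := p u + 1/3) in *.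
      unfold S. assert (E2 : v u ^ 2 = / s) by (apply Rmult_eq_reg_r with s; [rewrite Ev; field; lra|lra]).
      replace ((v u - 4 * k ^ 2 / 27 * v u ^ 3) ^ 2)
        with (v u ^ 2 * (1 - 4 * k ^ 2 / 27 * v u ^ 2) ^ 2) by ring.
      rewrite E2. field. lra. }
    pose proof (arc_neg _ _ _ _ _ H u Hu) as Hn.
    assert (Hpos : 0 < 1 - S u ^ 2).
    { rewrite ES. apply Rdiv_lt_0_compat; [nra|]. assert (0 < (p u + 1/3) ^ 3) by (apply pow_lt; lra). lra. }
    assert (HS0 : 0 < S u).
    { unfold S. replace (v u - 4 * k ^ 2 / 27 * v u ^ 3) with (v u * (1 - 4 * k ^ 2 / 27 * v u ^ 2)) by ring.
      apply Rmult_lt_0_compat; [exact Hv|]. nra. }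
    do 3 (split; [assumption|]). split; [split; [assumption|nra]|]. split; [assumption|].
    replace (sqrt (1 - S u ^ 2)) with (- dp u / (2 * (p u + 1/3) * sqrt (p u + 1/3))).
    { apply is_derive_inv_sqrt; [apply (arc_derive _ _ _ _ _ H u Hu)|lra]. }
    symmetry. apply sqrt_lem_1; [lra| |].
    - apply Rlt_le, Rdiv_lt_0_compat; [lra|]. nra.
    - rewrite ES. set (s := p u + 1/3) in *. set (r := sqrt s) in *. rewrite <- Er. field. lra. }
  set (phi := fun u => asin (S u)).
  assert (T : forall u, 0 < u < a -> RInt w 0 (phi u) = u).
  (* [v' = sqrt (1 - S^2)] cancels the derivative of [asin], so [phi'] is [1 - 4 (k v / 3)^2], and
     [hfun_triple] shows that [w phi] is its inverse. *)
  { apply (time_of_flight w phi (fun u => 1 - 4 * k ^ 2 / 9 * v u ^ 2) a Hw).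
    - intros u Hu. destruct (F u Hu) as (F1 & F2 & F3 & F4 & F5 & F6).
      assert (Hq : 0 < sqrt (1 - S u ^ 2)) by (apply sqrt_lt_R0; nra).
      split.
      + replace (1 - 4 * k ^ 2 / 9 * v u ^ 2) with
          (scal ((1 - 4 * k ^ 2 / 9 * v u ^ 2) * sqrt (1 - S u ^ 2)) (/ sqrt (1 - S u ^ 2)))
          by (match goal with |- scal ?x ?y = ?z => change (@eq R (x * y) z) end; field; lra).
        apply (is_derive_comp asin S); [apply is_derive_asin; lra|].
        unfold S at 1. auto_derive; [solve_ex_derive|].
        rewrite_Derive F6. field.
      + unfold w, phi. rewrite sin_asin by lra.
        replace (k * S u) with (3 * (k * v u / 3) - 4 * (k * v u / 3) ^ 3) by (unfold S; field).
        assert (Hy : 4 * k ^ 2 / 9 * v u ^ 2 < 1) by (assert (0 < v u ^ 2) by nra; nra).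
        rewrite hfun_triple.
        * field. nra.
        * assert (0 < k * v u) by nra. split; [lra|].
          assert (k * v u < 3 / 2); [|lra].
          assert ((k * v u) ^ 2 < (3/2) ^ 2) by (rewrite Rpow_mult_distr; lra). nra.
    - intros eps He.
      destruct (continuous_eps asin 0 eps) as [d1 [Hd1 C1]]; [|exact He|].
      { apply (ex_derive_continuous asin). eexists. apply is_derive_asin. lra. }
      destruct (inv_sqrt_tends_0 _ _ _ (1/3) _ _ H d1 Hd1) as [d2 [Hd2 C2]].
      exists d2. split; [exact Hd2|]. intros u Hu1 Hu2. specialize (C2 u Hu1 Hu2). fold (v u) in C2.
      destruct (F u ltac:(lra)) as (F1 & F2 & F3 & F4 & F5 & F6).
      specialize (C1 (S u)). rewrite asin_0, !Rminus_0_r in C1. apply C1.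
      rewrite Rabs_pos_eq by lra. unfold S. assert (0 < v u ^ 3) by (apply pow_lt; lra). nra. }
  set (G := fun x => RInt w 0 x).
  assert (HG : continuous G (PI/2)).
  { apply (ex_derive_continuous G). eexists. apply is_derive_RInt_cont, Hw. }
  (* As [u] tends to [a], [1 - S^2 = p'^2 / (4 s^3)] tends to 0 because [s] is bounded below; hence
     [phi] tends to [PI/2], and the elapsed time [G (phi u) = u] tends to [G (PI/2)]. *)
  assert (E : forall eps, 0 < eps -> Rabs (a - G (PI/2)) < eps).
  { intros eps He.
    destruct (continuous_eps G (PI/2) (eps/2) HG ltac:(lra)) as [d1 [Hd1 C1]].
    set (e1 := Rmin d1 (PI/4)).
    assert (He1 : 0 < e1 <= d1 /\ e1 < PI/2).
    { unfold e1. pose proof (Rmin_l d1 (PI/4)). pose proof (Rmin_r d1 (PI/4)).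
      repeat split; try lra. apply Rmin_glb_lt; lra. }
    assert (Hsin : sin (PI/2 - e1) < 1).
    { rewrite <- sin_PI2. apply sin_increasing_1; lra. }
    (* [m] bounds [s^3] from below; [1 - S^2 < e2] will force [S = sin phi] above
       [sin (PI/2 - e1)]. *)
    set (m := (4 * k ^ 2 / 9) ^ 3). assert (Hm : 0 < m) by (apply pow_lt; lra).
    set (e2 := 1 - sin (PI/2 - e1)).
    destruct (arc_a _ _ _ _ _ H (Rmin 1 (4 * m * e2 / 2))) as [d2 [Hd2 C2]].
    { apply Rmin_glb_lt; [lra|]. unfold e2. nra. }
    set (u := Rmax (a/2) (Rmax (a - d2/2) (a - eps/4))).
    assert (Hu : a/2 <= u /\ a - d2/2 <= u /\ a - eps/4 <= u /\ u < a).
    { unfold u. repeat split.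
      - apply Rmax_l.
      - eapply Rle_trans; [apply Rmax_l|apply Rmax_r].
      - eapply Rle_trans; [apply Rmax_r|apply Rmax_r].
      - repeat apply Rmax_lub_lt; lra. }
    destruct (F u ltac:(lra)) as (F1 & F2 & F3 & F4 & F5 & F6).
    specialize (C2 u ltac:(lra) ltac:(lra)).
    pose proof (arc_neg _ _ _ _ _ H u ltac:(lra)) as Hn.
    pose proof (Rmin_l 1 (4 * m * e2 / 2)). pose proof (Rmin_r 1 (4 * m * e2 / 2)).
    assert (Hdp : dp u ^ 2 < 4 * m * e2) by nra.
    assert (Hm2 : m <= (p u + 1/3) ^ 3) by (apply pow_incr; lra).
    assert (HS : 1 - S u ^ 2 < e2).
    { rewrite F5. apply Rmult_lt_reg_r with (4 * (p u + 1/3) ^ 3); [lra|].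
      unfold Rdiv. rewrite Rmult_assoc, Rinv_l by lra.
      assert (0 < e2) by (unfold e2; lra). nra. }
    assert (Hphi : PI/2 - e1 < phi u).
    { destruct (Rlt_le_dec (PI/2 - e1) (phi u)) as [L|L]; [exact L|exfalso].
      pose proof (asin_bound (S u)) as B. fold (phi u) in B.
      assert (sin (phi u) <= sin (PI/2 - e1)) by (apply sin_incr_1; lra).
      unfold phi in H2. rewrite sin_asin in H2 by lra. unfold e2 in HS. nra. }
    pose proof (asin_bound (S u)) as B. fold (phi u) in B.
    specialize (C1 (phi u)). unfold G in C1 at 1. rewrite (T u) in C1 by lra.
    assert (C : Rabs (phi u - PI/2) < d1) by (apply Rabs_def1; lra).
    specialize (C1 C). apply Rabs_def2 in C1. apply Rabs_def1; lra. }
  assert (EQ : a = G (PI/2)).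
  { destruct (Req_dec a (G (PI/2))) as [h|h]; [exact h|exfalso].
    assert (a - G (PI/2) <> 0) as N by lra. apply Rabs_pos_lt in N.
    specialize (E _ N). lra. }
  rewrite EQ. unfold G. apply is_RInt_unique. apply is_RInt_hfun_sin. lra.
Qed.

(** The quotient by the two points of order three over [s = 0]: the terms added to [p] are the sum
    of the values of [s] at the translates of [u] by these points. The new invariants are those of
    the curve of [k] turned by a right angle and scaled by [sqrt 3], namely [(sqrt 3)^4 g2] and
    [- (sqrt 3)^6 g3]. *)
Lemma arc_isogeny (k l a : R) (p dp : R -> R) :
  0 < k < 1 -> 0 < l < 1 -> k ^ 2 + l ^ 2 = 1 -> wp_arc (cub2 l) (cub3 l) a p dp ->
  let m := 4 * l ^ 2 / 27 in
  wp_arc (9 * cub2 k) (- (27 * cub3 k)) a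
    (fun u => p u + 4 * m / (p u + 1/3) - 4 * m ^ 2 / (p u + 1/3) ^ 2)
    (fun u => dp u * (1 - 4 * m / (p u + 1/3) ^ 2 + 8 * m ^ 2 / (p u + 1/3) ^ 3)).
Proof.
  intros Hk Hl Hkl H m.
  assert (Hm : 0 < m) by (unfold m; nra).
  assert (B : forall u, 0 < u < a -> 3 * m < p u + 1/3).
  { intros u Hu. pose proof (arc_lower_bound l a p dp u Hl H Hu). unfold m. lra. }
  assert (Q : forall u, 0 < u < a -> 0 < 1 - 4 * m / (p u + 1/3) ^ 2 + 8 * m ^ 2 / (p u + 1/3) ^ 3 <= 1 + 8 / (27 * m)).
  { intros u Hu. specialize (B u Hu).
    pose proof (arc_eq _ _ _ _ _ H u Hu) as E. rewrite cubic_shift in E. fold m in E.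
    pose proof (arc_neg _ _ _ _ _ H u Hu) as Hn.
    set (s := p u + 1/3) in *. assert (0 < s ^ 3) by (apply pow_lt; lra).
    assert (0 < s ^ 2) by (apply pow_lt; lra).
    assert (0 < dp u ^ 2) by nra.
    split.
    - replace (1 - 4 * m / s ^ 2 + 8 * m ^ 2 / s ^ 3) with ((s ^ 3 - 4 * m * s + 8 * m ^ 2) / s ^ 3) by (field; lra).
      apply Rdiv_lt_0_compat; [|assumption].
      (* [p'^2 > 0] means [s^3 > (s - m)^2], so the numerator exceeds [(s - 3 m)^2]. *)
      pose proof (pow2_ge_0 (s - 3 * m)). nra.
    - assert (0 < 4 * m / s ^ 2) by (apply Rdiv_lt_0_compat; lra).
      assert (8 * m ^ 2 / s ^ 3 <= 8 / (27 * m)); [|lra].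
      replace (8 / (27 * m)) with (8 * m ^ 2 / (3 * m) ^ 3) by (field; lra).
      apply Rmult_le_compat_l; [nra|]. apply Rinv_le_contravar; [apply pow_lt; lra|].
      apply pow_incr; lra. }
  constructor.
  - apply (arc_pos _ _ _ _ _ H).
  - intros u Hu. pose proof (arc_derive _ _ _ _ _ H u Hu) as D. specialize (B u Hu).
    auto_derive.
    + repeat match goal with |- _ /\ _ => split end; try exact I; try (eexists; exact D); try nra.
    + rewrite_Derive D. field. nra.
  - intros u Hu. pose proof (arc_neg _ _ _ _ _ H u Hu). destruct (Q u Hu). nra.
  - intros u Hu. specialize (B u Hu). rewrite Rpow_mult_distr, (arc_eq _ _ _ _ _ H u Hu).
    rewrite cubic_shift. fold m. set (s := p u + 1/3) in *.
    replace (p u) with (s - 1/3) by (unfold s; ring).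
    unfold cub2, cub3. replace (1 - k ^ 2) with (l ^ 2) by lra.
    replace (l ^ 2) with (27 * m / 4) by (unfold m; field). field. lra.
  - intros K. destruct (arc_0 _ _ _ _ _ H (K + 4/9)) as [d [Hd C]].
    exists d. split; [exact Hd|]. intros u Hu1 Hu2. specialize (C u Hu1 Hu2).
    specialize (B u ltac:(lra)). set (s := p u + 1/3) in *.
    assert (0 < 4 * m / s) by (apply Rdiv_lt_0_compat; lra).
    assert (4 * m ^ 2 / s ^ 2 <= 4 / 9); [|lra].
    replace (4 / 9) with (4 * m ^ 2 / (3 * m) ^ 2) by (field; lra).
    apply Rmult_le_compat_l; [nra|]. apply Rinv_le_contravar; [apply pow_lt; lra|].
    apply pow_incr; lra.
  - intros eps He. set (W := 1 + 8 / (27 * m)) in *.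
    assert (HW : 0 < W) by (unfold W; assert (0 < 8 / (27 * m)) by (apply Rdiv_lt_0_compat; lra); lra).
    destruct (arc_a _ _ _ _ _ H (eps / W)) as [d [Hd C]]; [apply Rdiv_lt_0_compat; lra|].
    exists d. split; [exact Hd|]. intros u Hu1 Hu2. specialize (C u Hu1 Hu2).
    destruct (Q u ltac:(lra)) as [Q1 Q2]. pose proof (arc_neg _ _ _ _ _ H u ltac:(lra)) as Hn.
    set (q := 1 - 4 * m / (p u + 1/3) ^ 2 + 8 * m ^ 2 / (p u + 1/3) ^ 3) in *.
    assert (- dp u * W < eps).
    { apply Rmult_lt_reg_r with (/ W); [apply Rinv_0_lt_compat, HW|].
      rewrite Rmult_assoc, Rinv_r by lra. unfold Rdiv in C. lra. }
    nra.
Qed.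

(* [v = 1 / sqrt (p + c)] turns [p'^2 = 4 p^3 - g2 p - g3] into [v'^2 = vpoly v]. *)
Definition vpoly (g2 g3 c v : R) : R :=
  (1 - c * v ^ 2) ^ 3 - g2 / 4 * (v ^ 4 - c * v ^ 6) - g3 / 4 * v ^ 6.

Lemma arc_inv_sqrt (g2 g3 a c : R) (p dp : R -> R) :
  wp_arc g2 g3 a p dp -> 4 * (- c) ^ 3 - g2 * (- c) - g3 < 0 ->
  forall u, 0 < u < a ->
    0 < p u + c /\ dp u ^ 2 = 4 * (p u + c) ^ 3 * vpoly g2 g3 c (/ sqrt (p u + c)) /\
    0 < vpoly g2 g3 c (/ sqrt (p u + c)) /\
    is_derive (fun u => / sqrt (p u + c)) u (sqrt (vpoly g2 g3 c (/ sqrt (p u + c)))).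
Proof.
  intros H Hc u Hu. pose proof (arc_barrier _ _ _ _ _ _ _ H Hc Hu) as B.
  assert (Hs0 : 0 < p u + c) by lra.
  pose proof (sqrt_lt_R0 _ Hs0) as Hr. pose proof (sqrt_sqrt _ (Rlt_le _ _ Hs0)) as Er.
  pose proof (arc_neg _ _ _ _ _ H u Hu) as Hn.
  assert (E : dp u ^ 2 = 4 * (p u + c) ^ 3 * vpoly g2 g3 c (/ sqrt (p u + c))).
  { rewrite (arc_eq _ _ _ _ _ H u Hu). unfold vpoly. set (r := sqrt (p u + c)) in *.
    replace (p u) with (r * r - c) by lra.
    replace (r * r - c + c) with (r * r) by ring. field. lra. }
  assert (H3 : 0 < (p u + c) ^ 3) by (apply pow_lt; lra).
  assert (P : 0 < vpoly g2 g3 c (/ sqrt (p u + c))) by (assert (0 < dp u ^ 2) by nra; nra).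
  do 3 (split; [assumption|]).
  replace (sqrt (vpoly g2 g3 c (/ sqrt (p u + c)))) with (- dp u / (2 * (p u + c) * sqrt (p u + c))).
  { apply is_derive_inv_sqrt; [apply (arc_derive _ _ _ _ _ H u Hu)|lra]. }
  symmetry. apply sqrt_lem_1; [lra| |].
  - apply Rlt_le, Rdiv_lt_0_compat; [lra|]. nra.
  - set (V := vpoly g2 g3 c (/ sqrt (p u + c))) in *. set (s := p u + c) in *. set (r := sqrt s) in *.
    transitivity (dp u ^ 2 / (4 * s * s * (r * r))); [field; lra|]. rewrite Er, E. field. lra.
Qed.

(** Every positive [x] up to the value of [1 / sqrt (p + c)] at [u] is its value at some earlier
    time, where [vpoly] is positive because [p'] does not vanish. *)
Lemma arc_vpoly_pos (g2 g3 a c : R) (p dp : R -> R) :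
  wp_arc g2 g3 a p dp -> 4 * (- c) ^ 3 - g2 * (- c) - g3 < 0 ->
  forall u x, 0 < u < a -> 0 <= x <= / sqrt (p u + c) -> 0 < vpoly g2 g3 c x.
Proof.
  intros H Hc u x Hu [Hx1 Hx2]. destruct (Req_dec x 0) as [->|Hn].
  { unfold vpoly. replace (_ - _ - _) with 1 by ring. lra. }
  destruct (arc_inv_sqrt _ _ _ _ _ _ H Hc u Hu) as (P & _).
  pose proof (sqrt_lt_R0 _ P) as Hr. pose proof (sqrt_sqrt _ (Rlt_le _ _ P)) as Er.
  assert (Hx0 : 0 < x) by lra.
  assert (Hix : 0 < / x) by (apply Rinv_0_lt_compat, Hx0).
  destruct (arc_intermediate _ _ _ _ _ ((/ x) ^ 2 - c) u H Hu) as [t [Ht E]].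
  { assert (sqrt (p u + c) <= / x).
    { rewrite <- (Rinv_inv (sqrt (p u + c))). apply Rinv_le_contravar; assumption. }
    nra. }
  destruct (arc_inv_sqrt _ _ _ _ _ _ H Hc t ltac:(lra)) as (_ & _ & Q & _).
  rewrite E in Q. replace ((/ x) ^ 2 - c + c) with ((/ x) ^ 2) in Q by ring.
  rewrite sqrt_pow2, Rinv_inv in Q by lra. exact Q.
Qed.

Lemma arc_decreasing (g2 g3 a : R) (p dp : R -> R) (t u : R) :
  wp_arc g2 g3 a p dp -> 0 < t < u -> u < a -> p u < p t.
Proof.
  intros H Ht Hu. destruct (MVT_gen p t u dp) as [z [Hz E]].
  - rewrite Rmin_left, Rmax_right by lra. intros x Hx. apply (arc_derive _ _ _ _ _ H); lra.
  - rewrite Rmin_left, Rmax_right by lra. intros x Hx. apply (arc_continuity_pt _ _ _ _ _ _ H); lra.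
  - rewrite Rmin_left, Rmax_right in Hz by lra.
    pose proof (arc_neg _ _ _ _ _ H z ltac:(lra)). nra.
Qed.

Lemma RInt_pos_inj (w : R -> R) (x y : R) :
  (forall t, continuous w t) -> (forall t, 0 < w t) -> RInt w 0 x = RInt w 0 y -> x = y.
Proof.
  intros Hc Hp E.
  assert (Hlt : forall x y, x < y -> RInt w 0 x < RInt w 0 y).
  { clear x y E. intros x y Hxy.
    assert (HI : forall s t, ex_RInt w s t) by (intros s t; apply (ex_RInt_continuous w); intros z _; apply Hc).
    rewrite <- (RInt_Chasles w 0 x y) by apply HI.
    assert (0 < RInt w x y) by (apply RInt_gt_0; [exact Hxy|intros; apply Hp|intros; apply Hc]).
    unfold plus; simpl. lra. }
  destruct (Rtotal_order x y) as [L|[L|L]]; [|exact L|]; apply Hlt in L; exfalso; rewrite E in L;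
    exact (Rlt_irrefl _ L).
Qed.

(** In the variable [1 / sqrt (p + c)] the pole becomes the common starting point 0 of both arcs.
    Both solve [v' = sqrt (F v)] and are therefore inverse to the same time function, the integral
    of [1 / sqrt F] from 0. *)
Lemma arc_unique_fun (g2 g3 a b : R) (p dp q dq : R -> R) :
  wp_arc g2 g3 a p dp -> wp_arc g2 g3 b q dq ->
  forall u, 0 < u < Rmin a b -> p u = q u.
Proof.
  intros Hp Hq u Hu.
  (* Large enough for [- c] to be a barrier below both arcs. *)
  set (c := 1 + Rabs g2 + Rabs g3).
  assert (Hc : 4 * (- c) ^ 3 - g2 * (- c) - g3 < 0).
  { pose proof (Rabs_pos g2). pose proof (Rabs_pos g3). pose proof (Rle_abs g2).
    pose proof (Rle_abs (- g3)) as X. rewrite Rabs_Ropp in X.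
    assert (1 <= c) by (unfold c; lra). assert (g2 <= c) by (unfold c; lra). assert (- g3 <= c) by (unfold c; lra).
    assert (g2 * c <= c * c) by nra. assert (c * c <= c ^ 3) by nra. assert (c <= c * c) by nra.
    replace ((- c) ^ 3) with (- c ^ 3) by ring. nra. }
  set (v := fun t => / sqrt (p t + c)). set (z := fun t => / sqrt (q t + c)).
  set (F := vpoly g2 g3 c).
  (* Stopping at a time [e] before either arc ends keeps [F] positive on the compact interval
     [[0, V]] that both functions sweep, hence bounded below there. *)
  set (e := (u + Rmin a b) / 2).
  pose proof (Rmin_l a b) as Ma. pose proof (Rmin_r a b) as Mb.
  assert (He : 0 < e /\ u < e /\ e < a /\ e < b) by (unfold e; lra).
  set (V := Rmax (v e) (z e)).
  assert (HF : forall x, 0 <= x <= V -> 0 < F x).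
  { intros x Hx. unfold V in Hx. destruct (Rle_dec x (v e)) as [L|L].
    - apply (arc_vpoly_pos _ _ _ _ _ _ Hp Hc e x); [lra|]. split; [lra|exact L].
    - apply (arc_vpoly_pos _ _ _ _ _ _ Hq Hc e x); [lra|]. split; [lra|].
      change (x <= z e). unfold Rmax in Hx. destruct (Rle_dec (v e) (z e)); lra. }
  assert (HV : 0 <= V).
  { unfold V. eapply Rle_trans; [|apply Rmax_l]. apply Rlt_le, Rinv_0_lt_compat, sqrt_lt_R0.
    apply (arc_inv_sqrt _ _ _ _ _ _ Hp Hc e). lra. }
  assert (CF : forall x, continuous F x).
  { intros x. apply (ex_derive_continuous F). unfold F, vpoly. auto_derive. exact I. }
  destruct (continuity_ab_min F 0 V HV) as [x0 [Hmin Hx0]].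
  { intros x _. apply continuity_pt_filterlim, CF. }
  set (m := F x0). assert (Hm : 0 < m) by (apply HF, Hx0).
  (* [time_of_flight] wants an integrand continuous on the whole line; cutting [F] off below at its
     minimum over [[0, V]] gives one that agrees with [1 / sqrt F] there. *)
  set (w := fun x => / sqrt (Rmax m (F x))).
  assert (Hw0 : forall x, 0 < sqrt (Rmax m (F x))).
  { intros x. apply sqrt_lt_R0. eapply Rlt_le_trans; [exact Hm|apply Rmax_l]. }
  assert (Cw : forall x, continuous w x).
  { intros x. unfold w.
    apply (continuous_comp (fun x => sqrt (Rmax m (F x))) Rinv).
    - apply (continuous_comp (fun x => Rmax m (F x)) sqrt); [|apply continuous_sqrt].
      apply continuity_pt_filterlim. apply continuity_pt_ext with (fun x => (m + F x + Rabs (m - F x)) / 2).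
      + intros t. unfold Rmax. destruct (Rle_dec m (F t)).
        * rewrite Rabs_left1; lra.
        * rewrite Rabs_pos_eq; lra.
      + apply continuity_pt_filterlim.
        apply (continuous_mult (fun t => m + F t + Rabs (m - F t)) (fun _ => / 2)); [|apply continuous_const].
        apply (continuous_plus (fun t => m + F t) (fun t => Rabs (m - F t))).
        * apply (continuous_plus (fun t => m) F); [apply continuous_const|apply CF].
        * apply (continuous_comp (fun t => m - F t) Rabs); [|apply continuous_Rabs].
          apply (continuous_minus (fun t => m) F); [apply continuous_const|apply CF].
    - apply continuous_Rinv. apply Rgt_not_eq, Hw0. }
  assert (Hw : forall x, 0 <= x <= V -> w x = / sqrt (F x)).
  { intros x Hx. unfold w. rewrite Rmax_right; [reflexivity|]. apply Hmin, Hx. }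
  assert (TF : forall (a' : R) (r dr : R -> R), wp_arc g2 g3 a' r dr -> e < a' -> / sqrt (r e + c) <= V ->
             RInt w 0 (/ sqrt (r u + c)) = u).
  { intros a' r dr Hr Hea HeV.
    apply (time_of_flight w (fun t => / sqrt (r t + c)) (fun t => sqrt (F (/ sqrt (r t + c)))) e Cw); [| |lra].
    - intros t Ht. destruct (arc_inv_sqrt _ _ _ _ _ _ Hr Hc t ltac:(lra)) as (P1 & P2 & P3 & P4).
      split; [exact P4|].
      destruct (arc_inv_sqrt _ _ _ _ _ _ Hr Hc e ltac:(lra)) as (Q1 & _).
      rewrite Hw.
      + apply Rinv_l, Rgt_not_eq, sqrt_lt_R0, P3.
      + split; [apply Rlt_le, Rinv_0_lt_compat, sqrt_lt_R0, P1|].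
        apply Rle_trans with (/ sqrt (r e + c)); [|exact HeV].
        apply Rinv_le_contravar; [apply sqrt_lt_R0, Q1|]. apply sqrt_le_1_alt.
        pose proof (arc_decreasing _ _ _ _ _ t e Hr ltac:(lra) ltac:(lra)). lra.
    - intros eps Heps. destruct (inv_sqrt_tends_0 _ _ _ c _ _ Hr eps Heps) as [d [Hd C]].
      exists d. split; [exact Hd|]. intros t Ht1 Ht2. specialize (C t Ht1 ltac:(lra)).
      rewrite Rabs_pos_eq; lra. }
  assert (E : v u = z u).
  { apply (RInt_pos_inj w); [exact Cw| |].
    - intros t. apply Rinv_0_lt_compat, Hw0.
    - unfold v, z. rewrite (TF a p dp Hp), (TF b q dq Hq); try lra.
      + apply Rmax_r.
      + apply Rmax_l. }
  destruct (arc_inv_sqrt _ _ _ _ _ _ Hp Hc u ltac:(lra)) as (P1 & _).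
  destruct (arc_inv_sqrt _ _ _ _ _ _ Hq Hc u ltac:(lra)) as (Q1 & _).
  unfold v, z in E. apply (f_equal Rinv) in E. rewrite !Rinv_inv in E.
  apply sqrt_inj in E; lra.
Qed.

(** On [(0, a)] the two functions agree, and with them the squares of the derivatives. For the
    shorter arc this square tends to 0 at [a], but [a] is interior to the longer one, where the
    derivative is strictly negative. *)
Lemma arc_length_not_lt (g2 g3 a b : R) (p dp q dq : R -> R) :
  wp_arc g2 g3 a p dp -> wp_arc g2 g3 b q dq -> a < b -> False.
Proof.
  intros Hp Hq Hab. pose proof (arc_pos _ _ _ _ _ Hp) as Ha.
  pose proof (arc_unique_fun _ _ _ _ _ _ _ _ Hp Hq) as E. rewrite Rmin_left in E by lra.
  pose proof (arc_neg _ _ _ _ _ Hq a ltac:(lra)) as Hn.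
  pose proof (arc_eq _ _ _ _ _ Hq a ltac:(lra)) as Ea.
  set (Q := fun u => 4 * q u ^ 3 - g2 * q u - g3).
  assert (CQ : continuous Q a).
  { apply (ex_derive_continuous Q). pose proof (arc_derive _ _ _ _ _ Hq a ltac:(lra)) as D.
    unfold Q. auto_derive. solve_ex_derive. }
  set (e := dq a ^ 2).
  assert (He : 0 < e) by (unfold e; nra).
  destruct (continuous_eps Q a (e/2) CQ ltac:(lra)) as [d1 [Hd1 C1]].
  destruct (arc_a _ _ _ _ _ Hp (Rmin 1 (e/2))) as [d2 [Hd2 C2]]; [apply Rmin_glb_lt; lra|].
  set (u := Rmax (a/2) (Rmax (a - d1/2) (a - d2/2))).
  assert (Hu : a/2 <= u /\ a - d1/2 <= u /\ a - d2/2 <= u /\ u < a).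
  { unfold u. repeat split.
    - apply Rmax_l.
    - eapply Rle_trans; [apply Rmax_l|apply Rmax_r].
    - eapply Rle_trans; [apply Rmax_r|apply Rmax_r].
    - repeat apply Rmax_lub_lt; lra. }
  specialize (C1 u ltac:(apply Rabs_def1; lra)). specialize (C2 u ltac:(lra) ltac:(lra)).
  pose proof (arc_neg _ _ _ _ _ Hp u ltac:(lra)) as Hn2.
  pose proof (arc_eq _ _ _ _ _ Hp u ltac:(lra)) as Eu.
  rewrite E in Eu by lra. fold (Q u) in Eu. fold (Q a) in Ea. rewrite <- Eu, <- Ea in C1. fold e in C1.
  apply Rabs_def2 in C1. pose proof (Rmin_l 1 (e/2)). pose proof (Rmin_r 1 (e/2)). nra.
Qed.

Lemma arc_length_unique (g2 g3 a b : R) (p dp q dq : R -> R) :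
  wp_arc g2 g3 a p dp -> wp_arc g2 g3 b q dq -> a = b.
Proof.
  intros Hp Hq. destruct (Rtotal_order a b) as [L|[L|L]]; [exfalso|exact L|exfalso].
  - exact (arc_length_not_lt _ _ _ _ _ _ _ _ Hp Hq L).
  - exact (arc_length_not_lt _ _ _ _ _ _ _ _ Hq Hp L).
Qed.

(** * Partial fractions of the hyperbolic cotangent *)

(** Has exactly [n] terms, possibly none, whereas [sum_n f n] has [n + 1]; index ranges then split
    without predecessors. *)
Fixpoint sum_lt (f : nat -> R) (n : nat) : R :=
  match n with O => 0 | S m => sum_lt f m + f m end.

Lemma sum_lt_S_sum_n (f : nat -> R) (n : nat) : sum_lt f (S n) = sum_n f n.
Proof.
  induction n as [|n IH]; [rewrite sum_O; simpl; ring|].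
  rewrite sum_Sn, <- IH. reflexivity.
Qed.

Lemma sum_lt_ext (f g : nat -> R) (n : nat) :
  (forall k, (k < n)%nat -> f k = g k) -> sum_lt f n = sum_lt g n.
Proof.
  induction n as [|n IH]; intros H; [reflexivity|]. simpl. rewrite IH by (intros; apply H; lia).
  now rewrite H by lia.
Qed.

Lemma sum_lt_plus (f g : nat -> R) (n : nat) :
  sum_lt (fun k => f k + g k) n = sum_lt f n + sum_lt g n.
Proof. induction n as [|n IH]; simpl; [ring|]. rewrite IH. ring. Qed.

Lemma sum_lt_scal (c : R) (f : nat -> R) (n : nat) :
  sum_lt (fun k => c * f k) n = c * sum_lt f n.
Proof. induction n as [|n IH]; simpl; [ring|]. rewrite IH. ring. Qed.

Lemma sum_lt_add (f : nat -> R) (m n : nat) :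
  sum_lt f (m + n) = sum_lt f m + sum_lt (fun k => f (m + k)%nat) n.
Proof.
  induction n as [|n IH]; [rewrite Nat.add_0_r; simpl; ring|].
  rewrite Nat.add_succ_r. simpl. rewrite IH. ring.
Qed.

Lemma sum_lt_Rabs_le (f : nat -> R) (c : R) (n : nat) :
  (forall k, (k < n)%nat -> Rabs (f k) <= c) -> Rabs (sum_lt f n) <= INR n * c.
Proof.
  induction n as [|n IH]; intros H; [simpl; rewrite Rabs_R0; lra|].
  rewrite S_INR. simpl. eapply Rle_trans; [apply Rabs_triang|].
  pose proof (IH ltac:(intros; apply H; lia)). pose proof (H n ltac:(lia)). lra.
Qed.

Lemma sum_lt_around (g : R -> R) (i n : nat) :
  sum_lt (fun j => g (INR j - INR i)) (i + 1 + n) =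
  sum_lt (fun l => g (- (INR l + 1))) i + g 0 + sum_lt (fun l => g (INR l + 1)) n.
Proof.
  rewrite sum_lt_add. f_equal.
  - induction i as [|i IH]; [simpl; rewrite Rminus_0_r; reflexivity|].
    replace (S i + 1)%nat with (1 + (i + 1))%nat by lia. rewrite sum_lt_add.
    rewrite (sum_lt_ext (fun k => g (INR (1 + k) - INR (S i))) (fun k => g (INR k - INR i))).
    2:{ intros k _. f_equal. change (1 + k)%nat with (S k). rewrite !S_INR. ring. }
    rewrite IH. cbn [sum_lt].
    replace (INR 0 - INR (S i)) with (- (INR i + 1)) by (rewrite S_INR; simpl (INR 0); ring). ring.
  - apply sum_lt_ext. intros k _. f_equal. rewrite !plus_INR. simpl (INR 1). ring.
Qed.

Lemma sum_lt_centered (f : R -> R) (L : nat) :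
  sum_lt (fun k => f (INR k - INR L)) (2 * L + 1) =
  f 0 + sum_lt (fun j => f (INR (S j)) + f (- INR (S j))) L.
Proof.
  replace (2 * L + 1)%nat with (L + 1 + L)%nat by lia. rewrite sum_lt_around, sum_lt_plus.
  rewrite (sum_lt_ext (fun k => f (INR (S k))) (fun l => f (INR l + 1))) by (intros; now rewrite S_INR).
  rewrite (sum_lt_ext (fun k => f (- INR (S k))) (fun l => f (- (INR l + 1)))) by (intros; now rewrite S_INR).
  ring.
Qed.

(** The arguments run from [- L] to [L - 1] only, so the symmetric sum counts the value at [L] once
    too often. *)
Lemma sum_lt_symmetric (f : R -> R) (L : nat) :
  (forall x, f (- x) = f x) ->
  sum_lt (fun k => f (INR k - INR L)) (2 * L) =
  f 0 + 2 * sum_lt (fun j => f (INR (S j))) L - f (INR L).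
Proof.
  intros He. pose proof (sum_lt_centered f L) as H.
  rewrite (sum_lt_add _ (2 * L) 1) in H. cbn [sum_lt] in H.
  replace (INR (2 * L + 0) - INR L) with (INR L) in H by (rewrite plus_INR, mult_INR; simpl; ring).
  rewrite (sum_lt_ext (fun j => f (INR (S j)) + f (- INR (S j))) (fun j => 2 * f (INR (S j)))) in H
    by (intros k _; rewrite He; ring).
  rewrite sum_lt_scal in H. lra.
Qed.

(** * Taylor bounds for circular and hyperbolic functions *)

Lemma le_of_derive_le (f g f' g' : R -> R) (b : R) :
  (forall x, 0 <= x <= b -> is_derive f x (f' x)) ->
  (forall x, 0 <= x <= b -> is_derive g x (g' x)) ->
  (forall x, 0 <= x <= b -> f' x <= g' x) -> f 0 <= g 0 ->
  forall x, 0 <= x <= b -> f x <= g x.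
Proof.
  intros Hf Hg H H0 x Hx.
  destruct (MVT_gen (fun t => g t - f t) 0 x (fun t => g' t - f' t)) as [c [Hc E]].
  - intros t Ht. rewrite Rmin_left, Rmax_right in Ht by lra.
    apply (is_derive_minus g f); [apply Hg|apply Hf]; lra.
  - intros t Ht. rewrite Rmin_left, Rmax_right in Ht by lra.
    apply continuity_pt_filterlim, (ex_derive_continuous (fun t => g t - f t)).
    eexists. apply (is_derive_minus g f); [apply Hg|apply Hf]; lra.
  - rewrite Rmin_left, Rmax_right in Hc by lra.
    specialize (H c ltac:(lra)). assert (0 <= (g' c - f' c) * (x - 0)) by (apply Rmult_le_pos; lra). lra.
Qed.

Ltac derive_solve := intros; auto_derive; [exact I|try (simpl; field)].

Lemma sin_le_id (x : R) : 0 <= x -> sin x <= x.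
Proof.
  intros Hx. apply (le_of_derive_le sin (fun t => t) cos (fun _ => 1) x); try derive_solve; try lra.
  - intros t _. apply COS_bound.
  - rewrite sin_0; lra.
Qed.

Lemma cos_ge_quadratic (x : R) : 0 <= x -> 1 - x ^ 2 / 2 <= cos x.
Proof.
  intros Hx. apply (le_of_derive_le (fun t => 1 - t ^ 2 / 2) cos (fun t => - t) (fun t => - sin t) x); try derive_solve; try lra.
  - intros t Ht. pose proof (sin_le_id t ltac:(lra)). lra.
  - rewrite cos_0; lra.
Qed.

Lemma sin_ge_cubic (x : R) : 0 <= x -> x - x ^ 3 / 6 <= sin x.
Proof.
  intros Hx. apply (le_of_derive_le (fun t => t - t ^ 3 / 6) sin (fun t => 1 - t ^ 2 / 2) cos x); try derive_solve; try lra.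
  - intros t Ht. apply cos_ge_quadratic; lra.
  - rewrite sin_0; lra.
Qed.

Lemma cos_le_quartic (x : R) : 0 <= x -> cos x <= 1 - x ^ 2 / 2 + x ^ 4 / 24.
Proof.
  intros Hx. apply (le_of_derive_le cos (fun t => 1 - t ^ 2 / 2 + t ^ 4 / 24) (fun t => - sin t) (fun t => - t + t ^ 3 / 6) x); try derive_solve; try lra.
  - intros t Ht. pose proof (sin_ge_cubic t ltac:(lra)). lra.
  - rewrite cos_0; lra.
Qed.

Lemma one_minus_cos_ge (x : R) : 0 <= x <= PI -> x ^ 2 / 18 <= 1 - cos x.
Proof.
  intros Hx. pose proof PI_4.
  replace x with (2 * (x / 2)) at 2 by field. rewrite cos_2a_sin.
  (* On [[0, 2]], [t - t^3 / 6 >= t / 3]; with [1 - cos x = 2 sin^2 (x/2)] this is the origin of the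
     18. *)
  pose proof (sin_ge_cubic (x/2) ltac:(lra)) as S. set (t := x / 2) in *.
  assert (Ht : 0 <= t <= 2) by (unfold t; lra). replace x with (2 * t) by (unfold t; field).
  assert (t / 3 <= sin t) by nra. nra.
Qed.

Lemma cosh_bounds (x : R) : 0 <= x <= 1 -> 1 <= cosh x <= 2.
Proof.
  intros Hx. unfold cosh. rewrite exp_Ropp. split.
  - pose proof (exp_pos x). set (y := exp x) in *.
    assert (y * / y = 1) by (apply Rinv_r; lra). assert (0 < / y) by (apply Rinv_0_lt_compat; lra). assert (0 <= / y * (y - 1) ^ 2) by (apply Rmult_le_pos; [lra|apply pow2_ge_0]). nra.
  - assert (exp x <= 3).
    { apply Rle_trans with (exp 1); [|apply exp_le_3]. destruct (Req_dec x 1) as [->|]; [lra|]. left; apply exp_increasing; lra. }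
    assert (1 <= exp x).
    { rewrite <- exp_0. destruct (Req_dec x 0) as [->|]; [lra|]. left; apply exp_increasing; lra. }
    assert (/ exp x <= / 1) by (apply Rinv_le_contravar; lra). lra.
Qed.

Lemma sinh_le_linear (x : R) : 0 <= x <= 1 -> x <= sinh x <= 2 * x.
Proof.
  intros Hx. split.
  - apply (le_of_derive_le (fun t => t) sinh (fun _ => 1) cosh 1); try derive_solve; try lra.
    + intros t Ht. apply cosh_bounds; lra.
    + rewrite sinh_0; lra.
  - apply (le_of_derive_le sinh (fun t => 2 * t) cosh (fun _ => 2) 1); try derive_solve; try lra.
    + intros t Ht. apply cosh_bounds; lra.
    + rewrite sinh_0; lra.
Qed.

Lemma cosh_0_eq : cosh 0 = 1.
Proof. unfold cosh. rewrite Ropp_0, exp_0. field. Qed.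

Lemma cosh_quadratic (x : R) : 0 <= x <= 1 -> 1 + x ^ 2 / 2 <= cosh x <= 1 + x ^ 2.
Proof.
  intros Hx. split.
  - apply (le_of_derive_le (fun t => 1 + t ^ 2 / 2) cosh (fun t => t) sinh 1); try derive_solve; try lra.
    + intros t Ht. apply sinh_le_linear; lra.
    + rewrite cosh_0_eq; lra.
  - apply (le_of_derive_le cosh (fun t => 1 + t ^ 2) sinh (fun t => 2 * t) 1); try derive_solve; try lra.
    + intros t Ht. apply sinh_le_linear; lra.
    + rewrite cosh_0_eq; lra.
Qed.

Lemma sinh_cubic (x : R) : 0 <= x <= 1 -> sinh x <= x + x ^ 3 / 3.
Proof.
  intros Hx. apply (le_of_derive_le sinh (fun t => t + t ^ 3 / 3) cosh (fun t => 1 + t ^ 2) 1); try derive_solve; try lra.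
  - intros t Ht. apply cosh_quadratic; lra.
  - rewrite sinh_0; lra.
Qed.

Lemma cosh_quartic (x : R) : 0 <= x <= 1 -> cosh x <= 1 + x ^ 2 / 2 + x ^ 4 / 12.
Proof.
  intros Hx. apply (le_of_derive_le cosh (fun t => 1 + t ^ 2 / 2 + t ^ 4 / 12) sinh (fun t => t + t ^ 3 / 3) 1); try derive_solve; try lra.
  - intros t Ht. apply sinh_cubic; lra.
  - rewrite cosh_0_eq; lra.
Qed.

(** * The Poisson kernel, real part of [coth ((t + i psi) / 2)], and its duplication formula *)

Definition poisson (t psi : R) : R := sinh t / (cosh t - cos psi).

Lemma sinh_pos (x : R) : 0 < x -> 0 < sinh x.
Proof. intros Hx. rewrite <- sinh_0. apply sinh_lt, Hx. Qed.

Lemma cosh2_sinh2 (x : R) : cosh x ^ 2 = 1 + sinh x ^ 2.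
Proof.
  unfold cosh, sinh. rewrite exp_Ropp. field. pose proof (exp_pos x). lra.
Qed.

Lemma cosh_pos (x : R) : 0 < cosh x.
Proof. unfold cosh. pose proof (exp_pos x). pose proof (exp_pos (- x)). lra. Qed.

Lemma cosh_gt_1 (x : R) : 0 < x -> 1 < cosh x.
Proof.
  intros Hx. pose proof (sinh_pos x Hx). pose proof (cosh2_sinh2 x). pose proof (cosh_pos x). nra.
Qed.

Lemma sinh_double (x : R) : sinh (2 * x) = 2 * sinh x * cosh x.
Proof.
  unfold sinh, cosh. rewrite !exp_Ropp. replace (2 * x) with (x + x) by ring. rewrite exp_plus.
  pose proof (exp_pos x). field. lra.
Qed.

Lemma cosh_double (x : R) : cosh (2 * x) = 1 + 2 * sinh x ^ 2.
Proof.
  unfold sinh, cosh. rewrite !exp_Ropp. replace (2 * x) with (x + x) by ring. rewrite exp_plus.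
  pose proof (exp_pos x). field. lra.
Qed.

Lemma poisson_double (t psi : R) : 0 < t ->
  2 * poisson (2 * t) (2 * psi) = poisson t psi + poisson t (psi + PI).
Proof.
  intros Ht. unfold poisson. rewrite neg_cos, sinh_double, cosh_double, cos_2a_cos.
  pose proof (cosh_gt_1 t Ht). pose proof (COS_bound psi).
  pose proof (cosh2_sinh2 t) as E.
  replace (1 + 2 * sinh t ^ 2 - (2 * cos psi * cos psi - 1)) with (2 * ((cosh t - cos psi) * (cosh t + cos psi)))
    by (replace (sinh t ^ 2) with (cosh t ^ 2 - 1) by lra; ring).
  field. lra.
Qed.

(** Iterating [2 coth (2 z) = coth z + coth (z + i PI / 2)] writes [coth] at a fixed point as a mean
    over [2^n] equally spaced angles close to the pole; the partial fractions appear in the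
    limit. *)
Lemma poisson_sum (n : nat) : forall t psi, 0 < t ->
  2 ^ n * poisson (2 ^ n * t) (2 ^ n * psi) =
  sum_lt (fun k => poisson t (psi + 2 * PI * INR k / 2 ^ n)) (2 ^ n).
Proof.
  induction n as [|n IH]; intros t psi Ht.
  - simpl. rewrite !Rmult_1_l. replace (psi + 2 * PI * 0 / 1) with psi by field. ring.
  - assert (H2 : 0 < 2 ^ n) by (apply pow_lt; lra).
    replace (2 ^ S n * poisson (2 ^ S n * t) (2 ^ S n * psi)) with
      (2 * (2 ^ n * poisson (2 ^ n * (2 * t)) (2 ^ n * (2 * psi)))).
    2:{ simpl. rewrite <- !Rmult_assoc, !(Rmult_comm (2 ^ n) 2). reflexivity. }
    rewrite IH by lra. rewrite <- sum_lt_scal.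
    replace (2 ^ S n)%nat with (2 ^ n + 2 ^ n)%nat by (simpl; lia).
    rewrite sum_lt_add, <- sum_lt_plus. apply sum_lt_ext. intros k _.
    replace (2 * psi + 2 * PI * INR k / 2 ^ n) with (2 * (psi + 2 * PI * INR k / 2 ^ S n))
      by (simpl; field; lra).
    rewrite poisson_double by exact Ht. f_equal. f_equal.
    rewrite plus_INR, pow_INR. change (INR 2) with 2. rewrite <- tech_pow_Rmult. field. lra.
Qed.

(** Compares the kernel with the polar part of [coth]. An error of order [t], uniform in the angle,
    is enough because [coth_partial] takes a mean over the angles while [t] tends to 0;
    [|psi| <= PI] keeps away from the other poles. *)
Lemma poisson_approx (t psi : R) : 0 < t <= 1 -> Rabs psi <= PI ->
  Rabs (poisson t psi - 2 * t / (t ^ 2 + psi ^ 2)) <= 18 * t.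
Proof.
  intros Ht Hpsi.
  assert (Hwlog : forall x, 0 <= x <= PI -> Rabs (poisson t x - 2 * t / (t ^ 2 + x ^ 2)) <= 18 * t).
  2:{ destruct (Rle_lt_dec 0 psi) as [L|L].
      - apply Hwlog. rewrite Rabs_pos_eq in Hpsi; lra.
      - rewrite Rabs_left in Hpsi by lra. specialize (Hwlog (- psi) ltac:(lra)).
        unfold poisson in *. rewrite cos_neg in Hwlog.
        replace ((- psi) ^ 2) with (psi ^ 2) in Hwlog by ring. exact Hwlog. }
  intros x Hx.
  pose proof (sinh_le_linear t ltac:(lra)) as S1. pose proof (sinh_cubic t ltac:(lra)) as S2.
  pose proof (cosh_quadratic t ltac:(lra)) as C1. pose proof (cosh_quartic t ltac:(lra)) as C2.
  pose proof (cos_ge_quadratic x ltac:(lra)) as K1. pose proof (cos_le_quartic x ltac:(lra)) as K2.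
  pose proof (one_minus_cos_ge x Hx) as K3.
  unfold poisson.
  assert (Hn : 0 < t ^ 2 + x ^ 2) by nra.
  assert (Hd : (t ^ 2 + x ^ 2) / 18 <= cosh t - cos x) by nra.
  set (n := t ^ 2 + x ^ 2) in *. set (D := cosh t - cos x) in *.
  assert (HD : 0 < D) by lra.
  replace (sinh t / D - 2 * t / n) with (((sinh t - t) * n - t * (2 * D - n)) / (D * n)) by (field; lra).
  assert (Hnum : Rabs ((sinh t - t) * n - t * (2 * D - n)) <= t * n ^ 2).
  { assert (A1 : 0 <= (sinh t - t) * n <= t ^ 3 / 3 * n) by (split; nra).
    assert (A2 : 2 * D - n <= t ^ 4 / 6) by (unfold D, n; lra).
    assert (A3 : - (x ^ 4 / 12) <= 2 * D - n) by (unfold D, n; lra).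
    assert (A4 : t ^ 2 <= n /\ x ^ 2 <= n) by (unfold n; nra).
    assert (A5 : t ^ 4 <= n ^ 2) by (replace (t ^ 4) with ((t ^ 2) ^ 2) by ring; apply pow_incr; nra).
    assert (A6 : x ^ 4 <= n ^ 2) by (replace (x ^ 4) with ((x ^ 2) ^ 2) by ring; apply pow_incr; nra).
    assert (A7 : t ^ 3 * n <= t * n ^ 2) by (replace (t ^ 3 * n) with (t * (t ^ 2 * n)) by ring;
      replace (n ^ 2) with (n * n) by ring; apply Rmult_le_compat_l; nra).
    apply Rabs_le. nra. }
  unfold Rdiv. rewrite Rabs_mult, Rabs_inv, (Rabs_pos_eq (D * n)) by nra.
  apply Rmult_le_reg_r with (D * n); [nra|].
  rewrite Rmult_assoc, Rinv_l by nra. rewrite Rmult_1_r.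
  eapply Rle_trans; [exact Hnum|].
  replace (18 * t * (D * n)) with (t * n * (18 * D)) by ring.
  replace (t * n ^ 2) with (t * n * n) by ring. apply Rmult_le_compat_l; nra.
Qed.

(* Real and imaginary parts of [(x + i y)^(-k)].  As [Rinv 0 = 0], both vanish at the origin for
   [k > 0], which is the convention of [eis_partial]. *)
Fixpoint zinv (k : nat) (x y : R) : R * R :=
  match k with
  | O => (1, 0)
  | S j => let (A, B) := zinv j x y in
           ((x * A + y * B) / (x ^ 2 + y ^ 2), (x * B - y * A) / (x ^ 2 + y ^ 2))
  end.

Definition zre (k : nat) (x y : R) : R := fst (zinv k x y).
Definition zim (k : nat) (x y : R) : R := snd (zinv k x y).

Lemma zre_S (k : nat) (x y : R) : zre (S k) x y = (x * zre k x y + y * zim k x y) / (x ^ 2 + y ^ 2).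
Proof. unfold zre, zim. simpl. destruct (zinv k x y). reflexivity. Qed.

Lemma zim_S (k : nat) (x y : R) : zim (S k) x y = (x * zim k x y - y * zre k x y) / (x ^ 2 + y ^ 2).
Proof. unfold zre, zim. simpl. destruct (zinv k x y). reflexivity. Qed.

Lemma is_derive_z (k : nat) (x y : R) : 0 < x ^ 2 + y ^ 2 ->
  is_derive (fun t => zre k t y) x (- INR k * zre (S k) x y) /\
  is_derive (fun t => zim k t y) x (- INR k * zim (S k) x y).
Proof.
  intros Hn. induction k as [|k [IH1 IH2]].
  - split.
    + replace (- INR 0 * zre 1 x y) with 0 by (simpl; ring). apply (is_derive_const 1).
    + replace (- INR 0 * zim 1 x y) with 0 by (simpl; ring). apply (is_derive_const 0).
  - split.
    + eapply is_derive_ext; [intros t; symmetry; apply zre_S|].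
      auto_derive.
      * repeat match goal with |- _ /\ _ => split end; try exact I; try (eexists; eassumption). simpl in Hn. lra.
      * rewrite_Derive IH1. rewrite_Derive IH2. rewrite !zre_S, !zim_S, ?zre_S, ?zim_S. rewrite S_INR.
        set (A := zre k x y). set (B := zim k x y). field. simpl in Hn. lra.
    + eapply is_derive_ext; [intros t; symmetry; apply zim_S|].
      auto_derive.
      * repeat match goal with |- _ /\ _ => split end; try exact I; try (eexists; eassumption). simpl in Hn. lra.
      * rewrite_Derive IH1. rewrite_Derive IH2. rewrite !zre_S, !zim_S, ?zre_S, ?zim_S. rewrite S_INR.
        set (A := zre k x y). set (B := zim k x y). field. simpl in Hn. lra.
Qed.

Lemma z_norm (k : nat) (x y : R) : 0 < x ^ 2 + y ^ 2 ->
  zre k x y ^ 2 + zim k x y ^ 2 = / (x ^ 2 + y ^ 2) ^ k.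
Proof.
  intros Hn. induction k as [|k IH]; [unfold zre, zim; simpl; field|].
  rewrite zre_S, zim_S, <- (tech_pow_Rmult (x ^ 2 + y ^ 2)), Rinv_mult, <- IH. field. lra.
Qed.

Lemma zre_bound (k : nat) (x y : R) : 0 < y -> Rabs (zre k x y) <= / y ^ k.
Proof.
  intros Hy. assert (Hn : 0 < x ^ 2 + y ^ 2) by nra.
  pose proof (z_norm k x y Hn) as E.
  assert (Hk : 0 < y ^ k) by (apply pow_lt, Hy).
  assert (L : / (x ^ 2 + y ^ 2) ^ k <= (/ y ^ k) ^ 2).
  { rewrite pow_inv. apply Rinv_le_contravar; [apply pow_lt, Hk|].
    rewrite <- pow_mult, Nat.mul_comm, pow_mult. apply pow_incr. nra. }
  assert (Rabs (zre k x y) ^ 2 <= (/ y ^ k) ^ 2) by (rewrite pow2_abs; pose proof (pow2_ge_0 (zim k x y)); lra).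
  assert (0 < / y ^ k) by (apply Rinv_0_lt_compat, Hk). pose proof (Rabs_pos (zre k x y)). nra.
Qed.

Lemma z_sym (k : nat) (x y : R) : zre k x (- y) = zre k x y /\ zim k x (- y) = - zim k x y.
Proof.
  induction k as [|k [IH1 IH2]]; [unfold zre, zim; simpl; lra|].
  rewrite !zre_S, !zim_S, IH1, IH2.
  replace ((- y) ^ 2) with (y ^ 2) by ring. split; unfold Rdiv; ring.
Qed.

Lemma z_real (k : nat) (x : R) : x <> 0 -> zre k x 0 = / x ^ k /\ zim k x 0 = 0.
Proof.
  intros Hx. induction k as [|k [IH1 IH2]]; [unfold zre, zim; simpl; lra|].
  rewrite zre_S, zim_S, IH1, IH2. simpl.
  assert (x ^ k <> 0) by (apply pow_nonzero, Hx). split; field; auto.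
Qed.

(** * Sums over the nonzero multiples of [i PI] *)

Lemma ex_series_inv_sqr : ex_series (fun k => / (INR k + 1) ^ 2).
Proof.
  apply ex_series_dominated with (fun k => 2 * (/ (INR k + 1) - / (INR k + 2))).
  - intros k. pose proof (pos_INR k).
    rewrite Rabs_pos_eq by (apply Rlt_le, Rinv_0_lt_compat; nra).
    replace (2 * (/ (INR k + 1) - / (INR k + 2))) with (2 * / ((INR k + 1) * (INR k + 2))) by (field; lra).
    apply Rmult_le_reg_r with ((INR k + 1) ^ 2 * (INR k + 2)); [nra|].
    replace (/ (INR k + 1) ^ 2 * ((INR k + 1) ^ 2 * (INR k + 2))) with (INR k + 2) by (field; nra).
    replace (2 * / ((INR k + 1) * (INR k + 2)) * ((INR k + 1) ^ 2 * (INR k + 2))) with (2 * (INR k + 1)) by (field; nra).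
    lra.
  - apply (ex_series_Rscal 2 (fun k => / (INR k + 1) - / (INR k + 2))).
    exists 1.
    assert (E : forall n, sum_n (fun k => / (INR k + 1) - / (INR k + 2)) n = 1 - / (INR n + 2)).
    { induction n as [|n IH]; [rewrite sum_O; simpl; field|]. rewrite sum_Sn, IH, S_INR.
      change (1 - / (INR n + 2) + (/ (INR n + 1 + 1) - / (INR n + 1 + 2)) = 1 - / (INR n + 1 + 2)).
      replace (INR n + 1 + 1) with (INR n + 2) by ring. ring. }
    unfold is_series. eapply filterlim_ext; [intros n; symmetry; apply E|].
    change (is_lim_seq (fun n => 1 - / (INR n + 2)) 1).
    replace (Finite 1) with (Finite (1 - 0)) by (f_equal; ring).
    apply (is_lim_seq_minus' (fun _ => 1) (fun n => / (INR n + 2)) 1 0); [apply is_lim_seq_const|].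
    apply (is_lim_seq_inv (fun n => INR n + 2) p_infty); [|discriminate].
    apply (is_lim_seq_plus _ _ p_infty 2 p_infty); [apply is_lim_seq_INR|apply is_lim_seq_const|reflexivity].
Qed.

(** The sum of [(x + i PI n)^(-j)] over nonzero integers [n], with [n] and [- n] paired into twice a
    real part; for [j = 1] the pairing makes it converge absolutely. Leaving out [n = 0] makes the
    function smooth at 0, where its value is wanted. *)
Definition sig (j : nat) (x : R) : R := Series (fun k => 2 * zre j x (PI * (INR k + 1))).

Lemma pik_pos (k : nat) : 1 <= INR k + 1 <= PI * (INR k + 1).
Proof. pose proof (pos_INR k). pose proof PI2_3_2. nra. Qed.

Lemma sig_term_bound (j k : nat) (x : R) : (2 <= j)%nat ->
  Rabs (2 * zre j x (PI * (INR k + 1))) <= 2 * / (INR k + 1) ^ 2.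
Proof.
  intros Hj. pose proof (pik_pos k) as Hk. rewrite Rabs_mult, (Rabs_pos_eq 2) by lra.
  apply Rmult_le_compat_l; [lra|]. eapply Rle_trans; [apply zre_bound; lra|].
  apply Rinv_le_contravar; [apply pow_lt; lra|].
  apply Rle_trans with ((INR k + 1) ^ j); [apply Rle_pow; lra || lia|apply pow_incr; lra].
Qed.

Lemma sig1_term_bound (k : nat) (x : R) :
  Rabs (2 * zre 1 x (PI * (INR k + 1))) <= 2 * Rabs x * / (INR k + 1) ^ 2.
Proof.
  pose proof (pik_pos k) as Hk. set (y := PI * (INR k + 1)) in *.
  rewrite Rabs_mult, (Rabs_pos_eq 2) by lra. rewrite Rmult_assoc.
  apply Rmult_le_compat_l; [lra|]. rewrite zre_S. unfold zre, zim; simpl zinv; simpl fst; simpl snd.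
  replace (x * 1 + y * 0) with x by ring. unfold Rdiv. rewrite Rabs_mult.
  apply Rmult_le_compat_l; [apply Rabs_pos|].
  assert (0 < x ^ 2 + y ^ 2) by nra.
  rewrite Rabs_pos_eq by (apply Rlt_le, Rinv_0_lt_compat; assumption).
  apply Rinv_le_contravar; [apply pow_lt; lra|]. assert ((INR k + 1) ^ 2 <= y ^ 2) by (apply pow_incr; lra).
  nra.
Qed.

Lemma ex_series_sig (j : nat) (x : R) : (1 <= j)%nat ->
  ex_series (fun k => 2 * zre j x (PI * (INR k + 1))).
Proof.
  intros Hj. destruct (Nat.eq_dec j 1) as [->|Hn].
  - apply ex_series_dominated with (fun k => 2 * Rabs x * / (INR k + 1) ^ 2);
      [intros k; apply sig1_term_bound|].
    apply ex_series_Rscal, ex_series_inv_sqr.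
  - apply ex_series_dominated with (fun k => 2 * / (INR k + 1) ^ 2);
      [intros k; apply sig_term_bound; lia|].
    apply ex_series_Rscal, ex_series_inv_sqr.
Qed.

Lemma is_derive_sig (j : nat) (x : R) : (1 <= j)%nat ->
  is_derive (sig j) x (- INR j * sig (S j) x).
Proof.
  intros Hj. unfold sig at 2. rewrite <- Series_scal_l.
  apply (is_derive_Series (fun k t => 2 * zre j t (PI * (INR k + 1)))
     (fun k t => - INR j * (2 * zre (S j) t (PI * (INR k + 1)))) (fun k => INR j * (2 * / (INR k + 1) ^ 2))).
  - apply filter_forall. intros t k. pose proof (pik_pos k) as Hk. split.
    + replace (- INR j * (2 * zre (S j) t (PI * (INR k + 1)))) with
        (2 * (- INR j * zre (S j) t (PI * (INR k + 1)))) by ring.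
      apply (is_derive_scal (fun t => zre j t (PI * (INR k + 1)))). apply is_derive_z. nra.
    + rewrite Rabs_mult, Rabs_Ropp, (Rabs_pos_eq (INR j)) by apply pos_INR.
      apply Rmult_le_compat_l; [apply pos_INR|]. apply sig_term_bound. lia.
  - apply filter_forall. intros t. apply ex_series_sig, Hj.
  - apply ex_series_Rscal.
    apply ex_series_Rscal, ex_series_inv_sqr.
Qed.

Definition coth (x : R) : R := cosh x / sinh x.

Lemma coth_partial (x : R) (n : nat) : 0 < x -> 2 * x / 2 ^ S n <= 1 ->
  Rabs (coth x - (/ x + 2 * sum_lt (fun k => zre 1 x (PI * (INR k + 1))) (2 ^ n)
     - zre 1 x (PI * INR (2 ^ n)))) <= 36 * x / 2 ^ S n.
Proof.
  intros Hx Hs. set (M := 2 ^ S n) in *. set (L := (2 ^ n)%nat).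
  assert (HM : 0 < M) by (apply pow_lt; lra).
  assert (HML : M = 2 * INR L) by (unfold M, L; rewrite pow_INR; reflexivity).
  assert (HL : INR (2 * L) = M) by (rewrite mult_INR, HML; reflexivity).
  (* Now [M t = 2 x], and [poisson (2 x) 0] is [coth x]; the angle [- PI + 2 PI k / M] belongs to
     the pole [i PI (k - L)] up to sign. *)
  set (t := 2 * x / M). assert (Ht : 0 < t <= 1) by (unfold t; split; [apply Rdiv_lt_0_compat; lra|exact Hs]).
  pose proof (poisson_sum (S n) t (- PI) ltac:(lra)) as E. fold M in E.
  replace (2 ^ S n)%nat with (2 * L)%nat in E by (unfold L; simpl; lia).
  assert (Ec : poisson (M * t) (M * - PI) = coth x).
  { unfold poisson. replace (M * t) with (2 * x) by (unfold t; field; lra).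
    replace (M * - PI) with (- (0 + 2 * INR L * PI)) by (rewrite HML; ring).
    rewrite cos_neg, cos_period, cos_0, sinh_double, cosh_double. unfold coth.
    pose proof (sinh_pos x Hx). replace (1 + 2 * sinh x ^ 2 - 1) with (2 * sinh x * sinh x) by ring. field. lra. }
  rewrite Ec in E.
  set (f := fun y => zre 1 x (PI * y)).
  assert (Hf : forall y, f y = x / (x ^ 2 + (PI * y) ^ 2)).
  { intros y. unfold f. rewrite zre_S. unfold zre, zim; simpl. f_equal; ring. }
  assert (Hmain : sum_lt (fun k => f (INR k - INR L)) (2 * L) =
     / x + 2 * sum_lt (fun k => zre 1 x (PI * (INR k + 1))) L - zre 1 x (PI * INR L)).
  { rewrite sum_lt_symmetric.
    - rewrite Hf. f_equal. f_equal; [field; lra|]. f_equal. apply sum_lt_ext. intros k _. unfold f. now rewrite S_INR.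
    - intros y. rewrite !Hf. f_equal. ring. }
  rewrite <- Hmain.
  replace (coth x) with (/ M * sum_lt (fun k => poisson t (- PI + 2 * PI * INR k / M)) (2 * L))
    by (rewrite <- E; field; lra).
  replace (sum_lt (fun k => f (INR k - INR L)) (2 * L)) with
    (/ M * sum_lt (fun k => M * f (INR k - INR L)) (2 * L)) by (rewrite sum_lt_scal; field; lra).
  rewrite <- Rmult_minus_distr_l.
  replace (sum_lt (fun k => poisson t (- PI + 2 * PI * INR k / M)) (2 * L) -
     sum_lt (fun k => M * f (INR k - INR L)) (2 * L)) with
    (sum_lt (fun k => poisson t (- PI + 2 * PI * INR k / M) + (-1) * (M * f (INR k - INR L))) (2 * L))
    by (rewrite sum_lt_plus, sum_lt_scal; ring).
  rewrite Rabs_mult, Rabs_pos_eq by (apply Rlt_le, Rinv_0_lt_compat, HM).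
  apply Rle_trans with (/ M * (INR (2 * L) * (18 * t))).
  - apply Rmult_le_compat_l; [apply Rlt_le, Rinv_0_lt_compat, HM|].
    apply sum_lt_Rabs_le. intros k Hk.
    set (psi := - PI + 2 * PI * INR k / M).
    assert (Hpsi : Rabs psi <= PI).
    { pose proof PI_RGT_0. apply lt_INR in Hk. rewrite HL in Hk. pose proof (pos_INR k).
      assert (0 <= INR k / M <= 1).
      { split; [apply Rmult_le_pos; [lra|apply Rlt_le, Rinv_0_lt_compat, HM]|].
        apply Rmult_le_reg_r with M; [exact HM|]. unfold Rdiv. rewrite Rmult_assoc, Rinv_l by lra. lra. }
      unfold psi. replace (2 * PI * INR k / M) with (2 * PI * (INR k / M)) by (field; lra).
      apply Rabs_le. nra. }
    pose proof (poisson_approx t psi Ht Hpsi) as P.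
    replace (M * f (INR k - INR L)) with (2 * t / (t ^ 2 + psi ^ 2)).
    + replace (poisson t psi + -1 * (2 * t / (t ^ 2 + psi ^ 2))) with (poisson t psi - 2 * t / (t ^ 2 + psi ^ 2)) by ring.
      exact P.
    + rewrite Hf.
      assert (HL0 : 0 < INR L) by lra.
      set (z := INR k - INR L).
      replace t with (x / INR L) by (unfold t; rewrite HML; field; lra).
      replace psi with (PI * z / INR L) by (unfold psi, z; rewrite HML; field; lra).
      rewrite HML. set (y := PI * z). assert (0 < x ^ 2 + y ^ 2) by nra.
      replace ((x / INR L) ^ 2 + (y / INR L) ^ 2) with ((x ^ 2 + y ^ 2) / (INR L * INR L)) by (field; lra).
      field. lra.
  - rewrite HL. unfold t. apply Req_le. field. lra.
Qed.

(** Repeated doubling reaches only the partial sums of length [2^n]; as the series is known to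
    converge, this subsequence determines its sum. *)
Lemma sig1_coth (x : R) : 0 < x -> sig 1 x = coth x - / x.
Proof.
  intros Hx.
  set (u := fun n => / x + 2 * sum_lt (fun k => zre 1 x (PI * (INR k + 1))) (2 ^ n) - zre 1 x (PI * INR (2 ^ n))).
  assert (Hpow : is_lim_seq (fun n => / 2 ^ S n) 0).
  { apply is_lim_seq_incr_1 with (u := fun n => / 2 ^ n).
    apply is_lim_seq_ext with (fun n => (/ 2) ^ n); [intros n; apply pow_inv|].
    apply is_lim_seq_geom. rewrite Rabs_pos_eq; lra. }
  assert (Hsub : is_lim_seq (fun n => INR (2 ^ n)) p_infty).
  { apply is_lim_seq_ext with (fun n => 2 ^ n); [intros n; now rewrite pow_INR|].
    apply is_lim_seq_geom_p. lra. }
  assert (U1 : is_lim_seq u (coth x)).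
  { apply is_lim_seq_spec. intros eps.
    assert (Hc : is_lim_seq (fun n => 36 * x * / 2 ^ S n) (36 * x * 0)).
    { apply is_lim_seq_mult'; [apply is_lim_seq_const|exact Hpow]. }
    rewrite Rmult_0_r in Hc. apply is_lim_seq_spec in Hc.
    assert (Hc2 : is_lim_seq (fun n => 2 * x * / 2 ^ S n) (2 * x * 0)).
    { apply is_lim_seq_mult'; [apply is_lim_seq_const|exact Hpow]. }
    rewrite Rmult_0_r in Hc2. apply is_lim_seq_spec in Hc2.
    generalize (filter_and _ _ (Hc eps) (Hc2 (mkposreal 1 Rlt_0_1))). apply filter_imp.
    intros n [h1 h2]. simpl pos in h2. rewrite Rminus_0_r in h1, h2.
    apply Rabs_def2 in h1. apply Rabs_def2 in h2.
    rewrite Rabs_minus_sym. eapply Rle_lt_trans; [apply (coth_partial x n Hx)|].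
    - unfold Rdiv. lra.
    - unfold Rdiv. lra. }
  assert (U2 : is_lim_seq u (/ x + sig 1 x - 0)).
  { unfold u. apply is_lim_seq_minus'; [apply is_lim_seq_plus'; [apply is_lim_seq_const|]|].
    - pose proof (is_lim_seq_sum_n _ (ex_series_sig 1 x (Nat.le_refl 1))) as HS. fold (sig 1 x) in HS.
      apply is_lim_seq_ext with (fun n => sum_n (fun k => 2 * zre 1 x (PI * (INR k + 1))) (pred (2 ^ n))).
      + intros n. rewrite <- sum_lt_S_sum_n. replace (S (pred (2 ^ n))) with (2 ^ n)%nat.
        * apply sum_lt_scal.
        * assert (2 ^ n <> 0)%nat by (apply Nat.pow_nonzero; lia). lia.
      + apply (is_lim_seq_subseq (sum_n (fun k => 2 * zre 1 x (PI * (INR k + 1)))) (sig 1 x) (fun n => pred (2 ^ n))); [|exact HS].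
        apply eventually_subseq. intros n. simpl.
        assert (2 ^ n <> 0)%nat by (apply Nat.pow_nonzero; lia). lia.
    - apply is_lim_seq_le_le with (fun n => 0) (fun n => x * / INR (2 ^ n)).
      + intros n. rewrite zre_S. unfold zre, zim; simpl zinv; simpl fst; simpl snd.
        set (y := INR (2 ^ n)).
        assert (Hy : 1 <= y).
        { unfold y. rewrite pow_INR. apply pow_R1_Rle. simpl; lra. }
        replace (x * 1 + PI * y * 0) with x by ring. unfold Rdiv.
        pose proof PI2_3_2. assert (y <= PI * y) by nra.
        assert (y <= x ^ 2 + (PI * y) ^ 2) by nra.
        split; [apply Rmult_le_pos; [lra|apply Rlt_le, Rinv_0_lt_compat; lra]|].
        apply Rmult_le_compat_l; [lra|]. apply Rinv_le_contravar; lra.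
      + apply is_lim_seq_const.
      + replace (Finite 0) with (Rbar_mult x 0) by (simpl; f_equal; ring).
        apply is_lim_seq_scal_l. apply (is_lim_seq_inv _ p_infty); [exact Hsub|discriminate]. }
  apply is_lim_seq_unique in U1. apply is_lim_seq_unique in U2. rewrite U1 in U2.
  injection U2 as E. lra.
Qed.

(** * Closed forms in [coth], and values at 0 *)

Lemma is_derive_coth (x : R) : 0 < x -> is_derive coth x (1 - coth x ^ 2).
Proof.
  intros Hx. pose proof (sinh_pos x Hx). unfold coth. auto_derive; [lra|]. field. lra.
Qed.

(** The derivative of [sig j] is computed twice: termwise, and from the closed form by
    [coth' = 1 - coth^2]. *)
Lemma sig_closed_step (j : nat) (P P' : R -> R) : (1 <= j)%nat ->
  (forall c, is_derive P c (P' c)) ->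
  (forall x, 0 < x -> sig j x = P (coth x) - / x ^ j) ->
  forall x, 0 < x -> sig (S j) x = (coth x ^ 2 - 1) * P' (coth x) / INR j - / x ^ S j.
Proof.
  intros Hj HP H x Hx.
  pose proof (is_derive_sig j x Hj) as D1. pose proof (is_derive_coth x Hx) as Dc.
  pose proof (HP (coth x)) as DP.
  assert (Hxj : forall i, 0 < x ^ i) by (intros i; apply pow_lt, Hx).
  assert (D2 : is_derive (sig j) x ((1 - coth x ^ 2) * P' (coth x) + INR j * / x ^ S j)).
  { apply is_derive_ext_loc with (fun t => P (coth t) - / t ^ j).
    - exists (mkposreal x Hx). intros t Ht. change (Rabs (t - x) < x) in Ht. apply Rabs_def2 in Ht.
      symmetry. apply H. lra.
    - auto_derive.
      + repeat match goal with |- _ /\ _ => split end; try exact I; try (eexists; eassumption).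
        apply Rgt_not_eq, Hxj.
      + rewrite_Derive Dc. rewrite_Derive DP. destruct j as [|j]; [lia|].
        simpl Init.Nat.pred. rewrite <- !tech_pow_Rmult. pose proof (Hxj j). field. lra. }
  apply is_derive_unique in D1. apply is_derive_unique in D2. rewrite D1 in D2.
  assert (0 < INR j) by (apply lt_0_INR; lia). pose proof (Hxj (S j)).
  apply Rmult_eq_reg_l with (- INR j); [|lra]. rewrite D2. field. lra.
Qed.

Lemma sig2_closed (x : R) : 0 < x -> sig 2 x = coth x ^ 2 - 1 - / x ^ 2.
Proof.
  intros Hx. rewrite (sig_closed_step 1 (fun c => c) (fun _ => 1)).
  - simpl. field. lra.
  - lia.
  - intros c. apply (is_derive_id c).
  - intros t Ht. rewrite sig1_coth by exact Ht. f_equal. simpl. now rewrite Rmult_1_r.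
  - exact Hx.
Qed.

Lemma sig3_closed (x : R) : 0 < x -> sig 3 x = coth x ^ 3 - coth x - / x ^ 3.
Proof.
  intros Hx. rewrite (sig_closed_step 2 (fun c => c ^ 2 - 1) (fun c => 2 * c)).
  - simpl. field. lra.
  - lia.
  - intros c. auto_derive; [exact I|simpl; ring].
  - apply sig2_closed.
  - exact Hx.
Qed.

Lemma sig4_closed (x : R) : 0 < x ->
  sig 4 x = (coth x ^ 2 - 1) ^ 2 + 2/3 * (coth x ^ 2 - 1) - / x ^ 4.
Proof.
  intros Hx. rewrite (sig_closed_step 3 (fun c => c ^ 3 - c) (fun c => 3 * c ^ 2 - 1)).
  - simpl. field. lra.
  - lia.
  - intros c. auto_derive; [exact I|simpl; ring].
  - apply sig3_closed.
  - exact Hx.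
Qed.

Lemma sig5_closed (x : R) : 0 < x ->
  sig 5 x = coth x ^ 5 - 5/3 * coth x ^ 3 + 2/3 * coth x - / x ^ 5.
Proof.
  intros Hx. rewrite (sig_closed_step 4 (fun c => (c ^ 2 - 1) ^ 2 + 2/3 * (c ^ 2 - 1)) (fun c => 4 * c ^ 3 - 8/3 * c)).
  - simpl. field. lra.
  - lia.
  - intros c. auto_derive; [exact I|simpl; field].
  - apply sig4_closed.
  - exact Hx.
Qed.

Lemma sig6_closed (x : R) : 0 < x ->
  sig 6 x = (coth x ^ 2 - 1) ^ 3 + (coth x ^ 2 - 1) ^ 2 + 2/15 * (coth x ^ 2 - 1) - / x ^ 6.
Proof.
  intros Hx. rewrite (sig_closed_step 5 (fun c => c ^ 5 - 5/3 * c ^ 3 + 2/3 * c) (fun c => 5 * c ^ 4 - 5 * c ^ 2 + 2/3)).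
  - simpl. field. lra.
  - lia.
  - intros c. auto_derive; [exact I|simpl; field].
  - apply sig5_closed.
  - exact Hx.
Qed.

(** Enters through the identity that evaluates [sig 6] at 0. *)
Lemma sig7_closed (x : R) : 0 < x ->
  sig 7 x = (coth x ^ 2 - 1) * (coth x ^ 5 - 4/3 * coth x ^ 3 + 17/45 * coth x) - / x ^ 7.
Proof.
  intros Hx. rewrite (sig_closed_step 6 (fun c => (c ^ 2 - 1) ^ 3 + (c ^ 2 - 1) ^ 2 + 2/15 * (c ^ 2 - 1))
     (fun c => 6 * c ^ 5 - 8 * c ^ 3 + 34/15 * c)).
  - simpl. field. lra.
  - lia.
  - intros c. auto_derive; [exact I|simpl; field].
  - apply sig6_closed.
  - exact Hx.
Qed.

(** The closed forms are singular at 0, so a relation between the [sig j] is verified for [x > 0]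
    and carried to 0 by continuity. *)
Lemma zero_at_0_of_zero_right (f : R -> R) : ex_derive f 0 -> (forall x, 0 < x -> f x = 0) -> f 0 = 0.
Proof.
  intros Hd H. apply (ex_derive_continuous f) in Hd.
  destruct (Req_dec (f 0) 0) as [E|E]; [exact E|exfalso].
  destruct (continuous_eps f 0 (Rabs (f 0)) Hd (Rabs_pos_lt _ E)) as [d [Hd1 C]].
  specialize (C (d/2)). rewrite H in C by lra. rewrite !Rminus_0_r in C.
  rewrite Rminus_0_l, Rabs_Ropp in C. rewrite (Rabs_pos_eq (d/2)) in C by lra. specialize (C ltac:(lra)). lra.
Qed.

Lemma ex_derive_sig (j : nat) (x : R) : (1 <= j)%nat -> ex_derive (sig j) x.
Proof. intros Hj. eexists. apply is_derive_sig, Hj. Qed.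

Lemma Series_zero (a : nat -> R) : (forall n, a n = 0) -> Series a = 0.
Proof.
  intros H. rewrite (Series_ext a (fun n => 0 * a n)) by (intros n; rewrite H; ring).
  rewrite Series_scal_l. ring.
Qed.

Lemma sig1_0 : sig 1 0 = 0.
Proof.
  apply Series_zero. intros k. rewrite zre_S. unfold zre, zim; simpl zinv; simpl fst; simpl snd.
  unfold Rdiv. ring.
Qed.

Lemma sig3_0 : sig 3 0 = 0.
Proof.
  apply Series_zero. intros k. repeat rewrite ?zre_S, ?zim_S.
  unfold zre, zim; simpl zinv; simpl fst; simpl snd. unfold Rdiv. ring.
Qed.

Ltac ex_derive_sigs := auto_derive;
  repeat match goal with |- _ /\ _ => split end; try exact I; apply ex_derive_sig; lia.

Ltac sigs_field x Hx :=
  rewrite ?(sig1_coth x Hx), ?(sig2_closed x Hx), ?(sig3_closed x Hx), ?(sig4_closed x Hx),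
    ?(sig5_closed x Hx), ?(sig6_closed x Hx), ?(sig7_closed x Hx);
  field; lra.

(* The identities for [sig 2], [sig 4] and [sig 6] below are the first, third and fifth derivatives
   of [x c' + 2 c = x - x c^2], the Riccati equation of [coth x = 1/x + c]. *)
Lemma sig2_0 : sig 2 0 = - / 3.
Proof.
  pose proof (zero_at_0_of_zero_right (fun x =>
    2 * x * sig 3 x - 3 * sig 2 x - 1 + sig 1 x ^ 2 - 2 * x * sig 1 x * sig 2 x)) as H.
  simpl in H. rewrite sig1_0 in H.
  assert (E : 2 * 0 * sig 3 0 - 3 * sig 2 0 - 1 + 0 * (0 * 1) - 2 * 0 * 0 * sig 2 0 = 0).
  { apply H; [ex_derive_sigs|]. intros x Hx. sigs_field x Hx. }
  lra.
Qed.

Lemma sig4_0 : sig 4 0 = 1 / 45.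
Proof.
  pose proof (zero_at_0_of_zero_right (fun x =>
    24 * x * sig 5 x - 30 * sig 4 x + (x * (- 12 * sig 2 x * sig 3 x - 12 * sig 1 x * sig 4 x)
       + 3 * (2 * sig 2 x ^ 2 + 4 * sig 1 x * sig 3 x)))) as H.
  cbv beta in H. rewrite sig1_0, sig2_0 in H.
  assert (E := H ltac:(ex_derive_sigs) ltac:(intros x Hx; sigs_field x Hx)). lra.
Qed.

Lemma sig6_0 : sig 6 0 = - 2 / 945.
Proof.
  pose proof (zero_at_0_of_zero_right (fun x =>
    720 * x * sig 7 x - 840 * sig 6 x
     + x * (- 240 * sig 1 x * sig 6 x - 240 * sig 2 x * sig 5 x - 240 * sig 3 x * sig 4 x)
     + 5 * (48 * sig 1 x * sig 5 x + 48 * sig 2 x * sig 4 x + 24 * sig 3 x ^ 2))) as H.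
  cbv beta in H. rewrite sig1_0, sig2_0, sig3_0, sig4_0 in H.
  assert (E := H ltac:(ex_derive_sigs) ltac:(intros x Hx; sigs_field x Hx)). lra.
Qed.

(** * Eisenstein sums of rectangular lattices *)

Lemma Cinv_Cpow_z (k : nat) (x y : R) : 0 < x ^ 2 + y ^ 2 ->
  Cinv (Defs.Cpow (x, y) k) = (zre k x y, zim k x y).
Proof.
  intros Hn. assert (Hz : ((x, y) : Complex.C) <> RtoC 0).
  { intros E. injection E as E1 E2. subst. lra. }
  assert (Hp : forall j, Defs.Cpow (x, y) j <> RtoC 0).
  { induction j as [|j IH]; simpl; [intros E; injection E; lra|]. apply Cmult_neq_0; assumption. }
  induction k as [|k IH].
  - simpl. unfold zre, zim, Cinv, RtoC; simpl. f_equal; field.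
  - change (Defs.Cpow (x, y) (S k)) with (Cmult (Defs.Cpow (x, y) k) (x, y)).
    assert (E : forall p z : Complex.C, p <> RtoC 0 -> z <> RtoC 0 -> Cinv (Cmult p z) = Cmult (Cinv p) (Cinv z))
      by (intros p z H1 H2; field; split; assumption).
    rewrite E by (apply Hp || assumption). rewrite IH, zre_S, zim_S. unfold Cinv, Cmult; simpl.
    simpl in Hn. f_equal; field; lra.
Qed.

Lemma z_origin (k : nat) : zre (S k) 0 0 = 0 /\ zim (S k) 0 0 = 0.
Proof. rewrite zre_S, zim_S. unfold Rdiv. split; ring. Qed.

Lemma sum_n_C (f : nat -> Complex.C) (n : nat) :
  sum_n f n = (sum_n (fun k => fst (f k)) n, sum_n (fun k => snd (f k)) n).
Proof.
  induction n as [|n IH].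
  - rewrite !sum_O. destruct (f 0%nat); reflexivity.
  - rewrite !sum_Sn, IH. reflexivity.
Qed.

Definition box (g : R -> R -> R) (N : nat) : R :=
  sum_lt (fun i => sum_lt (fun j => g (INR i - INR N) (INR j - INR N)) (2 * N + 1)) (2 * N + 1).

Lemma eis_partial_box (k : nat) (a b : R) (N : nat) : 0 < a -> 0 < b ->
  eis_partial (S k) (RtoC a) (Cmult Ci (RtoC b)) N =
  (box (fun m n => zre (S k) (2 * m * a) (2 * n * b)) N,
   box (fun m n => zim (S k) (2 * m * a) (2 * n * b)) N).
Proof.
  intros Ha Hb. unfold eis_partial, box. rewrite !Nat.add_1_r.
  assert (T : forall i j : nat,
    (let m := (Z.of_nat i - Z.of_nat N)%Z in let n := (Z.of_nat j - Z.of_nat N)%Z in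
      if (Z.eqb m 0 && Z.eqb n 0)%bool then RtoC 0
      else Cinv (Defs.Cpow (latpt (RtoC a) (Cmult Ci (RtoC b)) m n) (S k))) =
    (zre (S k) (2 * (INR i - INR N) * a) (2 * (INR j - INR N) * b),
     zim (S k) (2 * (INR i - INR N) * a) (2 * (INR j - INR N) * b))).
  { intros i j. cbv zeta.
    set (m := (Z.of_nat i - Z.of_nat N)%Z). set (n := (Z.of_nat j - Z.of_nat N)%Z).
    assert (Em : IZR m = INR i - INR N) by (unfold m; rewrite minus_IZR, <- !INR_IZR_INZ; reflexivity).
    assert (En : IZR n = INR j - INR N) by (unfold n; rewrite minus_IZR, <- !INR_IZR_INZ; reflexivity).
    rewrite <- Em, <- En. clearbody m n. destruct (Z.eqb m 0 && Z.eqb n 0)%bool eqn:Hz.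
    - apply andb_prop in Hz. destruct Hz as [H1 H2]. apply Z.eqb_eq in H1, H2. subst m n.
      rewrite !Rmult_0_r, !Rmult_0_l. destruct (z_origin k) as [-> ->]. reflexivity.
    - replace (latpt (RtoC a) (Cmult Ci (RtoC b)) m n) with ((2 * IZR m * a, 2 * IZR n * b) : Complex.C).
      + apply Cinv_Cpow_z.
        apply Bool.andb_false_iff in Hz. rewrite !Z.eqb_neq in Hz.
        assert (Hne : forall z c, z <> 0%Z -> 0 < c -> 0 < (2 * IZR z * c) ^ 2).
        { intros z c Hz' Hc. apply pow2_gt_0. apply not_0_IZR in Hz'.
          apply Rmult_integral_contrapositive. split; [|lra].
          apply Rmult_integral_contrapositive. split; [lra|exact Hz']. }
        pose proof (pow2_ge_0 (2 * IZR m * a)). pose proof (pow2_ge_0 (2 * IZR n * b)).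
        destruct Hz as [Hz|Hz]; [pose proof (Hne m a Hz Ha)|pose proof (Hne n b Hz Hb)]; lra.
      + unfold latpt, Cplus, Cmult, Ci, RtoC; simpl. f_equal; ring. }
  rewrite sum_n_C. rewrite !sum_lt_S_sum_n. cbv zeta in T |- *.
  f_equal; apply sum_n_ext; intros i; rewrite sum_lt_S_sum_n, sum_n_C; apply sum_n_ext; intros j;
    rewrite T; reflexivity.
Qed.

Lemma sum_lt_zero (f : nat -> R) (n : nat) : (forall k, (k < n)%nat -> f k = 0) -> sum_lt f n = 0.
Proof.
  induction n as [|n IH]; intros H; [reflexivity|]. simpl. rewrite IH, H by (intros; try apply H; lia). ring.
Qed.

(** For fixed [m] the points of index [n] and [- n] are conjugate, so their imaginary parts
    cancel. *)
Lemma box_zim (k : nat) (a b : R) (N : nat) : (forall x, zim k x 0 = 0) ->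
  box (fun m n => zim k (2 * m * a) (2 * n * b)) N = 0.
Proof.
  intros H0. unfold box. apply sum_lt_zero. intros i _.
  rewrite (sum_lt_centered (fun n => zim k (2 * (INR i - INR N) * a) (2 * n * b))).
  rewrite sum_lt_zero.
  - rewrite Rmult_0_r, Rmult_0_l, H0. ring.
  - intros j _. replace (2 * - INR (S j) * b) with (- (2 * INR (S j) * b)) by ring.
    rewrite (proj2 (z_sym _ _ _)). ring.
Qed.

Lemma z_scale (k : nat) (c x y : R) : 0 < c ->
  zre k x y = c ^ k * zre k (c * x) (c * y) /\ zim k x y = c ^ k * zim k (c * x) (c * y).
Proof.
  intros Hc. induction k as [|k [IH1 IH2]]; [unfold zre, zim; simpl; lra|].
  rewrite !zre_S, !zim_S, IH1, IH2.
  replace ((c * x) ^ 2 + (c * y) ^ 2) with (c ^ 2 * (x ^ 2 + y ^ 2)) by ring.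
  unfold Rdiv. rewrite Rinv_mult. simpl pow. set (z := / (x * (x * 1) + y * (y * 1))).
  assert (Ec : c * c * / (c * (c * 1)) = 1) by (field; lra).
  split.
  - transitivity ((x * (c ^ k * zre k (c * x) (c * y)) + y * (c ^ k * zim k (c * x) (c * y))) * z * (c * c * / (c * (c * 1))));
      [rewrite Ec|]; ring.
  - transitivity ((x * (c ^ k * zim k (c * x) (c * y)) - y * (c ^ k * zre k (c * x) (c * y))) * z * (c * c * / (c * (c * 1))));
      [rewrite Ec|]; ring.
Qed.

Lemma z_neg (k : nat) (x y : R) :
  zre k (- x) y = (-1) ^ k * zre k x y /\ zim k (- x) y = - (-1) ^ k * zim k x y.
Proof.
  induction k as [|k [IH1 IH2]]; [unfold zre, zim; simpl; lra|].
  rewrite !zre_S, !zim_S, IH1, IH2.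
  replace ((- x) ^ 2) with (x ^ 2) by ring. unfold Rdiv. simpl pow. split; ring.
Qed.

(** The sum of [(x + i PI n)^(-k)] over [|n| <= N], with conjugates paired. *)
Definition row (k N : nat) (x : R) : R :=
  zre k x 0 + sum_lt (fun j => 2 * zre k x (PI * (INR j + 1))) N.

(** Scaling by [PI / (2 b)] makes the imaginary period [i PI], so the sum over [n] becomes a [row]
    at a multiple of [PI a / b]; as [(-1)^k = 1], opposite rows agree. *)
Lemma box_rows (k : nat) (a b : R) (N : nat) : 0 < a -> 0 < b -> (-1) ^ k = 1 ->
  box (fun m n => zre k (2 * m * a) (2 * n * b)) N =
  (PI / (2 * b)) ^ k * (row k N 0 + 2 * sum_lt (fun i => row k N ((INR i + 1) * (PI * a / b))) N).
Proof.
  intros Ha Hb Hk. pose proof PI_RGT_0 as Hpi.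
  set (c := PI / (2 * b)). assert (Hc : 0 < c) by (apply Rdiv_lt_0_compat; lra).
  set (h := PI * a / b).
  assert (R1 : forall x, sum_lt (fun j => zre k (2 * x * a) (2 * (INR j - INR N) * b)) (2 * N + 1)
       = c ^ k * row k N (x * h)).
  { intros x. rewrite (sum_lt_centered (fun n => zre k (2 * x * a) (2 * n * b))).
    unfold row. rewrite Rmult_plus_distr_l, <- sum_lt_scal. f_equal.
    - rewrite (proj1 (z_scale k c _ _ Hc)). f_equal. f_equal; unfold c, h; field; lra.
    - apply sum_lt_ext. intros j _. replace (2 * - INR (S j) * b) with (- (2 * INR (S j) * b)) by ring.
      rewrite (proj1 (z_sym _ _ _)), (proj1 (z_scale k c _ _ Hc)), S_INR.
      replace (c * (2 * x * a)) with (x * h) by (unfold c, h; field; lra).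
      replace (c * (2 * (INR j + 1) * b)) with (PI * (INR j + 1)) by (unfold c; field; lra). ring. }
  unfold box.
  rewrite (sum_lt_ext _ (fun i => c ^ k * row k N ((INR i - INR N) * h))) by (intros i _; apply R1).
  rewrite sum_lt_scal. f_equal.
  rewrite (sum_lt_centered (fun m => row k N (m * h))). rewrite Rmult_0_l. f_equal.
  rewrite <- sum_lt_scal. apply sum_lt_ext. intros i _. rewrite S_INR.
  assert (E : forall x, row k N (- x) = row k N x).
  { intros x. unfold row. rewrite (proj1 (z_neg _ _ _)), Hk. f_equal; [ring|].
    apply sum_lt_ext. intros j _. rewrite (proj1 (z_neg _ _ _)), Hk. ring. }
  replace (- (INR i + 1) * h) with (- ((INR i + 1) * h)) by ring. rewrite E. ring.
Qed.

(** A box has [2 N + 1] rows, so the error must be uniform in [x] and smaller than [1/N]. For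
    [k >= 4] the tail terms are at most [2 / ((N + 1)^2 (i + 1)^2)]. *)
Lemma row_error (k N : nat) (x : R) : (4 <= k)%nat ->
  Rabs (row k N x - (zre k x 0 + sig k x)) <=
  2 * Series (fun i => / (INR i + 1) ^ 2) / (INR N + 1) ^ 2.
Proof.
  intros Hk. unfold row, sig. set (f := fun j => 2 * zre k x (PI * (INR j + 1))).
  assert (Hf : ex_series f) by (apply ex_series_sig; lia).
  assert (Hs : Series f - sum_lt f N = Series (fun i => f (N + i)%nat)).
  { destruct N as [|N]; [simpl; rewrite Rminus_0_r; reflexivity|]. rewrite (Series_incr_n f (S N)) by (lia || exact Hf).
    simpl Init.Nat.pred. rewrite sum_lt_S_sum_n, sum_n_Reals. ring. }
  replace (zre k x 0 + sum_lt f N - (zre k x 0 + Series f)) with (- Series (fun i => f (N + i)%nat)) by lra.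
  rewrite Rabs_Ropp.
  pose proof (pos_INR N) as HN.
  assert (Hb : forall i, Rabs (f (N + i)%nat) <= 2 / (INR N + 1) ^ 2 * / (INR i + 1) ^ 2).
  { intros i. unfold f. pose proof (pik_pos (N + i)) as Hp. pose proof (pos_INR i) as Hi.
    rewrite Rabs_mult, (Rabs_pos_eq 2) by lra. unfold Rdiv. rewrite Rmult_assoc.
    apply Rmult_le_compat_l; [lra|]. rewrite <- Rinv_mult.
    eapply Rle_trans; [apply zre_bound; lra|].
    apply Rinv_le_contravar; [apply Rmult_lt_0_compat; apply pow_lt; lra|].
    set (y := INR (N + i) + 1) in *.
    apply Rle_trans with (y ^ 4).
    - replace (y ^ 4) with (y ^ 2 * y ^ 2) by ring.
      assert (INR (N + i) = INR N + INR i) by apply plus_INR.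
      apply Rmult_le_compat; try apply pow2_ge_0; apply pow_incr; unfold y; lra.
    - apply Rle_trans with (y ^ k); [apply Rle_pow; lra || lia|apply pow_incr; lra]. }
  assert (Hg : ex_series (fun i => 2 / (INR N + 1) ^ 2 * / (INR i + 1) ^ 2))
    by (apply ex_series_Rscal, ex_series_inv_sqr).
  eapply Rle_trans; [apply Series_Rabs|].
  - apply ex_series_dominated with (fun i => 2 / (INR N + 1) ^ 2 * / (INR i + 1) ^ 2); [|exact Hg].
    intros i. rewrite Rabs_Rabsolu. apply Hb.
  - eapply Rle_trans; [apply Series_le; [intros i; split; [apply Rabs_pos|apply Hb]|exact Hg]|].
    rewrite Series_scal_l. apply Req_le. field. lra.
Qed.

Lemma box_limit (k : nat) (a b l0 : R) (r : nat -> R) : 0 < a -> 0 < b -> (-1) ^ k = 1 -> (4 <= k)%nat ->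
  zre k 0 0 + sig k 0 = l0 ->
  (forall i, zre k ((INR i + 1) * (PI * a / b)) 0 + sig k ((INR i + 1) * (PI * a / b)) = r i) ->
  ex_series r ->
  is_lim_seq (box (fun m n => zre k (2 * m * a) (2 * n * b)))
    ((PI / (2 * b)) ^ k * (l0 + 2 * Series r)).
Proof.
  intros Ha Hb Hk Hk4 H0 Hr Hex.
  set (h := PI * a / b) in *. set (Z := Series (fun i => / (INR i + 1) ^ 2)).
  apply is_lim_seq_ext with (fun N => (PI / (2 * b)) ^ k * (row k N 0 + 2 * sum_lt (fun i => row k N ((INR i + 1) * h)) N)).
  { intros N. symmetry. apply box_rows; assumption. }
  apply (is_lim_seq_mult' (fun _ => (PI / (2 * b)) ^ k)); [apply is_lim_seq_const|].
  set (u := fun N => row k N 0 + 2 * sum_lt (fun i => row k N ((INR i + 1) * h)) N).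
  set (v := fun N => l0 + 2 * sum_lt r N).
  assert (Hv : is_lim_seq v (l0 + 2 * Series r)).
  { unfold v. apply is_lim_seq_plus'; [apply is_lim_seq_const|].
    apply is_lim_seq_mult'; [apply is_lim_seq_const|].
    apply is_lim_seq_incr_1. apply is_lim_seq_ext with (sum_n r); [intros n; symmetry; apply sum_lt_S_sum_n|].
    apply is_lim_seq_sum_n, Hex. }
  assert (Hd : forall N, Rabs (u N - v N) <= 4 * Z * / (INR N + 1)).
  { intros N. pose proof (pos_INR N) as HN. set (e := 2 * Z / (INR N + 1) ^ 2).
    assert (E0 : Rabs (row k N 0 - l0) <= e) by (rewrite <- H0; apply row_error, Hk4).
    assert (E1 : Rabs (sum_lt (fun i => row k N ((INR i + 1) * h) + (-1) * r i) N) <= INR N * e).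
    { apply sum_lt_Rabs_le. intros i _. rewrite <- Hr.
      replace (row k N ((INR i + 1) * h) + -1 * (zre k ((INR i + 1) * h) 0 + sig k ((INR i + 1) * h)))
        with (row k N ((INR i + 1) * h) - (zre k ((INR i + 1) * h) 0 + sig k ((INR i + 1) * h))) by ring.
      apply row_error, Hk4. }
    rewrite sum_lt_plus, sum_lt_scal in E1.
    replace (u N - v N) with ((row k N 0 - l0) + 2 * (sum_lt (fun i => row k N ((INR i + 1) * h)) N + -1 * sum_lt r N))
      by (unfold u, v; ring).
    eapply Rle_trans; [apply Rabs_triang|]. rewrite Rabs_mult, (Rabs_pos_eq 2) by lra.
    assert (HZ : 0 <= Z).
    { unfold Z. rewrite <- (Series_zero (fun _ => 0)) by reflexivity. apply Series_le; [|apply ex_series_inv_sqr].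
      intros n. split; [lra|]. apply Rlt_le, Rinv_0_lt_compat, pow_lt. pose proof (pos_INR n). lra. }
    apply Rle_trans with (2 * (INR N + 1) * e).
    - assert (0 <= e) by (unfold e; apply Rmult_le_pos; [lra|apply Rlt_le, Rinv_0_lt_compat, pow_lt; lra]). nra.
    - unfold e. apply Req_le. field. lra. }
  assert (Hlim : is_lim_seq (fun N => 4 * Z * / (INR N + 1)) 0).
  { replace (Finite 0) with (Rbar_mult (4 * Z) 0) by (simpl; f_equal; ring).
    apply is_lim_seq_scal_l. apply (is_lim_seq_inv (fun n => INR n + 1) p_infty); [|discriminate].
    apply (is_lim_seq_plus _ _ p_infty 1 p_infty); [apply is_lim_seq_INR|apply is_lim_seq_const|reflexivity]. }
  assert (Hdiff : is_lim_seq (fun N => u N - v N) 0).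
  { apply is_lim_seq_abs_0. apply is_lim_seq_le_le with (fun _ => 0) (fun N => 4 * Z * / (INR N + 1)).
    - intros N. split; [apply Rabs_pos|apply Hd].
    - apply is_lim_seq_const.
    - exact Hlim. }
  apply is_lim_seq_ext with (fun N => (u N - v N) + v N); [intros N; ring|].
  replace (l0 + 2 * Series r) with (0 + (l0 + 2 * Series r)) by ring.
  apply is_lim_seq_plus'; assumption.
Qed.

(** * Eisenstein sums as series in [1 / sinh^2] *)

Definition csq (x : R) : R := / sinh x ^ 2.

Definition csum (j : nat) (h : R) : R := Series (fun i => 2 * csq ((INR i + 1) * h) ^ j).

Lemma coth_csq (x : R) : 0 < x -> coth x ^ 2 - 1 = csq x.
Proof.
  intros Hx. pose proof (sinh_pos x Hx). unfold coth, csq.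
  replace ((cosh x / sinh x) ^ 2) with (cosh x ^ 2 / sinh x ^ 2) by (field; lra).
  rewrite cosh2_sinh2. field. lra.
Qed.

Lemma sinh_ge_id (x : R) : 0 <= x -> x <= sinh x.
Proof.
  intros Hx. apply (le_of_derive_le (fun t => t) sinh (fun _ => 1) cosh x); try derive_solve; try lra.
  - intros t Ht. destruct (Req_dec t 0) as [->|]; [rewrite cosh_0_eq; lra|]. left. apply cosh_gt_1; lra.
  - rewrite sinh_0; lra.
Qed.

Lemma csq_bounds (x : R) : 0 < x -> 0 < csq x <= / x ^ 2.
Proof.
  intros Hx. pose proof (sinh_ge_id x ltac:(lra)). unfold csq. split.
  - apply Rinv_0_lt_compat, pow_lt. lra.
  - apply Rinv_le_contravar; [apply pow_lt, Hx|]. apply pow_incr; lra.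
Qed.

Lemma csum_term_bound (j i : nat) (h : R) : 0 < h -> (1 <= j)%nat ->
  0 <= 2 * csq ((INR i + 1) * h) ^ j <= 2 / h ^ (2 * j) * / (INR i + 1) ^ 2.
Proof.
  intros Hh Hj. pose proof (pos_INR i) as Hi.
  pose proof (csq_bounds ((INR i + 1) * h) ltac:(nra)) as [C1 C2].
  assert (Hhj : 0 < h ^ (2 * j)) by (apply pow_lt, Hh).
  split; [apply Rmult_le_pos; [lra|apply pow_le; lra]|].
  unfold Rdiv. rewrite Rmult_assoc. apply Rmult_le_compat_l; [lra|]. rewrite <- Rinv_mult.
  eapply Rle_trans; [apply pow_incr; split; [lra|exact C2]|].
  rewrite pow_inv. apply Rinv_le_contravar; [apply Rmult_lt_0_compat; [exact Hhj|apply pow_lt; lra]|].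
  rewrite <- pow_mult, Rpow_mult_distr, Rmult_comm. apply Rmult_le_compat_r; [lra|].
  apply Rle_pow; lra || lia.
Qed.

Lemma ex_series_csum (j : nat) (h : R) : 0 < h -> (1 <= j)%nat ->
  ex_series (fun i => 2 * csq ((INR i + 1) * h) ^ j).
Proof.
  intros Hh Hj. apply ex_series_dominated with (fun i => 2 / h ^ (2 * j) * / (INR i + 1) ^ 2).
  - intros i. pose proof (csum_term_bound j i h Hh Hj). rewrite Rabs_pos_eq; lra.
  - apply ex_series_Rscal, ex_series_inv_sqr.
Qed.

(** [E4] and [E6] are the sums of the powers -4 and -6 of the nonzero [m h + i PI n]. The constants
    [1/45 = 2 zeta(4) / PI^4] and [- 2/945 = - 2 zeta(6) / PI^6] are the rows [m = 0]; each other
    row is a polynomial in [csq (m h)]. *)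
Definition E4 (h : R) : R := 1 / 45 + csum 2 h + 2 / 3 * csum 1 h.
Definition E6 (h : R) : R := - 2 / 945 + csum 3 h + csum 2 h + 2 / 15 * csum 1 h.

Lemma box4_limit (a b : R) : 0 < a -> 0 < b ->
  is_lim_seq (box (fun m n => zre 4 (2 * m * a) (2 * n * b))) ((PI / (2 * b)) ^ 4 * E4 (PI * a / b)).
Proof.
  intros Ha Hb. pose proof PI_RGT_0. set (h := PI * a / b).
  assert (Hh : 0 < h) by (unfold h; apply Rdiv_lt_0_compat; nra).
  pose proof (ex_series_csum 1 h Hh ltac:(lia)) as X1. pose proof (ex_series_csum 2 h Hh ltac:(lia)) as X2.
  assert (X1' : ex_series (fun i => 2 / 3 * (2 * csq ((INR i + 1) * h) ^ 1)))
    by (apply ex_series_Rscal, X1).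
  set (r := fun i => / 2 * (2 * csq ((INR i + 1) * h) ^ 2 + 2 / 3 * (2 * csq ((INR i + 1) * h) ^ 1))).
  assert (Xr : ex_series r).
  { apply ex_series_Rscal.
    apply ex_series_Rplus; assumption. }
  replace (E4 h) with (1 / 45 + 2 * Series r).
  - apply box_limit; try assumption; [simpl; ring|lia| |].
    + rewrite sig4_0, (proj1 (z_origin 3)). ring.
    (* The term [n = 0] of the row is [1 / x^4], which cancels the pole in [sig4_closed]. *)
    + intros i. fold h. set (x := (INR i + 1) * h).
      assert (Hx : 0 < x) by (unfold x; pose proof (pos_INR i); nra).
      rewrite sig4_closed, (proj1 (z_real 4 x ltac:(lra))), coth_csq by exact Hx. unfold r. fold x. field. lra.
  - unfold r. rewrite Series_scal_l, Series_plus by assumption. rewrite (Series_scal_l (2 / 3)).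
    unfold E4, csum. field.
Qed.

Lemma box6_limit (a b : R) : 0 < a -> 0 < b ->
  is_lim_seq (box (fun m n => zre 6 (2 * m * a) (2 * n * b))) ((PI / (2 * b)) ^ 6 * E6 (PI * a / b)).
Proof.
  intros Ha Hb. pose proof PI_RGT_0. set (h := PI * a / b).
  assert (Hh : 0 < h) by (unfold h; apply Rdiv_lt_0_compat; nra).
  pose proof (ex_series_csum 1 h Hh ltac:(lia)) as X1. pose proof (ex_series_csum 2 h Hh ltac:(lia)) as X2.
  pose proof (ex_series_csum 3 h Hh ltac:(lia)) as X3.
  assert (X1' : ex_series (fun i => 2 / 15 * (2 * csq ((INR i + 1) * h) ^ 1)))
    by (apply ex_series_Rscal, X1).
  assert (X23 : ex_series (fun i => 2 * csq ((INR i + 1) * h) ^ 3 + 2 * csq ((INR i + 1) * h) ^ 2))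
    by (apply ex_series_Rplus; assumption).
  set (r := fun i => / 2 * (2 * csq ((INR i + 1) * h) ^ 3 + 2 * csq ((INR i + 1) * h) ^ 2
     + 2 / 15 * (2 * csq ((INR i + 1) * h) ^ 1))).
  assert (Xr : ex_series r).
  { apply ex_series_Rscal.
    apply ex_series_Rplus; assumption. }
  replace (E6 h) with (- 2 / 945 + 2 * Series r).
  - apply box_limit; try assumption; [simpl; ring|lia| |].
    + rewrite sig6_0, (proj1 (z_origin 5)). ring.
    + intros i. fold h. set (x := (INR i + 1) * h).
      assert (Hx : 0 < x) by (unfold x; pose proof (pos_INR i); nra).
      rewrite sig6_closed, (proj1 (z_real 6 x ltac:(lra))), coth_csq by exact Hx. unfold r. fold x. field. lra.
  - unfold r. rewrite Series_scal_l, Series_plus by assumption. rewrite Series_plus by assumption.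
    rewrite (Series_scal_l (2 / 15)). unfold E6, csum. field.
Qed.

(** * Exchange of the two periods *)

Lemma zre4_swap (x y : R) : zre 4 y x = zre 4 x y.
Proof.
  repeat rewrite ?zre_S, ?zim_S. unfold zre, zim; simpl zinv; simpl fst; simpl snd.
  rewrite (Rplus_comm (y ^ 2) (x ^ 2)). unfold Rdiv. ring.
Qed.

Lemma zre6_swap (x y : R) : zre 6 y x = - zre 6 x y.
Proof.
  repeat rewrite ?zre_S, ?zim_S. unfold zre, zim; simpl zinv; simpl fst; simpl snd.
  rewrite (Rplus_comm (y ^ 2) (x ^ 2)). unfold Rdiv. ring.
Qed.

Lemma sum_lt_exchange (f : nat -> nat -> R) (m n : nat) :
  sum_lt (fun i => sum_lt (f i) n) m = sum_lt (fun j => sum_lt (fun i => f i j) m) n.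
Proof.
  induction m as [|m IH]; simpl.
  - symmetry. apply sum_lt_zero. reflexivity.
  - rewrite IH, <- sum_lt_plus. reflexivity.
Qed.

(** A square box is preserved when [m] and [n] are exchanged, which turns the lattice by a right
    angle up to conjugation. The same partial sums thus have two limits by rows, which must agree.
    Here [i^4 = 1]; for [E6] it is [i^6 = -1] that brings the sign. *)
Lemma E4_reciprocal (h : R) : 0 < h -> E4 (PI ^ 2 / h) = (h / PI) ^ 4 * E4 h.
Proof.
  intros Hh. pose proof PI_RGT_0 as Hpi.
  pose proof (box4_limit (h / PI) 1 ltac:(apply Rdiv_lt_0_compat; lra) Rlt_0_1) as L1.
  pose proof (box4_limit 1 (h / PI) Rlt_0_1 ltac:(apply Rdiv_lt_0_compat; lra)) as L2.
  apply is_lim_seq_ext with (v := box (fun m n => zre 4 (2 * m * 1) (2 * n * (h / PI)))) in L1.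
  - apply is_lim_seq_unique in L1. apply is_lim_seq_unique in L2. rewrite L1 in L2. apply (f_equal real) in L2. cbn [real Rbar_opp] in L2. rename L2 into E.
    replace (PI * (h / PI) / 1) with h in E by (field; lra).
    replace (PI * 1 / (h / PI)) with (PI ^ 2 / h) in E by (field; lra).
    apply Rmult_eq_reg_l with ((PI / (2 * (h / PI))) ^ 4); [|apply pow_nonzero, Rgt_not_eq; repeat apply Rdiv_lt_0_compat; try lra; apply Rmult_lt_0_compat; [lra|apply Rdiv_lt_0_compat; lra]].
    rewrite <- E. field. lra.
  - intros N. unfold box. rewrite sum_lt_exchange. apply sum_lt_ext. intros i _. apply sum_lt_ext. intros j _.
    apply zre4_swap.
Qed.

Lemma E6_reciprocal (h : R) : 0 < h -> E6 (PI ^ 2 / h) = - ((h / PI) ^ 6 * E6 h).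
Proof.
  intros Hh. pose proof PI_RGT_0 as Hpi.
  pose proof (box6_limit (h / PI) 1 ltac:(apply Rdiv_lt_0_compat; lra) Rlt_0_1) as L1.
  pose proof (box6_limit 1 (h / PI) Rlt_0_1 ltac:(apply Rdiv_lt_0_compat; lra)) as L2.
  apply is_lim_seq_opp in L1.
  apply is_lim_seq_ext with (v := box (fun m n => zre 6 (2 * m * 1) (2 * n * (h / PI)))) in L1.
  - apply is_lim_seq_unique in L1. apply is_lim_seq_unique in L2. rewrite L1 in L2. apply (f_equal real) in L2. cbn [real Rbar_opp] in L2. rename L2 into E.
    replace (PI * (h / PI) / 1) with h in E by (field; lra).
    replace (PI * 1 / (h / PI)) with (PI ^ 2 / h) in E by (field; lra).
    apply Rmult_eq_reg_l with ((PI / (2 * (h / PI))) ^ 6); [|apply pow_nonzero, Rgt_not_eq; repeat apply Rdiv_lt_0_compat; try lra; apply Rmult_lt_0_compat; [lra|apply Rdiv_lt_0_compat; lra]].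
    rewrite <- E. field. lra.
  - intros N. unfold box. rewrite sum_lt_exchange.
    match goal with |- - ?X = _ => replace (- X) with ((-1) * X) by ring end. rewrite <- sum_lt_scal.
    apply sum_lt_ext. intros i _. rewrite <- sum_lt_scal. apply sum_lt_ext. intros j _.
    rewrite zre6_swap. ring.
Qed.

Lemma filterlim_C_real (f : nat -> Complex.C) (l : R) :
  is_lim_seq (fun n => fst (f n)) l -> (forall n, snd (f n) = 0) ->
  filterlim f Hierarchy.eventually (locally (RtoC l)).
Proof.
  intros H1 H2. apply filterlim_locally. intros eps.
  apply is_lim_seq_spec in H1. generalize (H1 eps). apply filter_imp. intros n Hn.
  split.
  - exact Hn.
  - change (Rabs (snd (f n) - 0) < eps). rewrite H2, Rminus_0_r, Rabs_R0. apply cond_pos.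
Qed.

Lemma zim_S_real (x : R) (k : nat) : zim (S k) x 0 = 0.
Proof.
  destruct (Req_dec x 0) as [->|Hx]; [apply z_origin|]. apply z_real, Hx.
Qed.

Lemma invariants_rectangular (a b : R) : 0 < a -> 0 < b ->
  lattice_has_invariants (RtoC a) (Cmult Ci (RtoC b))
    (RtoC ((PI / (2 * b)) ^ 4 * (60 * E4 (PI * a / b))))
    (RtoC ((PI / (2 * b)) ^ 6 * (140 * E6 (PI * a / b)))).
Proof.
  intros Ha Hb.
  assert (HC : forall c x, Cmult (RtoC c) (x, 0) = (c * x, 0))
    by (intros; unfold Cmult, RtoC; simpl; f_equal; ring).
  split; apply filterlim_C_real; intros; try (rewrite eis_partial_box, box_zim, HC by (assumption || (intros; apply zim_S_real)); reflexivity).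
  - replace (Finite ((PI / (2 * b)) ^ 4 * (60 * E4 (PI * a / b)))) with
      (Rbar_mult 60 ((PI / (2 * b)) ^ 4 * E4 (PI * a / b))) by (simpl; f_equal; ring).
    eapply is_lim_seq_ext; [|apply is_lim_seq_scal_l, box4_limit; assumption].
    intros N. cbv beta. rewrite eis_partial_box, box_zim, HC by (assumption || (intros; apply zim_S_real)). reflexivity.
  - replace (Finite ((PI / (2 * b)) ^ 6 * (140 * E6 (PI * a / b)))) with
      (Rbar_mult 140 ((PI / (2 * b)) ^ 6 * E6 (PI * a / b))) by (simpl; f_equal; ring).
    eapply is_lim_seq_ext; [|apply is_lim_seq_scal_l, box6_limit; assumption].
    intros N. cbv beta. rewrite eis_partial_box, box_zim, HC by (assumption || (intros; apply zim_S_real)). reflexivity.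
Qed.

(** * The Weierstrass function of a rectangular lattice on the real axis *)

Definition csq1 (x : R) : R := - 2 * coth x * csq x.
Definition csq2 (x : R) : R := 6 * csq x ^ 2 + 4 * csq x.

Lemma is_derive_csq (x : R) : 0 < x -> is_derive csq x (csq1 x).
Proof.
  intros Hx. pose proof (sinh_pos x Hx). unfold csq, csq1, coth, csq.
  auto_derive; [nra|]. field. lra.
Qed.

Lemma is_derive_csq1 (x : R) : 0 < x -> is_derive csq1 x (csq2 x).
Proof.
  intros Hx. pose proof (is_derive_csq x Hx) as D1. pose proof (is_derive_coth x Hx) as D2.
  unfold csq1. auto_derive; [solve_ex_derive|].
  rewrite_Derive D1. rewrite_Derive D2. unfold csq2, csq1. pose proof (coth_csq x Hx) as E.
  transitivity (- 2 * csq x + 2 * coth x ^ 2 * csq x + 4 * coth x ^ 2 * csq x); [ring|].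
  replace (coth x ^ 2) with (1 + csq x) by lra. ring.
Qed.

Lemma sinh_add (x y : R) : sinh (x + y) = sinh x * cosh y + cosh x * sinh y.
Proof.
  unfold sinh, cosh. rewrite Ropp_plus_distr, !exp_plus. field.
Qed.

Lemma cosh_add (x y : R) : cosh (x + y) = cosh x * cosh y + sinh x * sinh y.
Proof.
  unfold sinh, cosh. rewrite Ropp_plus_distr, !exp_plus. field.
Qed.

Lemma sinh_opp (x : R) : sinh (- x) = - sinh x.
Proof. unfold sinh. rewrite Ropp_involutive. field. Qed.

Lemma cosh_opp (x : R) : cosh (- x) = cosh x.
Proof. unfold cosh. rewrite Ropp_involutive. field. Qed.

Lemma csq_opp (x : R) : csq (- x) = csq x.
Proof. unfold csq. rewrite sinh_opp. f_equal. ring. Qed.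

Lemma coth_opp (x : R) : coth (- x) = - coth x.
Proof. unfold coth. rewrite sinh_opp, cosh_opp. unfold Rdiv. rewrite Rinv_opp. ring. Qed.

Lemma csq_0 : csq 0 = 0.
Proof. unfold csq. rewrite sinh_0. replace (0 ^ 2) with 0 by ring. apply Rinv_0. Qed.

Definition decay (h : R) : R := exp (- (2 * h)).

Lemma decay_bounds (h : R) : 0 < h -> 0 < decay h < 1.
Proof.
  intros Hh. unfold decay. split; [apply exp_pos|]. rewrite <- exp_0. apply exp_increasing. lra.
Qed.

Lemma exp_INR_mult (x : R) (n : nat) : exp (INR n * x) = exp x ^ n.
Proof.
  induction n as [|n IH]; [simpl; rewrite Rmult_0_l, exp_0; reflexivity|].
  rewrite S_INR, Rmult_plus_distr_r, exp_plus, IH, Rmult_1_l. simpl. ring.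
Qed.

(** [cosh x > sinh x] in the addition formula gives [sinh (x + y) >= sinh x exp y]. *)
Lemma csq_shift_le (x y : R) : 0 < x -> 0 <= y -> csq (x + y) <= csq x * exp (- (2 * y)).
Proof.
  intros Hx Hy. pose proof (sinh_pos x Hx) as Hs.
  assert (L : sinh x * exp y <= sinh (x + y)).
  { rewrite sinh_add. unfold sinh at 3. unfold cosh at 1.
    pose proof (exp_pos (- y)).
    assert (1 <= exp y) by (rewrite <- exp_0; destruct (Req_dec y 0) as [->|]; [lra|left; apply exp_increasing; lra]).
    assert (exp (- y) <= exp y).
    { destruct (Req_dec y 0) as [->|]; [rewrite Ropp_0; lra|left; apply exp_increasing; lra]. }
    assert (sinh x < cosh x) by (unfold sinh, cosh; pose proof (exp_pos (- x)); lra).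
    nra. }
  unfold csq. replace (exp (- (2 * y))) with (/ exp y ^ 2).
  - rewrite <- Rinv_mult, <- Rpow_mult_distr. pose proof (exp_pos y).
    apply Rinv_le_contravar; [apply pow_lt; nra|]. apply pow_incr. nra.
  - replace (- (2 * y)) with (- (INR 2 * y)) by (simpl; ring). now rewrite exp_Ropp, exp_INR_mult.
Qed.

Lemma csq_decay (x h : R) (n : nat) : 0 < x -> 0 < h -> csq (x + INR n * h) <= csq x * decay h ^ n.
Proof.
  intros Hx Hh. pose proof (pos_INR n).
  eapply Rle_trans; [apply csq_shift_le; [exact Hx|nra]|].
  apply Rmult_le_compat_l; [apply Rlt_le, csq_bounds, Hx|]. apply Req_le.
  unfold decay. rewrite <- exp_INR_mult. f_equal. ring.
Qed.

Lemma csq_decreasing (x y : R) : 0 < x <= y -> csq y <= csq x.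
Proof.
  intros H. pose proof (sinh_pos x ltac:(lra)). unfold csq.
  assert (sinh x <= sinh y) by (destruct (Req_dec x y) as [->|]; [lra|left; apply sinh_lt; lra]).
  apply Rinv_le_contravar; [apply pow_lt; lra|]. apply pow_incr; lra.
Qed.

Lemma coth_bounds (x : R) : 0 < x -> 1 < coth x < 1 + csq x.
Proof.
  intros Hx. pose proof (coth_csq x Hx) as E. pose proof (csq_bounds x Hx) as [C1 _].
  assert (0 < coth x) by (apply Rdiv_lt_0_compat; [apply cosh_pos|apply sinh_pos, Hx]).
  split; nra.
Qed.

Definition rsum (h u : R) : R := Series (fun n => csq (u + INR n * h)).
Definition rsum1 (h u : R) : R := Series (fun n => csq1 (u + INR n * h)).
Definition rsum2 (h u : R) : R := Series (fun n => csq2 (u + INR n * h)).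

Definition rsum_maj (e h : R) (n : nat) : R := (8 + 8 * csq e) * csq e * decay h ^ n.

Lemma ex_series_rsum_maj (e h : R) : 0 < h -> ex_series (rsum_maj e h).
Proof.
  intros Hh. apply ex_series_Rscal.
  pose proof (decay_bounds h Hh). apply ex_series_geom. rewrite Rabs_pos_eq; lra.
Qed.

Lemma rsum_terms_le (e h u : R) (n : nat) : 0 < h -> 0 < e <= u ->
  Rabs (csq (u + INR n * h)) <= rsum_maj e h n /\
  Rabs (csq1 (u + INR n * h)) <= rsum_maj e h n /\
  Rabs (csq2 (u + INR n * h)) <= rsum_maj e h n.
Proof.
  intros Hh Hu. pose proof (pos_INR n) as Hn. set (x := u + INR n * h).
  assert (Hx : 0 < x) by (unfold x; nra).
  pose proof (csq_bounds x Hx) as [C1 _]. pose proof (coth_bounds x Hx) as B.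
  assert (Hd : 0 < decay h ^ n) by (apply pow_lt, decay_bounds, Hh).
  assert (D1 : csq x <= csq e * decay h ^ n).
  { apply Rle_trans with (csq u * decay h ^ n); [apply csq_decay; lra|].
    apply Rmult_le_compat_r; [lra|]. apply csq_decreasing, Hu. }
  assert (D2 : csq x <= csq e) by (apply csq_decreasing; unfold x; nra).
  assert (He : 0 < csq e) by (apply csq_bounds; lra).
  set (m := csq e * decay h ^ n) in *.
  assert (Hm : 0 < m) by (unfold m; nra).
  replace (rsum_maj e h n) with ((8 + 8 * csq e) * m) by (unfold rsum_maj, m; ring).
  repeat split.
  - rewrite Rabs_pos_eq; nra.
  - unfold csq1. replace (-2 * coth x * csq x) with (- (2 * coth x * csq x)) by ring.
    assert (0 < coth x * csq x) by nra.
    rewrite Rabs_Ropp, Rabs_pos_eq by lra.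
    assert (coth x * csq x <= (1 + csq e) * m) by (apply Rmult_le_compat; lra). nra.
  - unfold csq2. rewrite Rabs_pos_eq by nra.
    assert (csq x * csq x <= csq e * m) by (apply Rmult_le_compat; lra). nra.
Qed.

Lemma ex_series_rsum (h u : R) : 0 < h -> 0 < u ->
  ex_series (fun n => csq (u + INR n * h)) /\ ex_series (fun n => csq1 (u + INR n * h)) /\
  ex_series (fun n => csq2 (u + INR n * h)).
Proof.
  intros Hh Hu. pose proof (fun n => rsum_terms_le u h u n Hh ltac:(lra)) as B.
  pose proof (ex_series_rsum_maj u h Hh).
  repeat split; apply ex_series_dominated with (rsum_maj u h); try assumption; intros n; apply B.
Qed.

Lemma locally_half (u : R) : 0 < u -> locally u (fun t => u / 2 < t).
Proof.
  intros Hu. assert (H : 0 < u / 2) by lra. exists (mkposreal _ H). intros t Ht.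
  change (Rabs (t - u) < u / 2) in Ht. apply Rabs_def2 in Ht. lra.
Qed.

Lemma is_derive_shift (f : R -> R) (l c x : R) : is_derive f (x + c) l -> is_derive (fun t => f (t + c)) x l.
Proof.
  intros D. auto_derive; [eexists; exact D|]. rewrite_Derive D. ring.
Qed.

Lemma is_derive_rsum (h u : R) : 0 < h -> 0 < u -> is_derive (rsum h) u (rsum1 h u).
Proof.
  intros Hh Hu. apply (is_derive_Series (fun n t => csq (t + INR n * h)) (fun n t => csq1 (t + INR n * h)) (rsum_maj (u/2) h)).
  - generalize (locally_half u Hu). apply filter_imp. intros t Ht n. split.
    + apply is_derive_shift, is_derive_csq. pose proof (pos_INR n). nra.
    + apply rsum_terms_le; lra.
  - generalize (locally_half u Hu). apply filter_imp. intros t Ht. apply ex_series_rsum; lra.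
  - apply ex_series_rsum_maj, Hh.
Qed.

Lemma is_derive_rsum1 (h u : R) : 0 < h -> 0 < u -> is_derive (rsum1 h) u (rsum2 h u).
Proof.
  intros Hh Hu. apply (is_derive_Series (fun n t => csq1 (t + INR n * h)) (fun n t => csq2 (t + INR n * h)) (rsum_maj (u/2) h)).
  - generalize (locally_half u Hu). apply filter_imp. intros t Ht n. split.
    + apply is_derive_shift, is_derive_csq1. pose proof (pos_INR n). nra.
    + apply rsum_terms_le; lra.
  - generalize (locally_half u Hu). apply filter_imp. intros t Ht. apply ex_series_rsum; lra.
  - apply ex_series_rsum_maj, Hh.
Qed.

(** [csq] is even, so the pole at [(n + 1) h] contributes [csq ((n + 1) h - u)], a term of
    [rsum h (h - u)]; for [0 < u < h] all arguments are then positive. *)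
Definition psum (h u : R) : R := rsum h u + rsum h (h - u).
Definition psum1 (h u : R) : R := rsum1 h u - rsum1 h (h - u).
Definition psum2 (h u : R) : R := rsum2 h u + rsum2 h (h - u).

Lemma is_derive_psum (h u : R) : 0 < u < h -> is_derive (psum h) u (psum1 h u).
Proof.
  intros Hu. pose proof (is_derive_rsum h u ltac:(lra) ltac:(lra)) as D1.
  pose proof (is_derive_rsum h (h - u) ltac:(lra) ltac:(lra)) as D2.
  unfold psum. auto_derive; [solve_ex_derive|].
  rewrite_Derive D1. replace (h + - u) with (h - u) by ring. rewrite_Derive D2. unfold psum1. ring.
Qed.

Lemma is_derive_psum1 (h u : R) : 0 < u < h -> is_derive (psum1 h) u (psum2 h u).
Proof.
  intros Hu. pose proof (is_derive_rsum1 h u ltac:(lra) ltac:(lra)) as D1.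
  pose proof (is_derive_rsum1 h (h - u) ltac:(lra) ltac:(lra)) as D2.
  unfold psum1. auto_derive; [solve_ex_derive|].
  rewrite_Derive D1. replace (h + - u) with (h - u) by ring. rewrite_Derive D2. unfold psum2. ring.
Qed.

Lemma rsum2_pos (h u : R) : 0 < h -> 0 < u -> 0 < rsum2 h u.
Proof.
  intros Hh Hu. destruct (ex_series_rsum h u Hh Hu) as (_ & _ & X).
  assert (P : forall n, 0 < csq2 (u + INR n * h)).
  { intros n. pose proof (pos_INR n). destruct (csq_bounds (u + INR n * h)) as [C1 _]; [nra|]. unfold csq2. nra. }
  unfold rsum2. rewrite Series_incr_1 by exact X. pose proof (P 0%nat).
  assert (0 <= Series (fun n => csq2 (u + INR (S n) * h))); [|lra].
  rewrite <- (Series_zero (fun _ => 0)) by reflexivity. apply Series_le.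
  - intros n. split; [lra|left; apply P].
  - apply ex_series_incr_1 in X. exact X.
Qed.

(** [rsum1] is increasing, since its derivative [rsum2] is positive, and [u < h - u]. *)
Lemma psum1_neg (h u : R) : 0 < h -> 0 < u < h / 2 -> psum1 h u < 0.
Proof.
  intros Hh Hu. destruct (MVT_gen (rsum1 h) u (h - u) (rsum2 h)) as [c [Hc E]].
  - rewrite Rmin_left, Rmax_right by lra. intros x Hx. apply is_derive_rsum1; lra.
  - rewrite Rmin_left, Rmax_right by lra. intros x Hx. apply continuity_pt_filterlim, (ex_derive_continuous (rsum1 h)).
    eexists. apply is_derive_rsum1; lra.
  - rewrite Rmin_left, Rmax_right in Hc by lra. pose proof (rsum2_pos h c Hh ltac:(lra)).
    unfold psum1. nra.
Qed.

(** For a fixed difference [d = x - y] this is the partial fraction decomposition in [x]: double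
    poles of weight [csq d] where [x] or [y] vanishes, with residues [2 csq d coth d] and its
    opposite. *)
Lemma csq_mult (x y : R) : sinh x <> 0 -> sinh y <> 0 -> sinh (x - y) <> 0 ->
  csq x * csq y = csq (x - y) * (csq x + csq y + 2 * coth (x - y) * (coth x - coth y)).
Proof.
  intros Hx Hy Hd. unfold coth, csq.
  assert (Es : sinh (x - y) = sinh x * cosh y - cosh x * sinh y)
    by (unfold Rminus; rewrite sinh_add, sinh_opp, cosh_opp; ring).
  assert (Ec : cosh (x - y) = cosh x * cosh y - sinh x * sinh y)
    by (unfold Rminus; rewrite cosh_add, sinh_opp, cosh_opp; ring).
  pose proof (cosh2_sinh2 x) as Cx. pose proof (cosh2_sinh2 y) as Cy.
  set (a := sinh x) in *. set (b := cosh x) in *. set (s := sinh y) in *. set (c := cosh y) in *.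
  set (d := sinh (x - y)) in *. rewrite Ec.
  (* [coth x - coth y = - d / (a s)] turns the bracket into [(d^2) / (a^2 s^2)] *)
  replace (b / a - c / s) with (- d / (a * s)) by (rewrite Es; field; lra).
  transitivity (/ d ^ 2 * (d ^ 2 / (a ^ 2 * s ^ 2))); [field; auto|]. f_equal.
  transitivity ((s ^ 2 + a ^ 2 - 2 * (b * c - a * s) * (a * s)) / (a ^ 2 * s ^ 2)); [|field; auto].
  f_equal. rewrite Es.
  transitivity (a ^ 2 * c ^ 2 + s ^ 2 * b ^ 2 - 2 * a * s * b * c); [ring|]. rewrite Cx, Cy. ring.
Qed.

Lemma sum_lt_scal_r (c : R) (f : nat -> R) (n : nat) : sum_lt (fun k => f k * c) n = sum_lt f n * c.
Proof. induction n as [|n IH]; simpl; [ring|]. rewrite IH. ring. Qed.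

Lemma sum_lt_delta (c : R) (i n : nat) : (i < n)%nat ->
  sum_lt (fun j => if Nat.eqb i j then c else 0) n = c.
Proof.
  induction n as [|n IH]; intros Hi; [lia|]. simpl.
  destruct (Nat.eqb_spec i n) as [->|Hn].
  - rewrite sum_lt_zero; [ring|]. intros k Hk. destruct (Nat.eqb_spec n k); [lia|reflexivity].
  - rewrite IH by lia. ring.
Qed.

(** The products off the diagonal are decomposed by [csq_mult]. The inner sums may include [j = i]
    because [csq 0 = 0] by the convention on inverses. The [coth] terms of [(i, j)] and [(j, i)] add
    up because [coth] is odd, whence the factor 4. *)
Lemma sum_csq_sqr (x : nat -> R) (n : nat) :
  (forall i, (i < n)%nat -> sinh (x i) <> 0) ->
  (forall i j, (i < n)%nat -> (j < n)%nat -> i <> j -> sinh (x i - x j) <> 0) ->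
  sum_lt (fun i => csq (x i)) n ^ 2 =
  sum_lt (fun i => csq (x i) ^ 2) n
  + 2 * sum_lt (fun i => csq (x i) * sum_lt (fun j => csq (x i - x j)) n) n
  + 4 * sum_lt (fun i => coth (x i) * sum_lt (fun j => csq (x i - x j) * coth (x i - x j)) n) n.
Proof.
  intros H1 H2.
  set (S1 := sum_lt (fun i => csq (x i) * sum_lt (fun j => csq (x i - x j)) n) n).
  set (S2 := sum_lt (fun i => coth (x i) * sum_lt (fun j => csq (x i - x j) * coth (x i - x j)) n) n).
  assert (P : forall i j, (i < n)%nat -> (j < n)%nat -> csq (x i) * csq (x j) =
     (if Nat.eqb i j then csq (x i) ^ 2 else 0)
     + (csq (x i) * csq (x i - x j) + csq (x j) * csq (x i - x j)
     + (2 * (coth (x i) * (csq (x i - x j) * coth (x i - x j)))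
     + - 2 * (coth (x j) * (csq (x i - x j) * coth (x i - x j)))))).
  { intros i j Hi Hj. destruct (Nat.eqb_spec i j) as [->|Hn].
    - rewrite Rminus_diag, csq_0. ring.
    - rewrite csq_mult by auto. ring. }
  replace (sum_lt (fun i => csq (x i)) n ^ 2) with
    (sum_lt (fun i => sum_lt (fun j => csq (x i) * csq (x j)) n) n).
  2:{ rewrite (sum_lt_ext _ (fun i => csq (x i) * sum_lt (fun j => csq (x j)) n)) by (intros; apply sum_lt_scal).
      rewrite sum_lt_scal_r. ring. }
  rewrite (sum_lt_ext _ (fun i => csq (x i) ^ 2 + (csq (x i) * sum_lt (fun j => csq (x i - x j)) n
     + sum_lt (fun j => csq (x j) * csq (x i - x j)) n
     + (2 * (coth (x i) * sum_lt (fun j => csq (x i - x j) * coth (x i - x j)) n)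
     + - 2 * sum_lt (fun j => coth (x j) * (csq (x i - x j) * coth (x i - x j))) n)))).
  2:{ intros i Hi. rewrite (sum_lt_ext _ _ n (fun j Hj => P i j Hi Hj)).
      rewrite !sum_lt_plus, !sum_lt_scal, sum_lt_delta by exact Hi. reflexivity. }
  rewrite !sum_lt_plus, !sum_lt_scal. fold S1 S2.
  rewrite (sum_lt_exchange (fun i j => csq (x j) * csq (x i - x j))).
  rewrite (sum_lt_exchange (fun i j => coth (x j) * (csq (x i - x j) * coth (x i - x j)))).
  replace (sum_lt (fun j => sum_lt (fun i => csq (x j) * csq (x i - x j)) n) n) with S1.
  2:{ apply sum_lt_ext. intros j _. rewrite <- sum_lt_scal. apply sum_lt_ext. intros i _.
      rewrite <- (csq_opp (x j - x i)). now replace (- (x j - x i)) with (x i - x j) by ring. }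
  replace (sum_lt (fun j => sum_lt (fun i => coth (x j) * (csq (x i - x j) * coth (x i - x j))) n) n) with (- S2).
  2:{ unfold S2. rewrite <- (Rmult_1_l (sum_lt _ n)), Ropp_mult_distr_l, <- sum_lt_scal.
      apply sum_lt_ext. intros j _. rewrite <- !sum_lt_scal. apply sum_lt_ext. intros i _.
      rewrite <- (csq_opp (x j - x i)).
      replace (x i - x j) with (- (x j - x i)) by ring. rewrite coth_opp. ring. }
  ring.
Qed.

Lemma sum_lt_pos_tail (f : nat -> R) (K r : R) (n : nat) : 0 < r < 1 ->
  (forall k, Rabs (f k) <= K * r ^ k) -> Rabs (Series f - sum_lt f n) <= K / (1 - r) * r ^ n.
Proof.
  intros Hr Hf.
  assert (HG : ex_series (fun k => K * r ^ k)).
  { apply ex_series_Rscal. apply ex_series_geom. rewrite Rabs_pos_eq; lra. }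
  assert (Xf : ex_series f) by (apply ex_series_dominated with (fun k => K * r ^ k); assumption).
  assert (Hs : Series f - sum_lt f n = Series (fun i => f (n + i)%nat)).
  { destruct n as [|n]; [simpl; rewrite Rminus_0_r; reflexivity|]. rewrite (Series_incr_n f (S n)) by (lia || exact Xf).
    simpl Init.Nat.pred. rewrite sum_lt_S_sum_n, sum_n_Reals. ring. }
  rewrite Hs.
  assert (Hb : forall i, Rabs (f (n + i)%nat) <= r ^ n * (K * r ^ i)).
  { intros i. eapply Rle_trans; [apply Hf|]. rewrite pow_add. apply Req_le. ring. }
  assert (HG' : ex_series (fun i => r ^ n * (K * r ^ i)))
    by (apply ex_series_Rscal, HG).
  eapply Rle_trans; [apply Series_Rabs|].
  - apply ex_series_dominated with (fun i => r ^ n * (K * r ^ i)); [|exact HG'].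
    intros i. rewrite Rabs_Rabsolu. apply Hb.
  - eapply Rle_trans; [apply Series_le; [intros i; split; [apply Rabs_pos|apply Hb]|exact HG']|].
    rewrite !Series_scal_l, Series_geom by (rewrite Rabs_pos_eq; lra). apply Req_le. field. lra.
Qed.

(** * A window of [2 N + 1] poles, and its truncation errors *)

Definition xpt (h u : R) (N i : nat) : R := u - (INR i - INR N) * h.

Lemma xpt_cases (h u : R) (N i : nat) : 0 < u < h ->
  (exists n, (n + i = N)%nat /\ xpt h u N i = u + INR n * h) \/
  (exists n, (N + 1 + n = i)%nat /\ xpt h u N i = - (h - u + INR n * h)).
Proof.
  intros Hu. unfold xpt. destruct (Nat.le_gt_cases i N) as [L|L].
  - left. exists (N - i)%nat. split; [lia|]. rewrite minus_INR by exact L. ring.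
  - right. exists (i - N - 1)%nat. split; [lia|]. rewrite !minus_INR by lia. simpl (INR 1). ring.
Qed.

Lemma xpt_sinh (h u : R) (N i : nat) : 0 < u < h -> sinh (xpt h u N i) <> 0.
Proof.
  intros Hu. destruct (xpt_cases h u N i Hu) as [[n [_ ->]]|[n [_ ->]]]; pose proof (pos_INR n).
  - apply Rgt_not_eq, sinh_pos. nra.
  - rewrite sinh_opp. apply Rlt_not_eq. assert (0 < sinh (h - u + INR n * h)) by (apply sinh_pos; nra). lra.
Qed.

(** The inner sums over a window miss their limits by about [r^i + r^(2 N - i)], with [r = decay h].
    This is large only near the ends, where [csq] is itself of order [r^N]; so the product is of
    order [r^N] for every [i]. The division by [decay h] is for the points with [i > N]: their index
    is [n + 1] away from [N] but their decay is only [r^n]. *)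
Lemma xpt_csq (h u : R) (N i : nat) : 0 < u < h -> (i < 2 * N + 1)%nat ->
  0 < csq (xpt h u N i) /\
  csq (xpt h u N i) * (decay h ^ i + decay h ^ (2 * N - i)) <=
    2 * (csq u + csq (h - u) / decay h) * decay h ^ N.
Proof.
  intros Hu Hi. pose proof (decay_bounds h ltac:(lra)) as Hr. set (r := decay h) in *.
  pose proof (csq_bounds u ltac:(lra)) as [C1 _]. pose proof (csq_bounds (h - u) ltac:(lra)) as [C2 _].
  assert (C3 : 0 < csq (h - u) / r) by (apply Rdiv_lt_0_compat; lra).
  assert (Hp : forall k, 0 < r ^ k) by (intros k; apply pow_lt; lra).
  assert (Hle : forall j k, (j <= k)%nat -> r ^ k <= r ^ j).
  { intros j k Hjk. replace k with (j + (k - j))%nat by lia. rewrite pow_add.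
    assert (r ^ (k - j) <= 1) by (rewrite <- (pow1 (k - j)); apply pow_incr; lra).
    pose proof (Hp j). nra. }
  assert (Main : forall m, (N <= m + i)%nat -> (N <= m + (2 * N - i))%nat ->
     r ^ m * (r ^ i + r ^ (2 * N - i)) <= 2 * r ^ N).
  { intros m H1 H2. rewrite Rmult_plus_distr_l, <- !pow_add.
    pose proof (Hle _ _ H1). pose proof (Hle _ _ H2). lra. }
  assert (Hq : 0 < r ^ i + r ^ (2 * N - i)) by (pose proof (Hp i); pose proof (Hp (2 * N - i)%nat); lra).
  pose proof (Hp N).
  destruct (xpt_cases h u N i Hu) as [[n [En ->]]|[n [En ->]]]; pose proof (pos_INR n).
  - split; [apply csq_bounds; nra|].
    pose proof (csq_decay u h n ltac:(lra) ltac:(lra)) as D. fold r in D.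
    specialize (Main n ltac:(lia) ltac:(lia)).
    apply Rle_trans with (csq u * (r ^ n * (r ^ i + r ^ (2 * N - i)))); [rewrite <- Rmult_assoc; apply Rmult_le_compat_r; lra|].
    apply Rle_trans with (csq u * (2 * r ^ N)); [apply Rmult_le_compat_l; lra|]. nra.
  - rewrite csq_opp. split; [apply csq_bounds; nra|].
    pose proof (csq_decay (h - u) h n ltac:(lra) ltac:(lra)) as D. fold r in D.
    specialize (Main (S n) ltac:(lia) ltac:(lia)).
    apply Rle_trans with (csq (h - u) / r * (r ^ S n * (r ^ i + r ^ (2 * N - i)))).
    + rewrite <- Rmult_assoc. apply Rmult_le_compat_r; [lra|].
      replace (csq (h - u) / r * r ^ S n) with (csq (h - u) * r ^ n) by (simpl; field; lra). exact D.
    + apply Rle_trans with (csq (h - u) / r * (2 * r ^ N)); [apply Rmult_le_compat_l; lra|]. nra.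
Qed.

(** [coth] tends to 1 or -1 along the window and does not decay. Points of the same index for [u]
    and [v] have the same sign, so these constants cancel; hence two values of [u] are compared
    instead of computing a limit. *)
Lemma xpt_coth_diff (h u v : R) (N i : nat) : 0 < u < h -> 0 < v < h ->
  Rabs (coth (xpt h u N i) - coth (xpt h v N i)) <= csq (xpt h u N i) + csq (xpt h v N i).
Proof.
  intros Hu Hv.
  assert (P : forall x y, 0 < x -> 0 < y -> Rabs (coth x - coth y) <= csq x + csq y).
  { intros x y Hx Hy. pose proof (coth_bounds x Hx). pose proof (coth_bounds y Hy).
    pose proof (csq_bounds x Hx). pose proof (csq_bounds y Hy). apply Rabs_le. lra. }
  destruct (xpt_cases h u N i Hu) as [[n [En ->]]|[n [En ->]]];
  destruct (xpt_cases h v N i Hv) as [[m [Em ->]]|[m [Em ->]]]; try lia;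
  pose proof (pos_INR n); pose proof (pos_INR m).
  - apply P; nra.
  - rewrite !coth_opp, !csq_opp.
    replace (- coth (h - u + INR n * h) - - coth (h - v + INR m * h)) with (- (coth (h - u + INR n * h) - coth (h - v + INR m * h))) by ring.
    rewrite Rabs_Ropp. apply P; nra.
Qed.

(** Bernoulli's inequality gives [exp h ^ N >= 1 + N h], and the square of the right-hand side beats
    the linear factor. *)
Lemma linear_decay_lim (h : R) : 0 < h -> is_lim_seq (fun N => INR (2 * N + 1) * decay h ^ N) 0.
Proof.
  intros Hh.
  apply is_lim_seq_le_le with (fun _ => 0) (fun N => (2 / h + 1) * / (1 + INR N * h)).
  - intros N. pose proof (pos_INR N) as HN.
    assert (Hd : decay h ^ N <= / (1 + INR N * h) ^ 2).
    { unfold decay. replace (exp (- (2 * h))) with (/ exp h ^ 2).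
      - rewrite pow_inv. apply Rinv_le_contravar; [apply pow_lt; nra|].
        rewrite <- pow_mult, Nat.mul_comm, pow_mult. apply pow_incr. split; [nra|].
        apply Rle_trans with ((1 + h) ^ N); [apply poly, Hh|]. apply pow_incr. split; [lra|].
        left. apply exp_ineq1. lra.
      - replace (2 * h) with (INR 2 * h) by (simpl; ring). now rewrite exp_Ropp, exp_INR_mult. }
    assert (0 < decay h ^ N) by (apply pow_lt, decay_bounds, Hh).
    rewrite plus_INR, mult_INR. simpl (INR 1). change (INR 2) with 2.
    assert (Hx : 0 < 1 + INR N * h) by nra.
    split; [nra|].
    apply Rle_trans with ((2 * INR N + 1) * / (1 + INR N * h) ^ 2); [apply Rmult_le_compat_l; lra|].
    replace (/ (1 + INR N * h)) with ((1 + INR N * h) * / (1 + INR N * h) ^ 2) by (field; lra).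
    rewrite <- Rmult_assoc. apply Rmult_le_compat_r; [apply Rlt_le, Rinv_0_lt_compat, pow_lt, Hx|].
    replace ((2 / h + 1) * (1 + INR N * h)) with (2 * INR N + 1 + (2 / h + INR N * h)) by (field; lra).
    assert (0 < 2 / h) by (apply Rdiv_lt_0_compat; lra). nra.
  - apply is_lim_seq_const.
  - replace (Finite 0) with (Rbar_mult (2 / h + 1) 0) by (simpl; f_equal; ring).
    apply is_lim_seq_scal_l. apply (is_lim_seq_inv (fun n => 1 + INR n * h) p_infty); [|discriminate].
    apply (is_lim_seq_plus _ _ 1 p_infty p_infty); [apply is_lim_seq_const| |reflexivity].
    apply is_lim_seq_ext with (fun n => h * INR n); [intros; ring|].
    replace p_infty with (Rbar_mult h p_infty).
    + apply is_lim_seq_scal_l, is_lim_seq_INR.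
    + simpl. destruct (Rle_dec 0 h) as [L|L]; [|lra]. destruct (Rle_lt_or_eq_dec 0 h L); [reflexivity|lra].
Qed.

Lemma psum_limits (h u : R) : 0 < u < h ->
  is_lim_seq (fun N => sum_lt (fun i => csq (xpt h u N i)) (2 * N + 1)) (psum h u) /\
  is_lim_seq (fun N => sum_lt (fun i => csq2 (xpt h u N i)) (2 * N + 1)) (psum2 h u).
Proof.
  intros Hu.
  assert (G : forall f : R -> R, (forall x, f (- x) = f x) ->
    ex_series (fun n => f (u + INR n * h)) -> ex_series (fun n => f (h - u + INR n * h)) ->
    is_lim_seq (fun N => sum_lt (fun i => f (xpt h u N i)) (2 * N + 1))
      (Series (fun n => f (u + INR n * h)) + Series (fun n => f (h - u + INR n * h)))).
  { intros f He X1 X2.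
    apply is_lim_seq_ext with (fun N => sum_lt (fun n => f (u + INR n * h)) (N + 1) + sum_lt (fun n => f (h - u + INR n * h)) N).
    - intros N. unfold xpt.
      replace (2 * N + 1)%nat with (N + 1 + N)%nat by lia.
      rewrite (sum_lt_around (fun m => f (u - m * h)) N N).
      rewrite (Nat.add_comm N 1), (sum_lt_add _ 1 N). cbn [sum_lt].
      rewrite (sum_lt_ext (fun l => f (u - - (INR l + 1) * h)) (fun k => f (u + INR (1 + k) * h))).
      2:{ intros k _. f_equal. change (1 + k)%nat with (S k). rewrite S_INR. ring. }
      rewrite (sum_lt_ext (fun l => f (u - (INR l + 1) * h)) (fun k => f (h - u + INR k * h))).
      2:{ intros k _. rewrite <- He. f_equal. ring. }
      replace (u - 0 * h) with (u + INR 0 * h) by (simpl; ring). ring.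
    - apply is_lim_seq_plus'.
      + apply is_lim_seq_ext with (sum_n (fun n => f (u + INR n * h))).
        * intros N. now rewrite Nat.add_1_r, sum_lt_S_sum_n.
        * apply is_lim_seq_sum_n, X1.
      + apply is_lim_seq_incr_1. apply is_lim_seq_ext with (sum_n (fun n => f (h - u + INR n * h))).
        * intros N. now rewrite sum_lt_S_sum_n.
        * apply is_lim_seq_sum_n, X2. }
  destruct (ex_series_rsum h u ltac:(lra) ltac:(lra)) as (X1 & _ & X2).
  destruct (ex_series_rsum h (h - u) ltac:(lra) ltac:(lra)) as (Y1 & _ & Y2).
  split; apply G; try assumption; intros x; unfold csq2; rewrite csq_opp; reflexivity.
Qed.

(* The contribution to [psum^2] of the pairs of distinct poles, less [2 A psum]: by [csq_mult] it is the
   limit of a telescoping sum of values of [coth], hence does not depend on [u]. *)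
Definition psum_defect (h u : R) : R := psum h u ^ 2 - (psum2 h u - 4 * psum h u) / 6 - 2 * csum 1 h * psum h u.

Lemma psum_defect_const (h u v : R) : 0 < u < h -> 0 < v < h -> psum_defect h u = psum_defect h v.
Proof.
  intros Hu Hv. assert (Hh : 0 < h) by lra. pose proof (decay_bounds h Hh) as Hr. set (r := decay h) in *.
  set (A := csum 1 h).
  set (t := fun w N => sum_lt (fun i => csq (xpt h w N i)) (2 * N + 1)).
  set (t2 := fun w N => sum_lt (fun i => csq2 (xpt h w N i)) (2 * N + 1)).
  (* The analogue of [psum_defect] on the window; [(t2 - 4 t) / 6] is the sum of the [csq^2]. *)
  set (Q := fun w N => t w N ^ 2 - (t2 w N - 4 * t w N) / 6 - 2 * A * t w N).
  assert (LQ : forall w, 0 < w < h -> is_lim_seq (Q w) (psum_defect h w)).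
  { intros w Hw. destruct (psum_limits h w Hw) as [L1 L2]. fold (t w) in L1. fold (t2 w) in L2.
    unfold Q, psum_defect. fold A.
    apply is_lim_seq_ext with (fun N => t w N * t w N - (t2 w N - 4 * t w N) * / 6 - 2 * A * t w N);
      [intros N; unfold Rdiv; ring|].
    replace (psum h w ^ 2) with (psum h w * psum h w) by ring. unfold Rdiv.
    repeat first [apply is_lim_seq_minus' | apply is_lim_seq_mult' | exact L1 | exact L2 | apply is_lim_seq_const]. }
  (* Up to truncation [a N i] is [A], and [b N i] is 0 because its summand is odd. *)
  set (a := fun N i => sum_lt (fun j => csq ((INR j - INR i) * h)) (2 * N + 1)).
  set (b := fun N i => sum_lt (fun j => csq ((INR j - INR i) * h) * coth ((INR j - INR i) * h)) (2 * N + 1)).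
  assert (EQ : forall w N, 0 < w < h -> Q w N =
     2 * sum_lt (fun i => csq (xpt h w N i) * (a N i - A)) (2 * N + 1)
     + 4 * sum_lt (fun i => coth (xpt h w N i) * b N i) (2 * N + 1)).
  { intros w N Hw.
    assert (Ed : forall i j, xpt h w N i - xpt h w N j = (INR j - INR i) * h) by (intros; unfold xpt; ring).
    assert (E := sum_csq_sqr (xpt h w N) (2 * N + 1) (fun i _ => xpt_sinh h w N i Hw)).
    assert (Hd : forall i j : nat, (i < 2 * N + 1)%nat -> (j < 2 * N + 1)%nat -> i <> j -> sinh (xpt h w N i - xpt h w N j) <> 0).
    { intros i j _ _ Hij. rewrite Ed. destruct (Rtotal_order (INR j - INR i) 0) as [L|[L|L]].
      - replace ((INR j - INR i) * h) with (- ((INR i - INR j) * h)) by ring. rewrite sinh_opp.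
        assert (0 < sinh ((INR i - INR j) * h)) by (apply sinh_pos; nra). lra.
      - exfalso. apply Hij, INR_eq. lra.
      - apply Rgt_not_eq, sinh_pos. nra. }
    specialize (E Hd). fold (t w N) in E.
    rewrite (sum_lt_ext (fun i => csq (xpt h w N i) * sum_lt (fun j => csq (xpt h w N i - xpt h w N j)) (2 * N + 1))
       (fun i => csq (xpt h w N i) * a N i)) in E.
    2:{ intros i _. f_equal. apply sum_lt_ext. intros j _. now rewrite Ed. }
    rewrite (sum_lt_ext (fun i => coth (xpt h w N i) * sum_lt (fun j => csq (xpt h w N i - xpt h w N j) * coth (xpt h w N i - xpt h w N j)) (2 * N + 1))
       (fun i => coth (xpt h w N i) * b N i)) in E.
    2:{ intros i _. f_equal. apply sum_lt_ext. intros j _. now rewrite Ed. }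
    unfold Q. rewrite E.
    rewrite (sum_lt_ext (fun i => csq (xpt h w N i) * (a N i - A)) (fun i => csq (xpt h w N i) * a N i + (- A) * csq (xpt h w N i)))
      by (intros; ring).
    rewrite sum_lt_plus, sum_lt_scal. fold (t w N).
    replace (t2 w N) with (6 * sum_lt (fun i => csq (xpt h w N i) ^ 2) (2 * N + 1) + 4 * t w N).
    2:{ unfold t2, t. rewrite <- !sum_lt_scal, <- sum_lt_plus. reflexivity. }
    field. }
  set (p := fun l => csq ((INR l + 1) * h)). set (q := fun l => csq ((INR l + 1) * h) * coth ((INR l + 1) * h)).
  assert (Hpd : forall l, 0 < p l <= csq h * r ^ l).
  { intros l. unfold p. pose proof (pos_INR l). split; [apply csq_bounds; nra|].
    replace ((INR l + 1) * h) with (h + INR l * h) by ring. apply csq_decay; lra. }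
  assert (Hch : 0 < csq h) by (apply csq_bounds, Hh).
  assert (Hqd : forall l, Rabs (q l) <= (1 + csq h) * csq h * r ^ l).
  { intros l. unfold q. pose proof (pos_INR l). specialize (Hpd l). unfold p in Hpd.
    set (x := (INR l + 1) * h) in *. assert (Hx : 0 < x) by (unfold x; nra).
    pose proof (coth_bounds x Hx). assert (csq x <= csq h) by (apply csq_decreasing; unfold x; nra).
    rewrite Rabs_pos_eq by nra.
    replace ((1 + csq h) * csq h * r ^ l) with (csq h * r ^ l * (1 + csq h)) by ring.
    apply Rmult_le_compat; lra. }
  assert (Hap : forall N i, (i < 2 * N + 1)%nat -> a N i = sum_lt p i + sum_lt p (2 * N - i)
      /\ b N i = - sum_lt q i + sum_lt q (2 * N - i)).
  { intros N i Hi. unfold a, b. replace (2 * N + 1)%nat with (i + 1 + (2 * N - i))%nat by lia.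
    rewrite (sum_lt_around (fun x => csq (x * h)) i), (sum_lt_around (fun x => csq (x * h) * coth (x * h)) i).
    replace (i + 1 + (2 * N - i) - i)%nat with (2 * N - i + 1)%nat by lia.
    rewrite Rmult_0_l, csq_0. split.
    - rewrite (sum_lt_ext (fun l => csq (- (INR l + 1) * h)) p).
      2:{ intros l _. unfold p. rewrite <- csq_opp. f_equal. ring. }
      fold p. ring.
    - rewrite (sum_lt_ext (fun l => csq (- (INR l + 1) * h) * coth (- (INR l + 1) * h)) (fun l => (-1) * q l)).
      2:{ intros l _. unfold q. replace (- (INR l + 1) * h) with (- ((INR l + 1) * h)) by ring.
          rewrite csq_opp, coth_opp. ring. }
      rewrite sum_lt_scal. fold q. ring. }
  assert (HA : A = 2 * Series p).
  { unfold A, csum. rewrite <- Series_scal_l. apply Series_ext. intros l. unfold p. ring. }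
  set (K := (1 + csq h) * csq h / (1 - r)).
  assert (HK1 : csq h / (1 - r) <= K).
  { unfold K, Rdiv. apply Rmult_le_compat_r; [apply Rlt_le, Rinv_0_lt_compat; lra|nra]. }
  assert (HK : 0 < K) by (eapply Rlt_le_trans; [|exact HK1]; apply Rdiv_lt_0_compat; lra).
  assert (Hab : forall N i, (i < 2 * N + 1)%nat -> Rabs (a N i - A) <= K * (r ^ i + r ^ (2 * N - i))
       /\ Rabs (b N i) <= K * (r ^ i + r ^ (2 * N - i))).
  { intros N i Hi. destruct (Hap N i Hi) as [-> ->].
    assert (Hp : forall k, 0 < r ^ k) by (intros k; apply pow_lt; lra).
    assert (P1 : forall n, Rabs (Series p - sum_lt p n) <= K * r ^ n).
    { intros n. eapply Rle_trans; [apply (sum_lt_pos_tail p (csq h) r n Hr)|].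
      - intros k. rewrite Rabs_pos_eq; [apply Hpd|apply Rlt_le, Hpd].
      - apply Rmult_le_compat_r; [apply Rlt_le, Hp|exact HK1]. }
    assert (P2 : forall n, Rabs (Series q - sum_lt q n) <= K * r ^ n)
      by (intros n; apply (sum_lt_pos_tail q _ r n Hr Hqd)).
    pose proof (P1 i) as A1. pose proof (P1 (2 * N - i)%nat) as A2.
    pose proof (P2 i) as B1. pose proof (P2 (2 * N - i)%nat) as B2.
    apply Rabs_le_between in A1, A2, B1, B2.
    split; apply Rabs_le; rewrite ?HA; lra. }
  set (W := fun w => csq w + csq (h - w) / r).
  (* Each of the [2 N + 1] terms of the difference is a truncation error times a combination of
     [csq] values or a difference of [coth] values, hence of order [r^N]. *)
  assert (Hdiff : forall N, Rabs (Q u N - Q v N) <= 12 * K * (W u + W v) * (INR (2 * N + 1) * r ^ N)).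
  { intros N. rewrite !EQ by assumption.
    replace (2 * sum_lt (fun i => csq (xpt h u N i) * (a N i - A)) (2 * N + 1) +
        4 * sum_lt (fun i => coth (xpt h u N i) * b N i) (2 * N + 1) -
        (2 * sum_lt (fun i => csq (xpt h v N i) * (a N i - A)) (2 * N + 1) +
        4 * sum_lt (fun i => coth (xpt h v N i) * b N i) (2 * N + 1)))
      with (sum_lt (fun i => 2 * (csq (xpt h u N i) * (a N i - A)) + (- 2) * (csq (xpt h v N i) * (a N i - A))
         + (4 * (coth (xpt h u N i) * b N i) + (-4) * (coth (xpt h v N i) * b N i))) (2 * N + 1))
      by (rewrite !sum_lt_plus, !sum_lt_scal; ring).
    replace (12 * K * (W u + W v) * (INR (2 * N + 1) * r ^ N)) with (INR (2 * N + 1) * (12 * K * (W u + W v) * r ^ N)) by ring.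
    apply sum_lt_Rabs_le. intros i Hi.
    destruct (Hab N i Hi) as [A1 B1].
    destruct (xpt_csq h u N i Hu Hi) as [U1 U2]. destruct (xpt_csq h v N i Hv Hi) as [V1' V2'].
    fold r in U2, V2'. fold (W u) in U2. fold (W v) in V2'.
    pose proof (xpt_coth_diff h u v N i Hu Hv) as C.
    set (cu := csq (xpt h u N i)) in *. set (cv := csq (xpt h v N i)) in *.
    set (ku := coth (xpt h u N i)) in *. set (kv := coth (xpt h v N i)) in *.
    set (g := r ^ i + r ^ (2 * N - i)) in *.
    replace (2 * (cu * (a N i - A)) + -2 * (cv * (a N i - A)) + (4 * (ku * b N i) + -4 * (kv * b N i)))
      with (2 * ((cu - cv) * (a N i - A)) + 4 * ((ku - kv) * b N i)) by ring.
    assert (Hg : 0 < g) by (unfold g; apply Rplus_lt_0_compat; apply pow_lt; lra).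
    assert (S1 : Rabs ((cu - cv) * (a N i - A)) <= (cu + cv) * (K * g)).
    { rewrite Rabs_mult. apply Rmult_le_compat; try apply Rabs_pos; [apply Rabs_le; lra|exact A1]. }
    assert (S2 : Rabs ((ku - kv) * b N i) <= (cu + cv) * (K * g)).
    { rewrite Rabs_mult. apply Rmult_le_compat; try apply Rabs_pos; assumption. }
    apply Rabs_le_between in S1, S2.
    assert (S3 : (cu + cv) * (K * g) <= K * (2 * (W u + W v) * r ^ N)).
    { replace ((cu + cv) * (K * g)) with (K * (cu * g + cv * g)) by ring. apply Rmult_le_compat_l; lra. }
    apply Rabs_le. lra. }
  assert (L0 : is_lim_seq (fun N => Q u N - Q v N) 0).
  { apply is_lim_seq_abs_0. apply is_lim_seq_le_le with (fun _ => 0) (fun N => 12 * K * (W u + W v) * (INR (2 * N + 1) * r ^ N)).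
    - intros N. split; [apply Rabs_pos|apply Hdiff].
    - apply is_lim_seq_const.
    - replace (Finite 0) with (Rbar_mult (12 * K * (W u + W v)) 0) by (simpl; f_equal; ring).
      apply is_lim_seq_scal_l, linear_decay_lim, Hh. }
  pose proof (is_lim_seq_minus' _ _ _ _ (LQ u Hu) (LQ v Hv)) as L1.
  apply is_lim_seq_unique in L0. apply is_lim_seq_unique in L1. rewrite L0 in L1.
  apply (f_equal real) in L1. cbn [real] in L1. lra.
Qed.

(** * Expansion at the pole in the variable [w = sinh^2 u] *)

Lemma csq_pair (x u : R) : 0 < u < x ->
  csq (x + u) + csq (x - u) =
  2 * csq x * (1 + (csq x + 2) * sinh u ^ 2) / (1 - csq x * sinh u ^ 2) ^ 2.
Proof.
  intros Hu. pose proof (sinh_pos x ltac:(lra)) as Ha. pose proof (sinh_pos u ltac:(lra)) as Hs.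
  pose proof (sinh_lt u x ltac:(lra)) as Hl.
  pose proof (sinh_pos (x + u) ltac:(lra)) as P1. pose proof (sinh_pos (x - u) ltac:(lra)) as P2.
  unfold csq. revert P1 P2. unfold Rminus at 1 2.
  rewrite !sinh_add, sinh_opp, cosh_opp.
  pose proof (cosh2_sinh2 x) as Cx. pose proof (cosh2_sinh2 u) as Cu.
  set (a := sinh x) in *. set (b := cosh x) in *. set (s := sinh u) in *. set (c := cosh u) in *.
  intros P1 P2.
  assert (E : (a * c + b * s) * (a * c + b * - s) = a ^ 2 - s ^ 2).
  { transitivity (a ^ 2 * c ^ 2 - b ^ 2 * s ^ 2); [ring|]. rewrite Cx, Cu. ring. }
  assert (Hd : 0 < a ^ 2 - s ^ 2) by nra.
  transitivity (((a * c + b * - s) ^ 2 + (a * c + b * s) ^ 2) / ((a * c + b * s) * (a * c + b * - s)) ^ 2).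
  - field. lra.
  - rewrite E. replace ((a * c + b * - s) ^ 2 + (a * c + b * s) ^ 2) with (2 * (a ^ 2 * c ^ 2 + b ^ 2 * s ^ 2)) by ring.
    rewrite Cx, Cu. replace (1 - / a ^ 2 * s ^ 2) with ((a ^ 2 - s ^ 2) / a ^ 2) by (field; lra).
    field. lra.
Qed.

(** The factor [2 sinh u cosh u] is the derivative of [sinh^2 u]; the rest is rational in
    [sinh^2 u], because [sinh (x + u) sinh (x - u) = sinh^2 x - sinh^2 u]. *)
Lemma csq1_pair (x u : R) : 0 < u < x ->
  csq1 (x + u) - csq1 (x - u) = 2 * sinh u * cosh u *
  (2 * csq x * (3 * csq x + 2 + (csq x ^ 2 + 2 * csq x) * sinh u ^ 2) / (1 - csq x * sinh u ^ 2) ^ 3).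
Proof.
  intros Hu. pose proof (sinh_pos x ltac:(lra)) as Ha. pose proof (sinh_pos u ltac:(lra)) as Hs.
  pose proof (sinh_lt u x ltac:(lra)) as Hl.
  pose proof (sinh_pos (x + u) ltac:(lra)) as P1. pose proof (sinh_pos (x - u) ltac:(lra)) as P2.
  unfold csq1, coth, csq. revert P1 P2. replace (x - u) with (x + - u) by ring.
  rewrite !sinh_add, !cosh_add, sinh_opp, cosh_opp.
  pose proof (cosh2_sinh2 x) as Cx. pose proof (cosh2_sinh2 u) as Cu.
  set (a := sinh x) in *. set (b := cosh x) in *. set (s := sinh u) in *. set (c := cosh u) in *.
  intros P1 P2.
  assert (E : (a * c + b * s) * (a * c + b * - s) = a ^ 2 - s ^ 2).
  { transitivity (a ^ 2 * c ^ 2 - b ^ 2 * s ^ 2); [ring|]. rewrite Cx, Cu. ring. }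
  assert (Hd : 0 < a ^ 2 - s ^ 2) by nra.
  transitivity (- 2 * ((b * c + a * s) * (a * c + b * - s) ^ 3 - (b * c + a * - s) * (a * c + b * s) ^ 3)
     / ((a * c + b * s) * (a * c + b * - s)) ^ 3).
  - field. lra.
  - rewrite E.
    replace ((b * c + a * s) * (a * c + b * - s) ^ 3 - (b * c + a * - s) * (a * c + b * s) ^ 3)
      with (2 * s * c * (a ^ 2 * (a ^ 2 * c ^ 2 + 3 * (b ^ 2 * s ^ 2)) - b ^ 2 * (3 * (a ^ 2 * c ^ 2) + b ^ 2 * s ^ 2))) by ring.
    rewrite Cx, Cu. replace (1 - / a ^ 2 * s ^ 2) with ((a ^ 2 - s ^ 2) / a ^ 2) by (field; lra).
    field. lra.
Qed.

(** Exact remainders: with [q = csq x], the right-hand side of [csq_pair] is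
    [2 q + (6 q^2 + 4 q) w + w^2 yterm q w], and its derivative in [w] is
    [6 q^2 + 4 q + w zterm q w]. *)
Definition yterm (q w : R) : R :=
  2 * q * (5 * q ^ 2 + 4 * q - (3 * q + 2) * q ^ 2 * w) / (1 - q * w) ^ 2.
Definition zterm (q w : R) : R :=
  2 * q * (10 * q ^ 2 + 8 * q - (3 * q + 2) * (3 * q ^ 2 * w - q ^ 3 * w ^ 2)) / (1 - q * w) ^ 3.

Definition ysum (h w : R) : R := Series (fun n => yterm (csq ((INR n + 1) * h)) w).
Definition zsum (h w : R) : R := Series (fun n => zterm (csq ((INR n + 1) * h)) w).

(** [alpha] and [beta] are the coefficients of [w] and [w^2] in the regular part of [psum]. *)
Definition alpha (h : R) : R := 3 * csum 2 h + 2 * csum 1 h.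
Definition beta (h : R) : R := 5 * csum 3 h + 4 * csum 2 h.

Lemma csq_tail_bounds (n : nat) (h : R) : 0 < h -> 0 < csq ((INR n + 1) * h) <= csq h.
Proof.
  intros Hh. pose proof (pos_INR n). split; [apply csq_bounds; nra|]. apply csq_decreasing. nra.
Qed.

Lemma yzterm_bound (q q0 w d : R) : 0 < q <= q0 -> Rabs w <= 1 -> 0 < d <= 1 -> d <= 1 - q * w ->
  Rabs (yterm q w) <= q * (2 * (8 * q0 ^ 2 + 4 * q0 + 3 * q0 ^ 3) / d ^ 3) /\
  Rabs (zterm q w) <= q * (2 * (16 * q0 ^ 2 + 8 * q0 + 11 * q0 ^ 3 + 3 * q0 ^ 4) / d ^ 3).
Proof.
  intros Hq Hw Hd Hqw. apply Rabs_le_between in Hw.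
  assert (Q2 : 0 < q ^ 2 <= q0 ^ 2) by (split; [apply pow_lt; lra|apply pow_incr; lra]).
  assert (Q3 : 0 < q ^ 3 <= q0 ^ 3) by (split; [apply pow_lt; lra|apply pow_incr; lra]).
  assert (Q4 : 0 < q ^ 4 <= q0 ^ 4) by (split; [apply pow_lt; lra|apply pow_incr; lra]).
  assert (D3 : 0 < d ^ 3) by (apply pow_lt; lra).
  assert (Dw3 : d ^ 3 <= (1 - q * w) ^ 3) by (apply pow_incr; lra).
  assert (Dw2 : d ^ 3 <= (1 - q * w) ^ 2).
  { apply Rle_trans with (d ^ 2); [nra|apply pow_incr; lra]. }
  assert (G : forall num den K, Rabs num <= K -> d ^ 3 <= den -> Rabs (2 * q * num / den) <= q * (2 * K / d ^ 3)).
  { intros num den K H1 H2. unfold Rdiv. rewrite !Rabs_mult, (Rabs_pos_eq 2), (Rabs_pos_eq q) by lra.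
    rewrite Rabs_inv, (Rabs_pos_eq den) by lra.
    replace (q * (2 * K * / d ^ 3)) with (2 * q * K * / d ^ 3) by ring.
    pose proof (Rabs_pos num).
    apply Rmult_le_compat; [nra|apply Rlt_le, Rinv_0_lt_compat; lra|nra|apply Rinv_le_contravar; lra]. }
  assert (w2 : 0 <= w ^ 2 <= 1) by nra.
  assert (psum2 : Rabs (q ^ 2 * w) <= q0 ^ 2) by (apply Rabs_le; nra).
  assert (T3 : Rabs (q ^ 3 * w) <= q0 ^ 3) by (apply Rabs_le; nra).
  assert (T3' : 0 <= q ^ 3 * w ^ 2 <= q0 ^ 3) by nra.
  assert (T4 : 0 <= q ^ 4 * w ^ 2 <= q0 ^ 4) by nra.
  apply Rabs_le_between in psum2, T3.
  split; apply G; try assumption.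
  - replace ((3 * q + 2) * q ^ 2 * w) with (3 * (q ^ 3 * w) + 2 * (q ^ 2 * w)) by ring.
    apply Rabs_le. nra.
  - replace ((3 * q + 2) * (3 * q ^ 2 * w - q ^ 3 * w ^ 2)) with
      (9 * (q ^ 3 * w) + 6 * (q ^ 2 * w) - 3 * (q ^ 4 * w ^ 2) - 2 * (q ^ 3 * w ^ 2)) by ring.
    apply Rabs_le. nra.
Qed.

Lemma ex_series_csq_scal (h K : R) : 0 < h -> ex_series (fun n => csq ((INR n + 1) * h) * K).
Proof.
  intros Hh. apply (ex_series_scal_r K).
  apply ex_series_dominated with (fun i => 2 * csq ((INR i + 1) * h) ^ 1); [|apply ex_series_csum; [exact Hh|lia]].
  intros n. pose proof (csq_tail_bounds n h Hh). rewrite Rabs_pos_eq; simpl; lra.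
Qed.

Lemma ex_series_yz (h w d : R) : 0 < h -> Rabs w <= 1 -> 0 < d <= 1 -> (forall q, 0 < q <= csq h -> d <= 1 - q * w) ->
  ex_series (fun n => yterm (csq ((INR n + 1) * h)) w) /\ ex_series (fun n => zterm (csq ((INR n + 1) * h)) w).
Proof.
  intros Hh Hw Hd Hq.
  split; (eapply ex_series_dominated; [intros n; pose proof (csq_tail_bounds n h Hh) as B;
    apply (yzterm_bound _ (csq h) w d B Hw Hd (Hq _ B))|apply ex_series_csq_scal, Hh]).
Qed.

Lemma continuous_yz (h : R) : 0 < h -> continuous (ysum h) 0 /\ continuous (zsum h) 0.
Proof.
  intros Hh. assert (Hc : 0 < csq h) by (apply csq_bounds, Hh).
  assert (HL : locally 0 (fun w => Rabs w <= 1 /\ forall q, 0 < q <= csq h -> /2 <= 1 - q * w)).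
  (* This radius keeps [q w] below 1/2 for every [q <= csq h], so the denominators stay away from
     0. *)
  { assert (He : 0 < Rmin 1 (/ (2 * csq h))) by (apply Rmin_glb_lt; [lra|apply Rinv_0_lt_compat; lra]).
    exists (mkposreal _ He). intros w Hw. change (Rabs (w - 0) < Rmin 1 (/ (2 * csq h))) in Hw.
    rewrite Rminus_0_r in Hw. pose proof (Rmin_l 1 (/ (2 * csq h))). pose proof (Rmin_r 1 (/ (2 * csq h))).
    split; [lra|]. intros q Hq.
    assert (w < / (2 * csq h)) by (apply Rabs_def2 in Hw; lra).
    assert (csq h * / (2 * csq h) = / 2) by (field; lra).
    destruct (Rle_dec w 0); nra. }
  split.
  - apply continuous_Series with (M := fun n => csq ((INR n + 1) * h) * (2 * (8 * csq h ^ 2 + 4 * csq h + 3 * csq h ^ 3) / (/ 2) ^ 3)); [|apply ex_series_csq_scal, Hh|].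
    + generalize HL. apply filter_imp. intros w [H1 H2] n. pose proof (csq_tail_bounds n h Hh) as B.
      apply (yzterm_bound _ (csq h) w (/ 2) B H1 ltac:(lra) (H2 _ B)).
    + intros n. apply (ex_derive_continuous (fun w => yterm (csq ((INR n + 1) * h)) w)). unfold yterm. auto_derive. nra.
  - apply continuous_Series with (M := fun n => csq ((INR n + 1) * h) * (2 * (16 * csq h ^ 2 + 8 * csq h + 11 * csq h ^ 3 + 3 * csq h ^ 4) / (/ 2) ^ 3)); [|apply ex_series_csq_scal, Hh|].
    + generalize HL. apply filter_imp. intros w [H1 H2] n. pose proof (csq_tail_bounds n h Hh) as B.
      apply (yzterm_bound _ (csq h) w (/ 2) B H1 ltac:(lra) (H2 _ B)).
    + intros n. apply (ex_derive_continuous (fun w => zterm (csq ((INR n + 1) * h)) w)). unfold zterm. auto_derive. nra.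
Qed.

Lemma yz_0 (h : R) : 0 < h -> ysum h 0 = beta h /\ zsum h 0 = 2 * beta h.
Proof.
  intros Hh. pose proof (ex_series_csum 2 h Hh ltac:(lia)) as X2. pose proof (ex_series_csum 3 h Hh ltac:(lia)) as X3.
  assert (Y : ysum h 0 = beta h).
  { unfold beta, csum. rewrite <- !Series_scal_l, <- Series_plus;
      try (apply ex_series_Rscal; assumption).
    apply Series_ext. intros n. unfold yterm. field. }
  split; [exact Y|]. rewrite <- Y. unfold ysum, zsum. rewrite <- Series_scal_l. apply Series_ext.
  intros n. unfold yterm, zterm. field.
Qed.

Lemma Series_plus3 (a b c : nat -> R) : ex_series a -> ex_series b -> ex_series c ->
  Series (fun n => a n + b n + c n) = Series a + Series b + Series c.
Proof.
  intros A B C. rewrite Series_plus, Series_plus; try assumption; [reflexivity|].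
  apply ex_series_Rplus; assumption.
Qed.

Lemma csq_sinh_lt_1 (h u : R) : 0 < u < h ->
  0 < 1 - csq h * sinh u ^ 2 <= 1 /\ forall q, 0 < q <= csq h -> 1 - csq h * sinh u ^ 2 <= 1 - q * sinh u ^ 2.
Proof.
  intros Hu. pose proof (sinh_pos u ltac:(lra)). pose proof (sinh_lt u h ltac:(lra)).
  assert (0 < sinh u ^ 2 < sinh h ^ 2) by nra.
  pose proof (csq_bounds h ltac:(lra)) as [C _].
  assert (csq h * sinh h ^ 2 = 1) by (unfold csq; field; lra).
  repeat split; try nra. intros q Hq. nra.
Qed.

(** The first term of [rsum h u] is the pole [1 / w]. Each later one, at [(n + 1) h + u], is paired
    with the term of [rsum h (h - u)] at [(n + 1) h - u]. *)
Lemma psum_expansion (h u : R) : 0 < u < h -> sinh u <= 1 ->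
  psum h u = / sinh u ^ 2 + csum 1 h + alpha h * sinh u ^ 2 + (sinh u ^ 2) ^ 2 * ysum h (sinh u ^ 2) /\
  psum1 h u = 2 * sinh u * cosh u * (- / (sinh u ^ 2) ^ 2 + alpha h + sinh u ^ 2 * zsum h (sinh u ^ 2)).
Proof.
  intros Hu Hs1. assert (Hh : 0 < h) by lra. pose proof (sinh_pos u ltac:(lra)) as Hs.
  set (w := sinh u ^ 2).
  assert (Hw : 0 < w <= 1) by (unfold w; nra).
  destruct (csq_sinh_lt_1 h u Hu) as [Hd1 Hd2]. fold w in Hd1, Hd2.
  set (q := fun n => csq ((INR n + 1) * h)).
  assert (Hq : forall n, 0 < q n <= csq h) by (intros n; apply csq_tail_bounds, Hh).
  destruct (ex_series_yz h w (1 - csq h * w) Hh ltac:(rewrite Rabs_pos_eq; lra) Hd1 Hd2) as [Xy Xz].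
  pose proof (ex_series_csum 1 h Hh ltac:(lia)) as X1. pose proof (ex_series_csum 2 h Hh ltac:(lia)) as X2.
  destruct (ex_series_rsum h u Hh ltac:(lra)) as (VU & VU1 & _).
  destruct (ex_series_rsum h (h - u) Hh ltac:(lra)) as (VH & VH1 & _).
  assert (Xa : ex_series (fun n => 3 * (2 * q n ^ 2) + 2 * (2 * q n ^ 1))).
  { apply (ex_series_Rplus (fun n => 3 * (2 * q n ^ 2)) (fun n => 2 * (2 * q n ^ 1)));
      apply ex_series_Rscal; assumption. }
  assert (Ea : Series (fun n => 3 * (2 * q n ^ 2) + 2 * (2 * q n ^ 1)) = alpha h).
  { rewrite Series_plus by (apply ex_series_Rscal; assumption).
    rewrite (Series_scal_l 3), (Series_scal_l 2 (fun n => 2 * q n ^ 1)). reflexivity. }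
  assert (Hx : forall n, 0 < u < (INR n + 1) * h) by (intros n; pose proof (pos_INR n); nra).
  assert (Hden : forall n, 0 < 1 - q n * w) by (intros n; specialize (Hd2 _ (Hq n)); lra).
  assert (XS : ex_series (fun n => csq (u + INR (S n) * h)))
    by (apply ex_series_incr_1 in VU; exact VU).
  assert (XS1 : ex_series (fun n => csq1 (u + INR (S n) * h)))
    by (apply ex_series_incr_1 in VU1; exact VU1).
  split.
  - unfold psum, rsum. rewrite (Series_incr_1 _ VU).
    replace (csq (u + INR 0 * h)) with (/ w) by (simpl INR; rewrite Rmult_0_l, Rplus_0_r; reflexivity).
    rewrite !Rplus_assoc. f_equal. rewrite <- Series_plus by assumption.
    rewrite (Series_ext _ (fun n => 2 * q n ^ 1 + w * (3 * (2 * q n ^ 2) + 2 * (2 * q n ^ 1)) + w ^ 2 * yterm (q n) w)).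
    + rewrite Series_plus3; try assumption; try (apply ex_series_Rscal; assumption).
      rewrite (Series_scal_l w), (Series_scal_l (w ^ 2)), Ea.
      change (Series (fun n => yterm (q n) w)) with (ysum h w).
      change (Series (fun n => 2 * q n ^ 1)) with (csum 1 h). ring.
    + intros n. rewrite S_INR.
      replace (u + (INR n + 1) * h) with ((INR n + 1) * h + u) by ring.
      replace (h - u + INR n * h) with ((INR n + 1) * h - u) by ring.
      rewrite csq_pair by apply Hx. fold w. fold (q n). unfold yterm. specialize (Hden n). field. lra.
  - unfold psum1, rsum1. rewrite (Series_incr_1 _ VU1).
    replace (csq1 (u + INR 0 * h)) with (2 * sinh u * cosh u * - / w ^ 2).
    2:{ simpl INR. rewrite Rmult_0_l, Rplus_0_r. unfold csq1, coth, csq, w. field. lra. }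
    transitivity (2 * sinh u * cosh u * - / w ^ 2 + (Series (fun n => csq1 (u + INR (S n) * h)) - Series (fun n => csq1 (h - u + INR n * h)))); [ring|].
    rewrite <- Series_minus by assumption.
    rewrite (Series_ext _ (fun n => (2 * sinh u * cosh u) * ((3 * (2 * q n ^ 2) + 2 * (2 * q n ^ 1)) + w * zterm (q n) w))).
    + rewrite Series_scal_l, Series_plus, Ea, Series_scal_l; try assumption.
      * change (Series (fun n => zterm (q n) w)) with (zsum h w). ring.
      * apply ex_series_Rscal; assumption.
    + intros n. rewrite S_INR.
      replace (u + (INR n + 1) * h) with ((INR n + 1) * h + u) by ring.
      replace (h - u + INR n * h) with ((INR n + 1) * h - u) by ring.
      rewrite csq1_pair by apply Hx. fold w. fold (q n). f_equal. unfold zterm. specialize (Hden n). field. lra.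
Qed.

(** At 0, [1 / sinh^2 u] is [1 / u^2 - 1/3 + ...] and the other poles contribute [csum 1 h]; the
    added constant removes the constant term, and with it the square term of the cubic. *)
Definition wp (h u : R) : R := psum h u + 1 / 3 - csum 1 h.

(** [psum_defect_const] amounts to [wp'' = 6 wp^2 - 6 (c^2 + K)]; multiplied by [2 wp'], this says
    that [G] has zero derivative. *)
Lemma wp_first_integral (h : R) : 0 < h -> exists g2 g3,
  forall u, 0 < u < h -> psum1 h u ^ 2 = 4 * wp h u ^ 3 - g2 * wp h u - g3.
Proof.
  intros Hh. set (A := csum 1 h). set (K := psum_defect h (h / 2)). set (c := 1 / 3 - A).
  set (G := fun u => psum1 h u ^ 2 - 4 * wp h u ^ 3 + 12 * (c ^ 2 + K) * wp h u).
  assert (HG : forall u, 0 < u < h -> is_derive G u 0).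
  { intros u Hu. pose proof (is_derive_psum h u Hu) as D1. pose proof (is_derive_psum1 h u Hu) as D2.
    unfold G, wp. fold A. auto_derive; [solve_ex_derive|].
    rewrite_Derive D1. rewrite_Derive D2.
    pose proof (psum_defect_const h u (h / 2) Hu ltac:(lra)) as E. fold K in E. unfold psum_defect in E. fold A in E.
    replace (psum2 h u) with (6 * (psum h u ^ 2 + 4 * psum h u / 6 - 2 * A * psum h u - K)) by lra.
    unfold c. field. }
  exists (12 * (c ^ 2 + K)), (- G (h / 2)). intros u Hu.
  rewrite <- (derive_0_constant G 0 h HG u (h / 2)) by lra. unfold G. ring.
Qed.

Ltac lim_arith := lazymatch goal with
  | |- is_lim_seq (fun _ => ?c) _ => apply is_lim_seq_const
  | |- is_lim_seq (fun n => @?f n - @?g n) _ => apply (is_lim_seq_minus' f g); lim_arith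
  | |- is_lim_seq (fun n => @?f n + @?g n) _ => apply (is_lim_seq_plus' f g); lim_arith
  | |- is_lim_seq (fun n => @?f n * @?g n) _ => apply (is_lim_seq_mult' f g); lim_arith
  | |- _ => eassumption
  end.

(** After [psum_expansion] is inserted, the higher poles cancel and [(4/3 + 20 alpha - g2) / w + W]
    remains, with [W] convergent as [w] tends to 0. The pole determines [g2], then the limit of [W]
    determines [g3]. *)
Lemma wp_invariants (h g2 g3 : R) : 0 < h ->
  (forall u, 0 < u < h -> psum1 h u ^ 2 = 4 * wp h u ^ 3 - g2 * wp h u - g3) ->
  g2 = 60 * E4 h /\ g3 = 140 * E6 h.
Proof.
  intros Hh H. set (al := alpha h). set (be := beta h).
  set (m := Rmin (1 / 2) (h / 2)).
  assert (Hm : 0 < m <= 1 / 2 /\ m < h).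
  { unfold m. pose proof (Rmin_l (1/2) (h/2)). pose proof (Rmin_r (1/2) (h/2)).
    repeat split; try lra. apply Rmin_glb_lt; lra. }
  set (u := fun n => m * / (INR n + 1)).
  assert (Hu : forall n, 0 < u n <= m).
  { intros n. unfold u. pose proof (pos_INR n).
    assert (0 < / (INR n + 1)) by (apply Rinv_0_lt_compat; lra).
    assert (/ (INR n + 1) <= / 1) by (apply Rinv_le_contravar; lra). rewrite Rinv_1 in *. nra. }
  set (w := fun n => sinh (u n) ^ 2). set (y := fun n => ysum h (w n)). set (z := fun n => zsum h (w n)).
  assert (Lu : is_lim_seq u 0).
  { replace (Finite 0) with (Rbar_mult m 0) by (simpl; f_equal; ring). apply is_lim_seq_scal_l.
    apply (is_lim_seq_inv (fun n => INR n + 1) p_infty); [|discriminate].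
    apply (is_lim_seq_plus _ _ p_infty 1 p_infty); [apply is_lim_seq_INR|apply is_lim_seq_const|reflexivity]. }
  assert (Lw : is_lim_seq w 0).
  { replace 0 with (sinh 0 ^ 2) by (rewrite sinh_0; ring).
    apply (is_lim_seq_continuous (fun x => sinh x ^ 2) u 0); [|exact Lu].
    apply continuity_pt_filterlim, (ex_derive_continuous (fun x => sinh x ^ 2)). auto_derive. exact I. }
  destruct (continuous_yz h Hh) as [Cy Cz]. destruct (yz_0 h Hh) as [Y0 Z0].
  assert (Ly : is_lim_seq y be).
  { unfold be. rewrite <- Y0. apply (is_lim_seq_continuous (ysum h) w 0); [apply continuity_pt_filterlim, Cy|exact Lw]. }
  assert (Lz : is_lim_seq z (2 * be)).
  { unfold be. rewrite <- Z0. apply (is_lim_seq_continuous (zsum h) w 0); [apply continuity_pt_filterlim, Cz|exact Lw]. }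
  assert (Hw : forall n, 0 < w n).
  { intros n. apply pow_lt, sinh_pos, Hu. }
  set (W := fun n => let e := 1/3 + (al * w n + w n * w n * y n) in let eta := al + w n * z n in
     12 * y n + 8 * (al + w n * y n) + 12 * (w n * ((al + w n * y n) * (al + w n * y n)))
       + 4 * (e * (e * e)) - g2 * e - g3 + 8 * z n + 8 * eta - 4 * (w n * (eta * eta)) - 4 * (w n * w n * (eta * eta))).
  assert (EW : forall n, (4/3 + 20 * al - g2) / w n + W n = 0).
  { intros n. pose proof (Hu n) as Hun.
    assert (Hs : sinh (u n) <= 1).
    { pose proof (sinh_le_linear (u n) ltac:(lra)). lra. }
    destruct (psum_expansion h (u n) ltac:(lra) Hs) as [E0 E1]. fold (w n) in E0, E1. fold (y n) in E0. fold (z n) in E1.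
    fold al in E0, E1.
    pose proof (H (u n) ltac:(lra)) as E. unfold wp in E. rewrite E0, E1 in E.
    rewrite !Rpow_mult_distr, cosh2_sinh2 in E. fold (w n) in E.
    pose proof (Hw n). unfold W.
    symmetry in E. apply Rminus_diag_eq in E. rewrite <- E. cbv zeta. field. lra. }
  assert (LW : is_lim_seq W (let e := 1/3 + (al * 0 + 0 * 0 * be) in let eta := al + 0 * (2 * be) in
     12 * be + 8 * (al + 0 * be) + 12 * (0 * ((al + 0 * be) * (al + 0 * be)))
       + 4 * (e * (e * e)) - g2 * e - g3 + 8 * (2 * be) + 8 * eta - 4 * (0 * (eta * eta)) - 4 * (0 * 0 * (eta * eta)))).
  { unfold W. cbv zeta. lim_arith. }
  cbv zeta in LW.
  match type of LW with is_lim_seq _ (Finite ?l) => set (LL := l) in LW end.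
  assert (G2 : 4/3 + 20 * al - g2 = 0).
  { assert (L : is_lim_seq (fun n => - (w n * W n)) (- (0 * LL))).
    { apply (is_lim_seq_opp (fun n => w n * W n) (0 * LL)). lim_arith. }
    apply is_lim_seq_ext with (v := fun _ => 4/3 + 20 * al - g2) in L.
    - apply is_lim_seq_unique in L. rewrite Lim_seq_const in L. apply (f_equal real) in L. cbn [real] in L. lra.
    - intros n. pose proof (Hw n). specialize (EW n).
      replace (W n) with (- ((4/3 + 20 * al - g2) / w n)) by lra. field. lra. }
  assert (G3 : LL = 0).
  { apply is_lim_seq_ext with (v := fun _ => 0) in LW.
    - apply is_lim_seq_unique in LW. rewrite Lim_seq_const in LW. apply (f_equal real) in LW. cbn [real] in LW. lra.
    - intros n. specialize (EW n). rewrite G2 in EW. unfold Rdiv in EW. lra. }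
  unfold LL in G3. unfold al, be, alpha, beta in *. unfold E4, E6.
  split; [lra|].
  replace g2 with (4 / 3 + 20 * (3 * csum 2 h + 2 * csum 1 h)) in G3 by lra.
  nra.
Qed.

Lemma rsum_ge_csq (h u : R) : 0 < h -> 0 < u -> csq u <= rsum h u.
Proof.
  intros Hh Hu. destruct (ex_series_rsum h u Hh Hu) as (X & _).
  unfold rsum. rewrite Series_incr_1 by exact X. simpl INR at 1. rewrite Rmult_0_l, Rplus_0_r.
  assert (0 <= Series (fun n => csq (u + INR (S n) * h))); [|lra].
  rewrite <- (Series_zero (fun _ => 0)) by reflexivity. apply Series_le.
  - intros n. split; [lra|]. apply Rlt_le, csq_bounds. pose proof (pos_INR (S n)). nra.
  - apply ex_series_incr_1 in X. exact X.
Qed.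

Lemma lattice_arc (h : R) : 0 < h -> wp_arc (60 * E4 h) (140 * E6 h) (h / 2) (wp h) (psum1 h).
Proof.
  intros Hh. destruct (wp_first_integral h Hh) as [g2 [g3 H]].
  destruct (wp_invariants h g2 g3 Hh H) as [-> ->].
  constructor.
  - lra.
  - intros u Hu. pose proof (is_derive_psum h u ltac:(lra)) as D. unfold wp.
    auto_derive; [solve_ex_derive|]. rewrite_Derive D. ring.
  - intros u Hu. apply psum1_neg; lra.
  - intros u Hu. apply H. lra.
  - intros K. set (M := Rmax 1 (K + csum 1 h)).
    assert (HM : 1 <= M /\ K + csum 1 h <= M) by (split; [apply Rmax_l|apply Rmax_r]).
    exists (/ (2 * M)). assert (0 < / (2 * M)) by (apply Rinv_0_lt_compat; lra).
    split; [assumption|]. intros u Hu1 Hu2.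
    assert (Hu3 : u * (2 * M) < 1).
    { apply Rmult_lt_reg_r with (/ (2 * M)); [assumption|]. rewrite Rmult_assoc, Rinv_r by lra. lra. }
    pose proof (rsum_ge_csq h u Hh ltac:(lra)) as V1'. pose proof (rsum_ge_csq h (h - u) Hh ltac:(lra)) as V2'.
    pose proof (csq_bounds (h - u) ltac:(lra)) as [C1 _].
    assert (C2 : M <= csq u).
    { unfold csq. pose proof (sinh_le_linear u ltac:(nra)) as [S1 S2].
      rewrite <- (Rinv_inv M). apply Rinv_le_contravar; [apply pow_lt, sinh_pos; lra|].
      apply Rmult_le_reg_r with M; [lra|]. rewrite Rinv_l by lra.
      assert (sinh u ^ 2 <= (2 * u) ^ 2) by (apply pow_incr; split; [apply Rlt_le, sinh_pos; lra|lra]).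
      assert ((2 * u) ^ 2 * M <= 1) by nra. nra. }
    unfold wp, psum. lra.
  - intros eps He.
    assert (Ct : continuous (psum1 h) (h / 2)).
    { apply (ex_derive_continuous (psum1 h)). eexists. apply is_derive_psum1. lra. }
    destruct (continuous_eps (psum1 h) (h / 2) eps Ct He) as [d [Hd C]].
    exists d. split; [exact Hd|]. intros u Hu1 Hu2.
    specialize (C u ltac:(apply Rabs_def1; lra)).
    assert (E : psum1 h (h / 2) = 0) by (unfold psum1; replace (h - h / 2) with (h / 2) by field; ring).
    rewrite E in C. apply Rabs_def2 in C. lra.
Qed.

(** * Inversion *)

Lemma continuous_csum (j : nat) (h : R) : 0 < h -> (1 <= j)%nat -> continuous (csum j) h.
Proof.
  intros Hh Hj.
  apply continuous_Series with (M := fun i => 2 / (h / 2) ^ (2 * j) * / (INR i + 1) ^ 2).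
  - generalize (locally_half h Hh). apply filter_imp. intros t Ht i.
    pose proof (csum_term_bound j i t ltac:(lra) Hj) as [B1 B2]. rewrite Rabs_pos_eq by exact B1.
    eapply Rle_trans; [exact B2|]. pose proof (pos_INR i).
    apply Rmult_le_compat_r; [apply Rlt_le, Rinv_0_lt_compat, pow_lt; lra|].
    apply Rmult_le_compat_l; [lra|]. apply Rinv_le_contravar; [apply pow_lt; lra|]. apply pow_incr; lra.
  - apply ex_series_Rscal, ex_series_inv_sqr.
  - intros i. pose proof (pos_INR i). assert (Hi : 0 < (INR i + 1) * h) by nra.
    pose proof (is_derive_csq _ Hi) as D.
    apply (ex_derive_continuous (fun h => 2 * csq ((INR i + 1) * h) ^ j)).
    auto_derive. solve_ex_derive.
Qed.

Lemma csum_nonneg (j : nat) (h : R) : 0 < h -> (1 <= j)%nat -> 0 <= csum j h.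
Proof.
  intros Hh Hj. unfold csum. rewrite <- (Series_zero (fun _ => 0)) by reflexivity.
  apply Series_le; [|apply ex_series_csum; assumption].
  intros n. split; [lra|]. apply csum_term_bound; assumption.
Qed.

Lemma E4_pos (h : R) : 0 < h -> 0 < E4 h.
Proof.
  intros Hh. unfold E4. pose proof (csum_nonneg 1 h Hh ltac:(lia)). pose proof (csum_nonneg 2 h Hh ltac:(lia)). lra.
Qed.

Lemma csum_lim (j : nat) : (1 <= j)%nat -> is_lim_seq (fun n => csum j (INR n + 1)) 0.
Proof.
  intros Hj. set (Z := Series (fun i => / (INR i + 1) ^ 2)).
  apply is_lim_seq_le_le with (fun _ => 0) (fun n => 2 * Z * / (INR n + 1)).
  - intros n. pose proof (pos_INR n) as Hn. split; [apply csum_nonneg; lra || lia|].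
    unfold csum. eapply Rle_trans.
    + apply Series_le; [intros i; apply csum_term_bound; [lra|exact Hj]|].
      apply ex_series_Rscal, ex_series_inv_sqr.
    + rewrite Series_scal_l. fold Z.
      assert (HZ : 0 <= Z).
      { unfold Z. rewrite <- (Series_zero (fun _ => 0)) by reflexivity. apply Series_le; [|apply ex_series_inv_sqr].
        intros i. split; [lra|]. apply Rlt_le, Rinv_0_lt_compat, pow_lt. pose proof (pos_INR i). lra. }
      replace (2 * Z * / (INR n + 1)) with (2 / (INR n + 1) ^ 1 * Z) by (simpl; field; lra).
      apply Rmult_le_compat_r; [exact HZ|]. apply Rmult_le_compat_l; [lra|].
      apply Rinv_le_contravar; [apply pow_lt; lra|]. apply Rle_pow; lra || lia.
  - apply is_lim_seq_const.
  - replace (Finite 0) with (Rbar_mult (2 * Z) 0) by (simpl; f_equal; ring).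
    apply is_lim_seq_scal_l. apply (is_lim_seq_inv (fun n => INR n + 1) p_infty); [|discriminate].
    apply (is_lim_seq_plus _ _ p_infty 1 p_infty); [apply is_lim_seq_INR|apply is_lim_seq_const|reflexivity].
Qed.

(* Vanishes exactly when the invariants of the lattice generated by [h] and [i PI]
   are those of a rescaling of the curve with invariants [g2], [g3]. *)
Definition mismatch (g2 g3 h : R) : R :=
  140 * E6 h * (g2 * sqrt g2) - g3 * (60 * E4 h * sqrt (60 * E4 h)).

(** For large [h] the lattice degenerates: [60 E4] and [140 E6] tend to 4/3 and -8/27, a pair of
    zero discriminant. The limit of [mismatch] is [- 8/27 g2^(3/2) - (4/3)^(3/2) g3], negative
    because [27 g3^2 < g2^3]. *)
Lemma mismatch_neg (g2 g3 : R) : 0 < g2 -> 27 * g3 ^ 2 < g2 ^ 3 ->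
  exists h, 0 < h /\ mismatch g2 g3 h < 0.
Proof.
  intros H2 H3.
  pose proof (csum_lim 1 ltac:(lia)) as L1. pose proof (csum_lim 2 ltac:(lia)) as L2.
  pose proof (csum_lim 3 ltac:(lia)) as L3.
  assert (LE4 : is_lim_seq (fun n => E4 (INR n + 1)) (1 / 45 + 0 + 2 / 3 * 0)) by (unfold E4; lim_arith).
  assert (LE6 : is_lim_seq (fun n => E6 (INR n + 1)) (- 2 / 945 + 0 + 0 + 2 / 15 * 0)) by (unfold E6; lim_arith).
  assert (LS : is_lim_seq (fun n => sqrt (60 * E4 (INR n + 1))) (sqrt (60 * (1 / 45 + 0 + 2 / 3 * 0)))).
  { apply (is_lim_seq_continuous sqrt); [|lim_arith]. apply continuity_pt_sqrt. lra. }
  set (s0 := sqrt (60 * (1 / 45 + 0 + 2 / 3 * 0))) in *. set (e4 := 1 / 45 + 0 + 2 / 3 * 0) in *.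
  set (e6 := - 2 / 945 + 0 + 0 + 2 / 15 * 0) in *.
  assert (L : is_lim_seq (fun n => mismatch g2 g3 (INR n + 1)) (140 * e6 * (g2 * sqrt g2) - g3 * (60 * e4 * s0)))
    by (unfold mismatch; lim_arith).
  assert (Hs0 : 0 < s0 /\ s0 * s0 = 4 / 3).
  { unfold s0, e4. split; [apply sqrt_lt_R0; lra|]. rewrite sqrt_sqrt; lra. }
  assert (HP : 0 < sqrt g2 /\ sqrt g2 * sqrt g2 = g2) by (split; [apply sqrt_lt_R0, H2|apply sqrt_sqrt; lra]).
  set (P := g2 * sqrt g2) in *. assert (HP0 : 0 < P) by (unfold P; nra).
  assert (HPP : P ^ 2 = g2 ^ 3) by (unfold P; transitivity (g2 ^ 2 * (sqrt g2 * sqrt g2)); [ring|rewrite (proj2 HP); ring]).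
  assert (N : 140 * e6 * P - g3 * (60 * e4 * s0) < 0).
  { replace (140 * e6) with (- (8 / 27)) by (unfold e6; field). replace (60 * e4) with (4 / 3) by (unfold e4; field).
    destruct (Rle_lt_dec 0 g3) as [Hg|Hg]; [nra|].
    assert ((- g3 * (4 / 3 * s0)) ^ 2 < (8 / 27 * P) ^ 2).
    { replace ((- g3 * (4 / 3 * s0)) ^ 2) with (g3 ^ 2 * (16 / 9) * (s0 * s0)) by field.
      rewrite (proj2 Hs0), Rpow_mult_distr, HPP. lra. }
    assert (0 < - g3 * (4 / 3 * s0)) by (apply Rmult_lt_0_compat; lra).
    assert (- g3 * (4 / 3 * s0) < 8 / 27 * P) by nra. lra. }
  apply is_lim_seq_spec in L.
  destruct (L (mkposreal (- (140 * e6 * P - g3 * (60 * e4 * s0))) ltac:(lra))) as [n Hn].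
  specialize (Hn n (Nat.le_refl n)). simpl in Hn. apply Rabs_def2 in Hn.
  exists (INR n + 1). pose proof (pos_INR n). split; lra.
Qed.

(** Turns negativity for [- g3] at [h] into positivity for [g3] at [PI^2 / h], which stands in for a
    study of [h] near 0. *)
Lemma mismatch_reciprocal (g2 g3 h : R) : 0 < h ->
  mismatch g2 g3 (PI ^ 2 / h) = - ((h / PI) ^ 6 * mismatch g2 (- g3) h).
Proof.
  intros Hh. pose proof PI_RGT_0 as Hpi. unfold mismatch. rewrite E4_reciprocal, E6_reciprocal by exact Hh.
  set (r := h / PI). assert (Hr : 0 < r) by (apply Rdiv_lt_0_compat; lra).
  pose proof (E4_pos h Hh).
  replace (60 * (r ^ 4 * E4 h)) with ((r ^ 2) ^ 2 * (60 * E4 h)) by ring.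
  rewrite sqrt_mult by nra. rewrite sqrt_pow2 by nra. ring.
Qed.

Lemma continuous_mismatch (g2 g3 h : R) : 0 < h -> continuous (mismatch g2 g3) h.
Proof.
  intros Hh.
  pose proof (continuous_csum 1 h Hh ltac:(lia)) as C1. pose proof (continuous_csum 2 h Hh ltac:(lia)) as C2.
  pose proof (continuous_csum 3 h Hh ltac:(lia)) as C3.
  assert (K : forall (c : R), continuous (fun _ : R => c) h) by (intros; apply continuous_const).
  assert (CE4 : continuous (fun h => 60 * E4 h) h).
  { unfold E4. apply (continuous_mult (fun _ => 60)); [apply K|].
    apply (continuous_plus (fun h => 1 / 45 + csum 2 h) (fun h => 2 / 3 * csum 1 h)).
    - apply (continuous_plus (fun _ => 1 / 45) (csum 2)); [apply K|exact C2].
    - apply (continuous_mult (fun _ => 2 / 3) (csum 1)); [apply K|exact C1]. }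
  assert (CE6 : continuous (fun h => 140 * E6 h) h).
  { unfold E6. apply (continuous_mult (fun _ => 140)); [apply K|].
    apply (continuous_plus (fun h => -2 / 945 + csum 3 h + csum 2 h) (fun h => 2 / 15 * csum 1 h)).
    - apply (continuous_plus (fun h => -2 / 945 + csum 3 h) (csum 2)); [|exact C2].
      apply (continuous_plus (fun _ => -2 / 945) (csum 3)); [apply K|exact C3].
    - apply (continuous_mult (fun _ => 2 / 15) (csum 1)); [apply K|exact C1]. }
  unfold mismatch.
  apply (continuous_minus (fun h => 140 * E6 h * (g2 * sqrt g2)) (fun h => g3 * (60 * E4 h * sqrt (60 * E4 h)))).
  - apply (continuous_mult (fun h => 140 * E6 h) (fun _ => g2 * sqrt g2)); [exact CE6|apply K].
  - apply (continuous_mult (fun _ => g3) (fun h => 60 * E4 h * sqrt (60 * E4 h))); [apply K|].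
    apply (continuous_mult (fun h => 60 * E4 h) (fun h => sqrt (60 * E4 h))); [exact CE4|].
    apply (continuous_comp (fun h => 60 * E4 h) sqrt); [exact CE4|apply continuous_sqrt].
Qed.

Lemma mismatch_root (g2 g3 : R) : 0 < g2 -> 27 * g3 ^ 2 < g2 ^ 3 ->
  exists h, 0 < h /\ mismatch g2 g3 h = 0.
Proof.
  intros H2 H3. pose proof PI_RGT_0 as Hpi.
  destruct (mismatch_neg g2 g3 H2 H3) as [h1 [P1 N1]].
  destruct (mismatch_neg g2 (- g3) H2) as [k [P2 N2]].
  { replace ((- g3) ^ 2) with (g3 ^ 2) by ring. exact H3. }
  set (h2 := PI ^ 2 / k). assert (Ph2 : 0 < h2) by (unfold h2; apply Rdiv_lt_0_compat; nra).
  assert (N3 : 0 < mismatch g2 g3 h2).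
  { unfold h2. rewrite mismatch_reciprocal by exact P2.
    assert (0 < (k / PI) ^ 6) by (apply pow_lt, Rdiv_lt_0_compat; lra). nra. }
  assert (Cm : forall x, 0 < x -> continuity_pt (mismatch g2 g3) x)
    by (intros x Hx; apply continuity_pt_filterlim, continuous_mismatch, Hx).
  destruct (Rtotal_order h1 h2) as [L|[L|L]].
  - destruct (IVT_interv (mismatch g2 g3) h1 h2) as [z [Hz E]]; try assumption.
    + intros x Hx. apply Cm. lra.
    + exists z. split; [lra|exact E].
  - subst h1. lra.
  - destruct (IVT_interv (fun x => - mismatch g2 g3 x) h2 h1) as [z [Hz E]]; try lra.
    + intros x Hx. apply continuity_pt_opp, Cm. lra.
    + exists z. split; lra.
Qed.

(** A root of [mismatch] fixes the shape of the lattice, and [c] its size. The second arc belongs to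
    the lattice turned by a right angle: its shape is [PI^2 / h], and the scale [PI c / h] makes its
    half-period [b]. *)
Lemma rectangular_lattice_exists (g2 g3 : R) : 0 < g2 -> 27 * g3 ^ 2 < g2 ^ 3 ->
  exists a b p dp q dq, 0 < a /\ 0 < b /\
    lattice_has_invariants (RtoC a) (Cmult Ci (RtoC b)) (RtoC g2) (RtoC g3) /\
    wp_arc g2 g3 a p dp /\ wp_arc g2 (- g3) b q dq.
Proof.
  intros H2 H3. pose proof PI_RGT_0 as Hpi.
  destruct (mismatch_root g2 g3 H2 H3) as [h [Hh M]].
  pose proof (E4_pos h Hh) as HE.
  set (E := 60 * E4 h). assert (HE' : 0 < E) by (unfold E; lra).
  assert (Hq : 0 < g2 / E) by (apply Rdiv_lt_0_compat; lra).
  pose proof (sqrt_lt_R0 _ Hq) as Hq1. pose proof (sqrt_lt_R0 _ Hq1) as Hq2.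
  (* Chosen so that [c^4 * (60 E4 h) = g2]; the vanishing of [mismatch] then gives
     [c^6 * (140 E6 h) = g3]. *)
  set (c := sqrt (sqrt (g2 / E))) in *.
  assert (Ec2 : c ^ 2 = sqrt (g2 / E)) by (unfold c; rewrite pow2_sqrt; lra).
  assert (Ec4 : c ^ 4 * E = g2).
  { replace (c ^ 4) with ((c ^ 2) ^ 2) by ring. rewrite Ec2, pow2_sqrt by lra. field. lra. }
  assert (Ec6 : c ^ 6 * (140 * E6 h) = g3).
  { unfold mismatch in M. fold E in M.
    pose proof (sqrt_lt_R0 _ HE') as HsE.
    replace (c ^ 6) with ((c ^ 2) ^ 2 * c ^ 2) by ring. rewrite Ec2, pow2_sqrt by lra.
    rewrite sqrt_div by lra.
    apply Rmult_eq_reg_r with (E * sqrt E); [|nra].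
    transitivity (140 * E6 h * (g2 * sqrt g2)); [field; lra|lra]. }
  set (a := h / (2 * c)). set (b := PI / (2 * c)).
  assert (Ha : 0 < a) by (apply Rdiv_lt_0_compat; lra).
  assert (Hb : 0 < b) by (apply Rdiv_lt_0_compat; lra).
  pose proof (arc_scale _ _ _ c _ _ (lattice_arc h Hh) Hq2) as A1. fold E in A1.
  rewrite Ec4, Ec6 in A1. replace (h / 2 / c) with a in A1 by (unfold a; field; lra).
  assert (Hh' : 0 < PI ^ 2 / h) by (apply Rdiv_lt_0_compat; nra).
  assert (Hc' : 0 < PI * c / h) by (apply Rdiv_lt_0_compat; nra).
  pose proof (arc_scale _ _ _ (PI * c / h) _ _ (lattice_arc (PI ^ 2 / h) Hh') Hc') as A2.
  rewrite E4_reciprocal, E6_reciprocal in A2 by exact Hh.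
  replace ((PI * c / h) ^ 4 * (60 * ((h / PI) ^ 4 * E4 h))) with g2 in A2
    by (rewrite <- Ec4; unfold E; field; lra).
  replace ((PI * c / h) ^ 6 * (140 * - ((h / PI) ^ 6 * E6 h))) with (- g3) in A2
    by (rewrite <- Ec6; field; lra).
  replace (PI ^ 2 / h / 2 / (PI * c / h)) with b in A2 by (unfold b; field; lra).
  eexists a, b, _, _, _, _.
  split; [exact Ha|]. split; [exact Hb|]. split; [|split; [exact A1|exact A2]].
  pose proof (invariants_rectangular a b Ha Hb) as L.
  replace (PI / (2 * b)) with c in L by (unfold b; field; lra).
  replace (PI * a / b) with h in L by (unfold a, b; field; lra).
  fold E in L. rewrite Ec4, Ec6 in L. exact L.
Qed.

Lemma cub_discriminant (k : R) : 0 < k < 1 -> 0 < cub2 k /\ 27 * cub3 k ^ 2 < cub2 k ^ 3.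
Proof.
  intros Hk. unfold cub2, cub3. assert (HL : 0 < 1 - k ^ 2 < 1) by nra. set (L := 1 - k ^ 2) in *.
  split; [lra|].
  assert (0 < L * (1 - L) ^ 3) by (apply Rmult_lt_0_compat; [lra|apply pow_lt; lra]).
  enough (E : (4 / 27 * (8 * L + 1)) ^ 3 - 27 * (8 / 729 * (8 * L ^ 2 + 20 * L - 1)) ^ 2 = 4096 / 19683 * (L * (1 - L) ^ 3)) by lra.
  field.
Qed.

Theorem theorem10 (kappa : R) (hk0 : 0 < kappa) (hk1 : kappa < 1) :
  let lambda := sqrt (1 - kappa ^ 2) in
  let g2 := 4 / 27 * (8 * lambda ^ 2 + 1) in
  let g3 := 8 / 729 * (8 * lambda ^ 4 + 20 * lambda ^ 2 - 1) in
  let omega := 1 / 2 * PI * hyp2F1 (1/3) (2/3) 1 (kappa ^ 2) in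
  let omega' := Cmult Ci (RtoC (sqrt 3 / 2 * PI * hyp2F1 (1/3) (2/3) 1 (lambda ^ 2))) in
  0 < omega /\ 0 < Im omega' /\ Re omega' = 0 /\
  lattice_has_invariants (RtoC omega) omega' (RtoC g2) (RtoC g3).
Proof.
  intros lambda g2 g3 omega omega'.
  assert (Hk2 : 0 < 1 - kappa ^ 2 < 1) by nra.
  assert (Hl2 : lambda ^ 2 = 1 - kappa ^ 2) by (unfold lambda; apply pow2_sqrt; lra).
  assert (Hl : 0 < lambda < 1).
  { split; [apply sqrt_lt_R0; lra|]. assert (0 < lambda) by (apply sqrt_lt_R0; lra). nra. }
  assert (Hk : 0 < kappa < 1) by lra.
  destruct (cub_discriminant kappa Hk) as [Dk1 Dk2]. destruct (cub_discriminant lambda Hl) as [Dl1 Dl2].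
  destruct (rectangular_lattice_exists _ _ Dk1 Dk2) as (a & b & p & dp & q & dq & Ha & Hb & Lat & Ap & Aq).
  (* From the lattice of [lambda] only the real arc is kept: its length is known by [arc_length],
     and the isogeny carries it over to [kappa]. *)
  destruct (rectangular_lattice_exists _ _ Dl1 Dl2) as (a' & b' & p' & dp' & _ & _ & _ & _ & _ & Ap' & _).
  pose proof (arc_length kappa a p dp Hk Ap) as Ea.
  pose proof (arc_length lambda a' p' dp' Hl Ap') as Ea'.
  pose proof (arc_isogeny kappa lambda a' p' dp' Hk Hl ltac:(lra) Ap') as Iso. cbv zeta in Iso.
  assert (H3 : 0 < sqrt 3 /\ sqrt 3 ^ 2 = 3) by (split; [apply sqrt_lt_R0; lra|apply pow2_sqrt; lra]).
  (* Scaled by [sqrt 3], the imaginary arc of [kappa] has the invariants of the isogenous arc of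
     [lambda]; uniqueness of the length then gives [a' = b / sqrt 3]. *)
  pose proof (arc_scale _ _ _ (sqrt 3) _ _ Aq (proj1 H3)) as As.
  replace (sqrt 3 ^ 4 * cub2 kappa) with (9 * cub2 kappa) in As
    by (replace (sqrt 3 ^ 4) with ((sqrt 3 ^ 2) ^ 2) by ring; rewrite (proj2 H3); ring).
  replace (sqrt 3 ^ 6 * - cub3 kappa) with (- (27 * cub3 kappa)) in As
    by (replace (sqrt 3 ^ 6) with ((sqrt 3 ^ 2) ^ 3) by ring; rewrite (proj2 H3); ring).
  pose proof (arc_length_unique _ _ _ _ _ _ _ _ Iso As) as Eb.
  assert (Eom : omega = a) by (rewrite Ea; unfold omega; field).
  assert (Eom' : omega' = Cmult Ci (RtoC b)).
  { unfold omega'. do 2 f_equal. replace b with (sqrt 3 * a') by (rewrite Eb; field; lra). rewrite Ea'. field. }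
  replace g2 with (cub2 kappa) by (unfold g2, cub2; rewrite Hl2; reflexivity).
  replace g3 with (cub3 kappa)
    by (unfold g3, cub3; replace (lambda ^ 4) with ((lambda ^ 2) ^ 2) by ring; rewrite Hl2; reflexivity).
  rewrite Eom, Eom'. split; [exact Ha|]. split; [simpl; lra|]. split; [simpl; lra|exact Lat].
Qed.
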